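(* Let $d\ge1$, let $\Omega\subset\mathbb{R}^d$ be an open bounded hyperrectangle, let $\alpha>0$, and for $f,u\in L^2(\Omega)$ put $E(u;f)=\frac12\|u-f\|_{L^2(\Omega)}^2+\alpha J(u)$ and $u_f=\operatorname{arg\,min}_{u\in L^2(\Omega)}E(u;f)$, where $J$ is the $\ell^1$-anisotropic total variation. Let $(G_k)$ be a sequence of grids on $\Omega$ with mesh sizes $h(G_k)\to0$ as $k\to\infty$, and let $A_{G_k}$ be the associated averaging operators. Then, as $k\to\infty$, the following hold. 1. If $f\in L^2(\Omega)$, then $$\|u_{A_{G_k}f}-u_f\|_{L^2}\to0,\qquad J(u_{A_{G_k}f})\to J(u_f),\qquad E(u_{A_{G_k}f};A_{G_k}f)\to E(u_f;f).$$ 2. If $f\in L^q(\Omega)$, $2\le q\le\infty$, then $$\|u_{A_{G_k}f}-u_f\|_{L^2}=\mathcal{O}\big(h(G_k)^{\frac12-\frac{q'}{2q}}\big),\qquad |J(u_{A_{G_k}f})-J(u_f)|=\mathcal{O}\big(h(G_k)^{\frac12-\frac{q'}{2q}}\big).$$ If in addition $d=1$, then $$\|u_{A_{G_k}f}-u_f\|_{L^2}=\mathcal{O}\big(h(G_k)^{\frac12-\frac{1}{2q}}\big),\qquad |J(u_{A_{G_k}f})-J(u_f)|=\mathcal{O}\big(h(G_k)^{\frac12-\frac{1}{2q}}\big).$$ 3. If $f\in L^q(\Omega)\cap BV(\Omega)$, $2\le q\le\infty$, then $$|E(u_{A_{G_k}f};A_{G_k}f)-E(u_f;f)|=\mathcal{O}\big(h(G_k)^{1-\frac{q'}{q}}\big).$$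 If in addition $d=1$, then $$|E(u_{A_{G_k}f};A_{G_k}f)-E(u_f;f)|=\mathcal{O}\big(h(G_k)^{1-\frac1q}\big).$$
   Context: $\Omega=a+\prod_{i=1}^d(0,l_i)$ with $a\in\mathbb{R}^d$, $l\in\mathbb{R}^d_{>0}$. $J:L^2(\Omega)\to[0,+\infty]$ is the $\ell^1$-anisotropic total variation $$J(u)=\sup\Big\{\int_\Omega u\,\mathrm{div}\,H\,dx : H\in C_c^\infty(\Omega,\mathbb{R}^d),\ |H(x)|_\infty\le 1\ \text{for all }x\in\Omega\Big\},$$ where $|\cdot|_\infty$ is the maximum norm. $BV(\Omega)$ is the set of $u\in L^1(\Omega)$ for which the same supremum is finite. $J$ is proper, convex and lower semicontinuous, so $u_f$ exists and is unique. A grid $G$ on $\Omega$ is a finite collection of affine hyperplanes of $\mathbb{R}^d$, each orthogonal to one of the coordinate axes, with $\partial\Omega\subset\bigcup G$. It defines the partition $\mathcal{Q}(G)=\{R_1,\dots,R_n\}$ of $\Omega$ (up to a null set) into open hyperrectangles, namely the connected components of $\Omega\setminus\bigcup G$. The mesh size $h(G)$ is the greatest side length among all hyperrectangles in $\mathcal{Q}(G)$. The averaging operator is $A_Gg=\sum_{i=1}^n g_{R_i}\mathbf{1}_{R_i}$ for $g\in L^1(\Omega)$, with $g_R=\frac1{|R|}\int_R g\,dx$. $q'$ is the Hölder conjugate of $q$, $\frac1q+\frac1{q'}=1$; conventions: $\frac1q=\frac{q'}{q}=0$ for $q=\infty$. *)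

(* Defs.v *)
From HB Require Import structures.
From mathcomp Require Import all_boot all_order all_algebra.
From mathcomp Require Import finmap.
From mathcomp Require Import all_classical all_reals all_analysis.

Set Implicit Arguments.
Unset Strict Implicit.
Unset Printing Implicit Defensive.

Import Order.TTheory GRing.Theory Num.Theory.
Import numFieldNormedType.Exports.

Local Open Scope classical_set_scope.
Local Open Scope ring_scope.

Definition measure_rV_display : measure_display -> measure_display.
Proof. exact. Qed.

Section measurable_rV.
Context {d : measure_display} {T : measurableType d}.
Variable n : nat.

Let coors : 'I_n -> 'rV[T]_n -> T := fun i x => x ord0 i.

Let rV_set0 : g_sigma_preimage coors set0.
Proof. exact: sigma_algebra0. Qed.

Let rV_setC A : g_sigma_preimage coors A -> g_sigma_preimage coors (~` A).
Proof. exact: sigma_algebraC. Qed.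

Let rV_bigcup (F : (set 'rV[T]_n)^nat) :
  (forall i, g_sigma_preimage coors (F i)) ->
  g_sigma_preimage coors (\bigcup_i (F i)).
Proof. exact: sigma_algebra_bigcup. Qed.

HB.instance Definition _ := @isMeasurable.Build (measure_rV_display d)
  'rV[T]_n (g_sigma_preimage coors) rV_set0 rV_setC rV_bigcup.

Lemma measurable_rV_coord (i : 'I_n) :
  measurable_fun [set: 'rV[T]_n] (fun x : 'rV[T]_n => x ord0 i).
Proof.
move=> _ Y mY; rewrite setTI; apply: sub_sigma_algebra => /=.
rewrite -bigcup_seq/=; exists i => /=; first by rewrite mem_index_enum.
by exists Y => //; rewrite setTI.
Qed.

End measurable_rV.

Lemma measurable_fun_rVP d1 d2 (T1 : measurableType d1)
    (T2 : measurableType d2) n (f : T1 -> 'rV[T2]_n) :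
  measurable_fun [set: T1] f <->
  forall i, measurable_fun [set: T1] (fun x => f x ord0 i).
Proof.
split=> [mf i|mf].
  by apply: (measurableT_comp (measurable_rV_coord i)).
move=> _ A mA; rewrite setTI.
suff : preimage_set_system [set: T1] f (@measurable _ 'rV[T2]_n)
         `<=` measurable.
  by apply; exists A => //; rewrite setTI.
rewrite -[X in preimage_set_system _ _ X]/(g_sigma_preimage _).
rewrite -g_sigma_preimageE; apply: smallest_sub.
  exact: sigma_algebra_measurable.
move=> B [C + <-].
rewrite -bigcup_seq/= => -[i _ [D mD <-]].
rewrite !setTI -comp_preimage -[X in measurable X]setTI.
exact: mf.
Qed.

Definition cons_rV {T : Type} n (p : T * 'rV[T]_n) : 'rV[T]_n.+1 :=
  \row_i (if unlift ord0 i is Some j then p.2 ord0 j else p.1).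

Lemma measurable_cons_rV d (T : measurableType d) n :
  measurable_fun [set: T * 'rV[T]_n] (@cons_rV T n).
Proof.
apply/measurable_fun_rVP => i.
case: (unliftP ord0 i) => [j ->|->].
  rewrite (_ : (fun _ => _) = (fun x : 'rV[T]_n => x ord0 j) \o snd); last first.
    by apply/funext => p /=; rewrite mxE liftK.
  apply: measurableT_comp; last exact: measurable_snd.
  exact: measurable_rV_coord.
rewrite (_ : (fun _ => _) = fst); first exact: measurable_fst.
by apply/funext => p /=; rewrite mxE unlift_none.
Qed.

Section cons_measure.
Context {R : realType} (n : nat).
Variable m : {sigma_finite_measure set 'rV[R]_n -> \bar R}.
Local Open Scope ereal_scope.

Definition cons_measure : set 'rV[R]_n.+1 -> \bar R :=
  pushforward (@lebesgue_measure R \x m) (@cons_rV R n).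

Let cons_measure0 : cons_measure set0 = 0.
Proof. by rewrite /cons_measure /pushforward preimage_set0 measure0. Qed.

Let cons_measure_ge0 A : 0 <= cons_measure A.
Proof. by rewrite /cons_measure /pushforward measure_ge0. Qed.

Let cons_measure_sigma_additive : semi_sigma_additive cons_measure.
Proof.
have mc A : measurable A -> measurable (@cons_rV R n @^-1` A).
  by move=> mA; rewrite -[X in measurable X]setTI; exact: measurable_cons_rV.
move=> F mF tF mUF; rewrite /cons_measure /pushforward preimage_bigcup.
apply: measure_semi_sigma_additive.
- by move=> k; exact: mc.
- apply/trivIsetP => /= i j _ _ ij; rewrite -preimage_setI.
  by move/trivIsetP : tF => /(_ _ _ _ _ ij) ->//; rewrite preimage_set0.
- by rewrite -preimage_bigcup; exact: mc.
Qed.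

HB.instance Definition _ := isMeasure.Build _ _ _ cons_measure
  cons_measure0 cons_measure_ge0 cons_measure_sigma_additive.

Let cons_measure_sigma_finite : sigma_finite setT cons_measure.
Proof.
have [F [TF mF]] : exists F : (set (R * 'rV[R]_n))^nat,
    setT = \bigcup_k F k /\
    forall k, measurable (F k) /\ (@lebesgue_measure R \x m) (F k) < +oo.
  have /sigma_finiteP[A [TA ndA Aoo]] := sigma_finiteT (@lebesgue_measure R).
  have /sigma_finiteP[B [TB ndB Boo]] := sigma_finiteT m.
  exists (fun k => A k `*` B k); split.
    rewrite -setXTT TA TB predeqE => -[x y]; split.
      move=> [/= [i _ Aix] [j _ Bjy]]; exists (maxn i j) => //; split.
      - by move: x Aix; exact/subsetPset/ndA/leq_maxl.
      - by move: y Bjy; exact/subsetPset/ndB/leq_maxr.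
    by move=> [k _ []/= ? ?]; split; exists k.
  move=> k; have [? ?] := Aoo k; have [? ?] := Boo k.
  split; first exact: measurableX.
  by rewrite product_measure1E// lte_mul_pinfty// ge0_fin_numE.
pose g (x : 'rV[R]_n.+1) : R * 'rV[R]_n :=
  (x ord0 ord0, \row_j x ord0 (lift ord0 j)).
have gK : cancel (@cons_rV R n) g.
  move=> [r v]; rewrite /g !mxE unlift_none; congr pair.
  by apply/rowP => j; rewrite !mxE liftK.
have mg : measurable_fun setT g.
  apply/measurable_fun_pairP; split; first exact: measurable_rV_coord.
  apply/measurable_fun_rVP => i.
  rewrite (_ : (fun _ => _) =
    (fun x : 'rV[R]_n.+1 => x ord0 (lift ord0 i))); first exact: measurable_rV_coord.
  by apply/funext => x /=; rewrite mxE.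
exists (fun k => g @^-1` F k).
  by rewrite -preimage_bigcup -TF preimage_setT.
move=> k; have [mFk Fk] := mF k; split.
  by rewrite -[X in measurable X]setTI; exact: mg.
rewrite /cons_measure /pushforward -comp_preimage (_ : _ \o _ = id)//.
by apply/funext => x /=; exact: gK.
Qed.

HB.instance Definition _ := Measure_isSigmaFinite.Build _ _ _ cons_measure
  cons_measure_sigma_finite.

End cons_measure.

Fixpoint lebesgue_rV {R : realType} (n : nat) :
    {sigma_finite_measure set 'rV[R]_n -> \bar R} :=
  if n is n'.+1 then cons_measure (lebesgue_rV n')
  else @dirac _ 'rV[R]_0 0 R.

Section geometry.
Context {R : realType} {d : nat}.
Implicit Types (a l x : 'rV[R]_d) (Omega P : set 'rV[R]_d).

Definition hyperrectangle a l : set 'rV[R]_d :=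
  [set x | forall i, a ord0 i < x ord0 i < a ord0 i + l ord0 i].

Lemma measurable_hyperrectangle a l : measurable (hyperrectangle a l).
Proof.
rewrite (_ : hyperrectangle a l = \bigcap_(i in [set: 'I_d])
  ((fun x : 'rV[R]_d => x ord0 i) @^-1`
     `]a ord0 i, a ord0 i + l ord0 i[%classic)).
  apply: fin_bigcap_measurable; first exact: finite_finset.
  move=> i _; rewrite -[X in measurable X]setTI.
  by apply: measurable_rV_coord => //; exact: measurable_itv.
by apply/seteqP; split=> x xP i; have := xP i; rewrite /= in_itv/=; exact.
Qed.


(* A pair (i, c) stands for the hyperplane x_i = c. *)
Definition hyperplane (p : 'I_d * R) : set 'rV[R]_d :=
  [set x | x ord0 p.1 = p.2].

Definition grid_support (G : {fset 'I_d * R}) : set 'rV[R]_d :=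
  \bigcup_(p in [set` G]) hyperplane p.

Definition is_grid Omega (G : {fset 'I_d * R}) : Prop :=
  closure Omega `\` Omega° `<=` grid_support G.

Definition cells Omega (G : {fset 'I_d * R}) : set (set 'rV[R]_d) :=
  [set connected_component (Omega `\` grid_support G) x
     | x in Omega `\` grid_support G].

Definition side_length P (i : 'I_d) : R :=
  sup [set x ord0 i | x in P] - inf [set x ord0 i | x in P].

Definition mesh_size Omega (G : {fset 'I_d * R}) : R :=
  sup [set side_length p.1 p.2 | p in cells Omega G `*` [set: 'I_d]].

Definition mean (g : 'rV[R]_d -> R) P : R :=
  (fine (lebesgue_rV d P))^-1 * \int[lebesgue_rV d]_(x in P) g x.

(* \sum_(P \in _) is a finitely supported sum; [cells Omega G] is finite. *)
Definition averaging Omega (G : {fset 'I_d * R}) (g : 'rV[R]_d -> R)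
    : 'rV[R]_d -> R :=
  fun x => \sum_(P \in cells Omega G) mean g P * \1_P x.

End geometry.

Lemma lebesgue_rV_hyperrectangle (R : realType) (n : nat) (a l : 'rV[R]_n) :
  (forall i, 0 <= l ord0 i) ->
  lebesgue_rV n (hyperrectangle a l) = (\prod_(i < n) l ord0 i)%:E.
Proof.
elim: n a l => [|n IH] a l l0.
  rewrite big_ord0 /= diracE (_ : _ \in _ = true)//.
  by apply/mem_set => -[].
pose a' : 'rV[R]_n := \row_i a ord0 (lift ord0 i).
pose l' : 'rV[R]_n := \row_i l ord0 (lift ord0 i).
rewrite /= /cons_measure /pushforward.
rewrite (_ : _ @^-1` _ = `]a ord0 ord0, a ord0 ord0 + l ord0 ord0[%classic
    `*` hyperrectangle a' l'); last first.
  apply/seteqP; split=> -[x v] /=.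
    move=> H; split.
      by have := H ord0; rewrite mxE unlift_none /= in_itv.
    by move=> i; have := H (lift ord0 i); rewrite !mxE liftK.
  move=> [xI vI] i; rewrite mxE; case: (unliftP ord0 i) => [j ->|->] /=.
    by have := vI j; rewrite !mxE.
  by move: xI; rewrite in_itv.
rewrite product_measure1E//; last exact: measurable_hyperrectangle.
rewrite IH; last by move=> i; rewrite mxE.
have /= -> := lebesgue_measure_itv `]a ord0 ord0, a ord0 ord0 + l ord0 ord0[.
rewrite big_ord_recl EFinM lte_fin ltrDl; congr (_ * _)%E; last first.
  by congr EFin; apply: eq_bigr => i _; rewrite mxE.
have := l0 ord0; rewrite le_eqVlt => /predU1P[<-|l00]; first by rewrite ltxx.
by rewrite l00 -EFinB addrAC subrr add0r.
Qed.

Section total_variation.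
Context {R : realType} {d : nat}.
Implicit Types (Omega : set 'rV[R]_d) (u f : 'rV[R]_d -> R).

Definition partial (W : normedModType R) (i : 'I_d) (F : 'rV[R]_d -> W)
    : 'rV[R]_d -> W :=
  fun x => derive F x (delta_mx ord0 i).

Fixpoint continuously_differentiable (W : normedModType R) (n : nat)
    (F : 'rV[R]_d -> W) : Prop :=
  continuous F /\
  if n is n'.+1 then
    forall i, (forall x, derivable F x (delta_mx ord0 i)) /\
              continuously_differentiable n' (partial i F)
  else True.

Definition smooth (W : normedModType R) (F : 'rV[R]_d -> W) : Prop :=
  forall n, continuously_differentiable n F.

Definition divergence (H : 'rV[R]_d -> 'rV[R]_d) (x : 'rV[R]_d) : R :=
  \sum_(i < d) partial i (fun y => H y ord0 i : R^o) x.

(* C_c^oo(Omega, R^d), each field being extended by zero to the whole space.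
   The norm of 'rV[R]_d is the maximum norm. *)
Definition test_fields Omega : set ('rV[R]_d -> 'rV[R]_d) :=
  [set H | [/\ smooth H,
               compact (closure [set x | H x != 0]),
               closure [set x | H x != 0] `<=` Omega &
               forall x, Omega x -> `|H x| <= 1]].

Definition TV Omega u : \bar R :=
  ereal_sup
    [set (\int[lebesgue_rV d]_(x in Omega) (u x * divergence H x)%:E)%E
    | H in test_fields Omega].

End total_variation.

Section rof.
Context {R : realType} {d : nat}.
Variables a l : 'rV[R]_d.
Implicit Types f u : 'rV[R]_d -> R.

Let Omega := hyperrectangle a l.

(* Functions on Omega are represented by measurable functions on the whole
   space, whose values outside Omega do not matter; thus L^q(Omega) is
   [Lfun (lebesgue_on a l) q], up to equality almost everywhere. *)
Definition lebesgue_on : {measure set 'rV[R]_d -> \bar R} :=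
  mrestr (lebesgue_rV d) (measurable_hyperrectangle a l).

Definition Lnorm_on (p : \bar R) u : \bar R :=
  ('N[lebesgue_on]_p [EFin \o u])%E.

Definition is_BV u : Prop := u \in Lfun lebesgue_on 1%E /\ (TV Omega u < +oo)%E.

Definition energy (alpha : R) f u : \bar R :=
  ((2^-1)%R%:E * Lnorm_on 2%:E (u \- f)%R ^+ 2 + alpha%:E * TV Omega u)%E.

Definition is_minimizer (alpha : R) f u : Prop :=
  u \in Lfun lebesgue_on 2%:E /\
  forall v, v \in Lfun lebesgue_on 2%:E ->
    (energy alpha f u <= energy alpha f v)%E.

End rof.

(* The finiteness clause is needed because [fine] maps infinities to 0. *)
Definition ereal_bigO {R : realType} (e : nat -> \bar R) (b : nat -> R) : Prop :=
  (\forall k \near \oo, e k \is a fin_num) /\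
  (fun k => fine (e k) : R^o) =O_\oo (fun k => b k : R^o).

(* q' / q; the library conventions give 0 for q = +oo. *)
Definition conj_ratio {R : realType} (q : \bar R) : R :=
  fine (hoelder_conjugate q / q)%E.

(* Main.v *)
(** Let A be the averaging operator of a grid of mesh size h, let u minimize
    E(.; f) and let v minimize E(.; A f). Smooth fields approximating fields
    that are piecewise constant on the cells show that a step function whose
    values differ from cell to cell by at most the differences of the cell means
    of w has variation at most J(w). In particular J(A w) <= J(w), so v = A v,
    and comparing the Euler-Lagrange inequalities of u and v gives
      ||u - v||^2 <= <f, u - A u>,  alpha |J(v) - J(u)| <= ||u - f|| ||u - v||,
      0 <= E(u; f) - E(v; A f) <= <f, f - A f> / 2.
    Bisecting the grid in one direction after the other, with the signs of the
    new jumps as test field, gives ||w - A w||_1 <= d h J(w). The rates follow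
    by splitting <f, w - A w> at |f| = M with M = h^(-1/(q-1)), which requires
    u in L^q: the variational inequality for v is tested with
    v - e sgn(v) |v|^(q-1), and the resulting bound passes to the limit. In
    dimension one w is bounded by its variation and M = h^(-1/q) is possible. *)

(* [J] is handled by duality alone: a lower bound on [J] comes from one explicit field, an upper
   bound from an estimate valid for all fields, so neither traces nor measure-valued derivatives
   occur. In particular [J(A w) <= J(w)] is shown by turning each field for [A w] into a field for
   [w].

   The bisection inequality controls [w - A w] in L^1 only, while [f] may be unbounded; this forces
   the truncation. Splitting at [M] leaves a main part [M h] and a tail [M^(2-q)], and the stated
   [M] makes them equal, which gives h^(1 - 1/(q-1)) with 1/(q-1) = q'/q. For bounded [w] the tail
   is [M^(1-q)], whence the exponent 1 - 1/q. Distances get half the exponent because their squares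
   are estimated.

   The L^q bound is proved for [v] and passed on to [u], since [v] has finitely many values: on a
   finite set of values t - e sgn(t)|t|^(q-1) does not increase differences for e small, whereas for
   q > 2 it does so on the whole line, however small e is. *)
Require Import Defs.
From mathcomp Require Import all_boot all_order all_algebra.
From mathcomp Require Import finmap.
From mathcomp Require Import all_classical all_reals all_analysis.
From mathcomp Require Import measurable_realfun.
From mathcomp Require Import ring lra.

Set Implicit Arguments.
Unset Strict Implicit.
Unset Printing Implicit Defensive.

Import Order.TTheory GRing.Theory Num.Theory.
Import numFieldNormedType.Exports.
Import HBNNSimple.

Local Open Scope classical_set_scope.
Local Open Scope ring_scope.

(** * Smooth profiles *)

Section smooth_one_variable.
Context {R : realType}.
Implicit Types (f g : R -> R) (x c eps : R) (m n : nat).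

(** The derivative is an existential witness rather than a computed limit, so that closure
    properties can name it explicitly and proceed by induction on [n]. *)
Fixpoint Cn n f : Prop :=
  (forall x, {for x, continuous f}) /\
  if n is n'.+1 then
    exists g, (forall x, is_derive x (1 : R) f (g x)) /\ Cn n' g
  else True.

Lemma Cn_continuous n f : Cn n f -> continuous f.
Proof. by case: n => [|n] [cf _] x; exact: cf. Qed.

Lemma CnW n f : Cn n.+1 f -> Cn n f.
Proof.
elim: n f => [|n IH] f [cf [g [fg Cg]]]; split=> //.
by exists g; split => //; exact: IH.
Qed.

Lemma Cn_cst n c : Cn n (cst c).
Proof.
elim: n c => [|n IH] c; first by split=> // x; exact: cst_continuous.
split; first by move=> x; exact: cst_continuous.
by exists (cst 0); split=> [x|//]; exact: is_derive_cst.
Qed.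

Lemma Cn_id n : Cn n id.
Proof.
have cid x : {for x, continuous (@id R)} by move=> ? ?.
case: n => [|n]; split=> //.
by exists (cst 1); split=> [x|]; [exact: is_derive_id|exact: Cn_cst].
Qed.

Lemma CnD n f g : Cn n f -> Cn n g -> Cn n (fun x => f x + g x).
Proof.
elim: n f g => [|n IH] f g [cf +] [cg +].
  by move=> _ _; split=> // x; apply: continuousD; [exact: cf|exact: cg].
move=> [f' [df Cf]] [g' [dg Cg]]; split.
  by move=> x; apply: continuousD; [exact: cf|exact: cg].
exists (fun x => f' x + g' x); split; last exact: IH.
by move=> x; exact: is_deriveD.
Qed.

Lemma CnM n f g : Cn n f -> Cn n g -> Cn n (fun x => f x * g x).
Proof.
elim: n f g => [|n IH] f g Cf Cg.
  by split=> // x; apply: continuousM; [case: Cf => + _|case: Cg => + _]; exact.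
move: (Cf) (Cg) => [cf [f' [df Cf']]] [cg [g' [dg Cg']]]; split.
  by move=> x; apply: continuousM; [exact: cf|exact: cg].
exists (fun x => f x * g' x + g x * f' x); split.
  by move=> x; exact: is_deriveM.
by apply: CnD; apply: IH => //; exact: CnW.
Qed.

(** The derivative -f'/f^2 contains 1/f itself, so [f] stays fixed in the induction and the
    hypothesis is applied to 1/f one order lower. *)
Lemma Cn_inv n f : (forall x, f x != 0) -> Cn n f -> Cn n (fun x => (f x)^-1).
Proof.
move=> f0; elim: n => [|n IH] Cf.
  by split=> // x; apply: (@continuousV _ _ f) => //; case: Cf => + _; exact.
move: (Cf) => [cf [f' [df Cf']]]; split.
  by move=> x; apply: (@continuousV _ _ f) => //; exact: cf.
exists (fun x => (-1) * (((f x)^-1 * (f x)^-1) * f' x)); split.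
  move=> x; have [dfx dE] := df x; split.
    exact: (@derivableV _ _ f).
  by rewrite (deriveV (f0 x) dfx) dE /GRing.scale/=; field; rewrite f0.
apply: CnM; first exact: Cn_cst.
by apply: CnM => //; apply: CnM; apply: IH; exact: CnW.
Qed.

Lemma Cn_affine n k c f : Cn n f -> Cn n (fun x => f (k * x + c)).
Proof.
have da x : is_derive x (1 : R) (fun y => k * y + c) k.
  by apply: is_derive_eq; rewrite addr0 /GRing.scale/= mulr1.
have ca : continuous (fun y => k * y + c).
  by move=> x; apply/differentiable_continuous/derivable1_diffP; case: (da x).
have cfa g : (forall x, {for x, continuous g}) ->
    forall x, {for x, continuous (fun y => g (k * y + c))}.
  move=> cg x; apply: (@continuous_comp _ _ _ (fun y => k * y + c) g).
    exact: ca.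
  exact: cg.
elim: n f => [|n IH] f [cf]; first by move=> _; split=> //; exact: cfa.
move=> [f' [df Cf']]; split; first exact: cfa.
exists (fun x => k * f' (k * x + c)); split; last first.
  by apply: CnM; [exact: Cn_cst|exact: IH].
move=> x; rewrite mulrC; apply: (@is_derive1_comp _ f (fun y => k * y + c)).
Qed.

Lemma is_derive0_quadratic f (C : R) :
  (forall x, `|f x| <= C * x ^+ 2) -> is_derive (0 : R) (1 : R) f 0.
Proof.
move=> fC; have f0 : f 0 = 0.
  by apply/eqP; rewrite -normr_le0; have := fC 0; rewrite expr0n/= mulr0.
have C0 : 0 <= C by have := fC 1; rewrite expr1n mulr1; apply: le_trans.
have H : h^-1 *: (f (h *: (1 : R) + 0) - f 0) @[h --> (0 : R)^'] --> (0 : R).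
  apply/cvgrPdist_le => /= e e0; near=> h.
  have h0 : h != 0 by near: h; exact: nbhs_dnbhs_neq.
  rewrite f0 subr0 addr0 sub0r normrN /GRing.scale/= mulr1 normrM normfV.
  have h1 : 0 < `|h| by rewrite normr_gt0.
  rewrite ler_pdivrMl//; apply: (le_trans (fC h)).
  rewrite -real_normK ?num_real// expr2.
  have : `|h| <= e / (C + 1).
    near: h; apply: dnbhs0_le; rewrite divr_gt0//; lra.
  rewrite ler_pdivlMr; last lra.
  by move=> H; nra.
split; first by apply/cvg_ex; exists 0.
exact: cvg_lim.
Unshelve. all: by end_near. Qed.

(** The classical function exp(-eps/x) flat at 0, with a negative power of x in front:
    differentiation only raises [m], so the family spans a space closed under derivation. *)
Definition flat eps m x : R :=
  if 0 < x then (x^-1) ^+ m * expR (- (eps / x)) else 0.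

Lemma flat_ge0 eps m x : 0 <= flat eps m x.
Proof.
rewrite /flat; case: ifPn => // x0.
by rewrite mulr_ge0 ?expR_ge0// exprn_ge0// invr_ge0 ltW.
Qed.

Lemma flat_succ eps m x : flat eps m x = x * flat eps m.+1 x.
Proof.
rewrite /flat; case: ifPn => x0; last by rewrite mulr0.
by rewrite exprS; field; rewrite gt_eqF.
Qed.

(** Near 0 one term of the exponential series, (eps/x)^(m+1)/(m+1)!, beats the pole x^(-m) and even
    leaves a factor x; beyond 1 both factors are at most 1. *)
Lemma flat_bounded eps m : 0 < eps -> exists2 C, 0 <= C & forall x, flat eps m x <= C.
Proof.
move=> e0; exists (m.+1`!%:R * eps ^- m.+1 + 1 + m.+1`!%:R * eps ^- m.+1).
  by rewrite !addr_ge0// mulr_ge0// invr_ge0 exprn_ge0 ?ltW.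
move=> x; rewrite /flat; set C := m.+1`!%:R * _.
have C0 : 0 <= C by rewrite mulr_ge0// invr_ge0 exprn_ge0 ?ltW.
case: ifPn => x0; last by rewrite addr_ge0// addr_ge0.
have [x1|x1] := ltP 1 x.
  apply: (@le_trans _ _ 1); last lra.
  have xi0 : 0 <= x^-1 by rewrite invr_ge0 ltW.
  rewrite mulr_ile1 ?expR_ge0 ?exprn_ge0//.
    by rewrite exprn_ile1// ?invr_ge0 ?invf_le1//; exact: ltW.
  by rewrite expR_le1 oppr_le0 divr_ge0//; exact: ltW.
apply: (@le_trans _ _ C); last lra.
rewrite expRN.
have ex0 : 0 <= eps / x by rewrite divr_ge0 ?ltW.
have := expR_ge1Dxn m ex0 => H.
have H2 : (eps / x) ^+ m.+1 / m.+1`!%:R <= expR (eps / x) by lra.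
have H3 : 0 < (eps / x) ^+ m.+1 / m.+1`!%:R.
  by rewrite divr_gt0 ?ltr0n ?fact_gt0// exprn_gt0// divr_gt0.
apply: (@le_trans _ _ ((x^-1) ^+ m * ((eps / x) ^+ m.+1 / m.+1`!%:R)^-1)).
  apply: ler_wpM2l; first by rewrite exprn_ge0// invr_ge0 ltW.
  by rewrite lef_pV2// posrE expR_gt0.
have -> : x^-1 ^+ m / ((eps / x) ^+ m.+1 / m.+1`!%:R) = C * x.
  have xm : x ^+ m != 0 by rewrite gt_eqF// exprn_gt0.
  have em : eps ^+ m != 0 by rewrite gt_eqF// exprn_gt0.
  have fm : m.+1`!%:R != 0 :> R by rewrite gt_eqF// ltr0n fact_gt0.
  rewrite /C exprMn !exprVn !exprS; field.
  by rewrite xm em fm !gt_eqF.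
by rewrite ler_piMr.
Qed.

(** Away from 0 this is the chain rule. At 0 the function is y^2 times the bounded function
    [flat eps m.+2], hence has derivative 0 there. *)
Lemma flat_derive eps m : 0 < eps -> forall x,
  is_derive x (1 : R) (flat eps m)
    (eps * flat eps m.+2 x + (- m%:R) * flat eps m.+1 x).
Proof.
move=> e0 x; have [x0|x0|->] := ltgtP x 0.
- have -> : eps * flat eps m.+2 x + - m%:R * flat eps m.+1 x = 0.
    by rewrite /flat ltNge (ltW x0)/= !mulr0 addr0.
  apply: (@near_eq_is_derive R R R (cst 0)).
  near=> y; rewrite /flat ifF//; apply/negbTE; rewrite -leNgt.
  by apply: ltW; near: y; exact: lt_nbhsl.
- apply: (@near_eq_is_derive _ _ _ (fun x => (x^-1) ^+ m * expR (- (eps / x)))).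
    near=> y; rewrite /flat ifT//.
    by near: y; exact: lt_nbhsr.
  have dV : is_derive x (1 : R) (fun x : R => x^-1) (- x ^- 2).
    have xn0 : x != 0 by rewrite gt_eqF.
    split; first exact: (@derivableV _ _ id).
    by rewrite (@deriveV _ _ id _ 1 xn0 (@derivable_id _ _ _ _)) derive_id /GRing.scale/= mulr1.
  have dX : is_derive x (1 : R) (fun x : R => (x^-1) ^+ m)
      ((m%:R * (x^-1) ^+ m.-1) *: (- x ^- 2)).
    have := @is_deriveX _ _ (fun x : R => x^-1) m x 1 _ dV.
    by rewrite exprfctE/= -mulr_natl.
  have dN : is_derive x (1 : R) (fun x : R => - (eps / x)) (eps * x ^- 2).
    apply: is_derive_eq.
    by rewrite /GRing.scale/= mulrN opprK.
  have dE : is_derive x (1 : R) (fun x : R => expR (- (eps / x)))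
      (expR (- (eps / x)) * (eps * x ^- 2)).
    exact: (@is_derive1_comp _ expR (fun x : R => - (eps / x))).
  apply: is_derive_eq.
  rewrite /GRing.scale/= /flat x0.
  case: m dX => [|m] _.
    by rewrite !expr0 !mul0r !mulr0 !addr0 !expr2 oppr0 !mul0r addr0 mul1r; field; rewrite gt_eqF.
  by rewrite /= !exprS; field; rewrite gt_eqF.
- have -> : eps * flat eps m.+2 0 + - m%:R * flat eps m.+1 0 = 0.
    by rewrite /flat ltxx !mulr0 addr0.
  have [C C0 HC] := flat_bounded m.+2 e0.
  apply: (@is_derive0_quadratic _ C) => y.
  rewrite flat_succ flat_succ mulrA -expr2 normrM ger0_norm ?sqr_ge0//.
  rewrite mulrC ler_wpM2r ?sqr_ge0//.
  by rewrite ger0_norm ?flat_ge0.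
Unshelve. all: by end_near. Qed.

Lemma flat_Cn n eps m : 0 < eps -> Cn n (flat eps m).
Proof.
move=> e0; have cf k x : {for x, continuous (flat eps k)}.
  apply/differentiable_continuous/derivable1_diffP.
  by have [] := flat_derive k e0 x.
elim: n m => [|n IH] m; first by split=> // x; exact: cf.
split; first by move=> x; exact: cf.
exists (fun x => eps * flat eps m.+2 x + (- m%:R) * flat eps m.+1 x).
split; first exact: flat_derive.
by apply: CnD; apply: CnM => //; exact: Cn_cst.
Qed.

(* As eps tends to 0, [theta eps] below tends to the identity clamped to [0, 1]
   and its derivative [dtheta eps] tends boundedly to the indicator of ]0, 1[. *)
Definition up eps x : R := (x - eps) * flat eps 0 (x - eps).

Definition dup eps x : R := flat eps 0 (x - eps) + eps * flat eps 1 (x - eps).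

Lemma up_Cn n eps : 0 < eps -> Cn n (up eps).
Proof.
move=> e0.
have := @Cn_affine n 1 (- eps) _ (CnM (Cn_id n) (flat_Cn n 0 e0)).
by under eq_fun do rewrite mul1r.
Qed.

Lemma up_derive eps x : 0 < eps -> is_derive x (1 : R) (up eps) (dup eps x).
Proof.
move=> e0; have d1 : is_derive x (1 : R) (fun x => x - eps) 1.
  by apply: is_derive_eq; rewrite subr0.
have d2 : is_derive x (1 : R) (fun x => flat eps 0 (x - eps))
    (eps * flat eps 2 (x - eps)).
  have := flat_derive 0 e0 (x - eps); rewrite oppr0 mul0r addr0 => d3.
  by apply: is_derive_eq; rewrite mulr1.
apply: is_derive_eq; rewrite /GRing.scale/= mulr1 addrC /dup.
by congr (_ + _); rewrite (flat_succ _ 1) mulrCA.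
Qed.

Lemma up_eq0 eps x : x <= eps -> up eps x = 0.
Proof. by move=> xe; rewrite /up /flat subr_gt0 ltNge xe mulr0. Qed.

Lemma dup_eq0 eps x : x <= eps -> dup eps x = 0.
Proof. by move=> xe; rewrite /dup /flat subr_gt0 ltNge xe mulr0 addr0. Qed.

Lemma up_ge0 eps x : 0 <= up eps x.
Proof.
have [/up_eq0->//|xe] := leP x eps.
by rewrite mulr_ge0 ?flat_ge0// subr_ge0 ltW.
Qed.

(** From exp(-t) >= 1 - t with t = eps/(x - eps). *)
Lemma up_ge eps x : 0 < eps -> x - 2 * eps <= up eps x.
Proof.
move=> e0; have [xe|xe] := leP x eps; first by rewrite up_eq0//; lra.
have s0 : 0 < x - eps by lra.
rewrite /up /flat s0 expr0 mul1r.
have := expR_ge1Dx (- (eps / (x - eps))) => H.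
apply: (@le_trans _ _ ((x - eps) * (1 + - (eps / (x - eps))))).
  by rewrite le_eqVlt; apply/orP; left; apply/eqP; field; rewrite gt_eqF.
by rewrite ler_wpM2l// ltW.
Qed.

Lemma dup_ge0 eps x : 0 < eps -> 0 <= dup eps x.
Proof. by move=> e0; rewrite addr_ge0 ?flat_ge0// mulr_ge0 ?flat_ge0// ltW. Qed.

(** With t = eps/(x - eps) the value is (1 + t) exp(-t), and 1 + t <= exp t. *)
Lemma dup_le1 eps x : 0 < eps -> dup eps x <= 1.
Proof.
move=> e0; have [xe|xe] := leP x eps; first by rewrite dup_eq0.
have s0 : 0 < x - eps by lra.
rewrite /dup /flat s0 expr0 mul1r expr1 mulrA -[X in X + _]mul1r -mulrDl expRN.
by rewrite ler_pdivrMr ?expR_gt0// mul1r expR_ge1Dx.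
Qed.

Definition theta eps x : R := up eps x / (up eps x + up eps (1 - x)).

Definition dtheta eps x : R :=
  (dup eps x * up eps (1 - x) + up eps x * dup eps (1 - x)) /
  (up eps x + up eps (1 - x)) ^+ 2.

Section theta.
Variable eps : R.
Hypothesis eps_gt0 : 0 < eps.
Hypothesis eps_le : eps <= 8^-1.

Let den x := up eps x + up eps (1 - x).

(** One of x and 1 - x is at least 1/2, and there [up] is at least 1/2 - 2 eps. This is where
    [eps_le] enters; the bound is uniform in [eps]. *)
Let den_ge x : 4^-1 <= den x.
Proof.
rewrite /den; have [xh|xh] := leP x 2^-1.
  by move: (up_ge (1 - x) eps_gt0) (up_ge0 eps x) eps_le => ? ? ?; lra.
by move: (up_ge x eps_gt0) (up_ge0 eps (1 - x)) eps_le => ? ? ?; lra.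
Qed.

Let den_gt0 x : 0 < den x.
Proof. by apply: lt_le_trans (den_ge x); lra. Qed.

Lemma theta_Cn n : Cn n (theta eps).
Proof.
have Cup' : Cn n (fun x => up eps (1 - x)).
  have := @Cn_affine n (-1) 1 _ (up_Cn n eps_gt0).
  by under eq_fun do rewrite mulN1r addrC.
apply: CnM; first exact: up_Cn.
apply: Cn_inv; last by apply: CnD => //; exact: up_Cn.
by move=> x; rewrite gt_eqF// den_gt0.
Qed.

Lemma theta_derive x : is_derive x (1 : R) (theta eps) (dtheta eps x).
Proof.
have d1 := up_derive x eps_gt0.
have d2 : is_derive x (1 : R) (fun x => up eps (1 - x)) (- dup eps (1 - x)).
  have d3 : is_derive x (1 : R) (fun x => 1 - x) (-1).
    have := @is_deriveB R R R (cst (1 : R)) id x 1 _ _ (is_derive_cst _ _ _) (is_derive_id _ _).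
    by rewrite sub0r.
  have := up_derive (1 - x) eps_gt0 => d4.
  by apply: is_derive_eq; rewrite mulrN1.
have d5 : is_derive x (1 : R) den (dup eps x - dup eps (1 - x)).
  exact: is_deriveD.
have dn0 : den x != 0 by rewrite gt_eqF.
have d6 : is_derive x (1 : R) (fun x => (den x)^-1)
    (- (den x) ^- 2 * (dup eps x - dup eps (1 - x))).
  have [dd dE] := d5; split; first exact: (@derivableV _ _ den).
  by rewrite (deriveV dn0 dd) dE.
apply: is_derive_eq; rewrite /GRing.scale/= /dtheta.
by rewrite -/(den x) /den; field; exact: dn0.
Qed.

Lemma theta_le x : x <= eps -> theta eps x = 0.
Proof. by move=> xe; rewrite /theta up_eq0// mul0r. Qed.

Lemma theta_ge x : 1 - eps <= x -> theta eps x = 1.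
Proof.
move=> xe; have := den_gt0 x; rewrite /theta /den (@up_eq0 eps (1 - x)); last lra.
by rewrite addr0 => /gt_eqF/negbT/divff.
Qed.

Lemma theta_ge0 x : 0 <= theta eps x.
Proof. by rewrite divr_ge0 ?up_ge0// ltW// den_gt0. Qed.

Lemma theta_le1 x : theta eps x <= 1.
Proof. by rewrite ler_pdivrMr ?den_gt0// mul1r lerDl up_ge0. Qed.

(** Since [dup] is at most 1, the numerator is at most [den x], which leaves 1/[den x]. A bound free
    of [eps] is what dominated convergence will require. *)
Lemma dtheta_le4 x : `|dtheta eps x| <= 4.
Proof.
have D0 := den_gt0 x; have Dg := den_ge x.
rewrite ger0_norm; last first.
  by rewrite divr_ge0 ?exprn_ge0 ?(ltW D0)// addr_ge0// mulr_ge0 ?up_ge0 ?dup_ge0.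
rewrite ler_pdivrMr ?exprn_gt0// -/(den x).
apply: (@le_trans _ _ (den x)); last by rewrite expr2; nra.
rewrite /den addrC lerD//.
  by rewrite ler_piMr ?up_ge0 ?dup_le1.
by rewrite ler_piMl ?up_ge0 ?dup_le1.
Qed.

Lemma dtheta_out x : x <= eps \/ 1 - eps <= x -> dtheta eps x = 0.
Proof.
move=> [xe|xe]; first by rewrite /dtheta (@up_eq0 _ x)// (@dup_eq0 _ x)// !mul0r addr0 mul0r.
rewrite /dtheta (@up_eq0 _ (1 - x)); last lra.
by rewrite (@dup_eq0 _ (1 - x)); [rewrite !mulr0 addr0 mul0r|lra].
Qed.

(** The cutoff used in the directions transverse to a component of a field. It needs no
    normalization: only values in [0, 1], support inside ]0, 1[ and pointwise convergence to the
    indicator matter. *)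
Definition bump x : R := flat eps 0 (x - eps) * flat eps 0 (1 - eps - x).

Lemma bump_Cn n : Cn n bump.
Proof.
apply: CnM.
  have := @Cn_affine n 1 (- eps) _ (flat_Cn n 0 eps_gt0).
  by under eq_fun do rewrite mul1r.
have := @Cn_affine n (-1) (1 - eps) _ (flat_Cn n 0 eps_gt0).
by under eq_fun do rewrite mulN1r addrC.
Qed.

Lemma bump_out x : x <= eps \/ 1 - eps <= x -> bump x = 0.
Proof.
move=> [xe|xe]; rewrite /bump /flat.
  by rewrite subr_gt0 ltNge xe mul0r.
by rewrite (_ : (0 < 1 - eps - x) = false) ?mulr0//; apply/negbTE; rewrite -leNgt subr_le0.
Qed.

Lemma flat_le1 x : flat eps 0 x <= 1.
Proof.
rewrite /flat; case: ifPn => // x0.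
by rewrite expr0 mul1r expR_le1 oppr_le0 divr_ge0//; exact: ltW.
Qed.

Lemma bump_ge0 x : 0 <= bump x.
Proof. by rewrite mulr_ge0 ?flat_ge0. Qed.

Lemma bump_le1 x : bump x <= 1.
Proof. by rewrite mulr_ile1 ?flat_ge0 ?flat_le1. Qed.

End theta.

Section limits.
Variable e : nat -> R.
Hypothesis e_gt0 : forall k, 0 < e k.
Hypothesis e_cvg0 : e k @[k --> \oo] --> 0.

Lemma flat_cvg m x (b : R) (y : nat -> R) : 0 < x -> y k @[k --> \oo] --> x ->
  flat (e k) m (y k) @[k --> \oo] --> (x^-1) ^+ m.
Proof.
move=> x0 yx.
have H : (y k)^-1 ^+ m * expR (- (e k / y k)) @[k --> \oo] --> (x^-1) ^+ m * expR (- (0 / x)).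
  have yV : (y k)^-1 @[k --> \oo] --> x^-1 by apply: cvgV => //; rewrite gt_eqF.
  apply: cvgM.
    by elim: m => [|m IH]; [under eq_fun do rewrite expr0; exact: cvg_cst
      |under eq_fun do rewrite exprS; rewrite exprS; exact: cvgM].
  apply: (@cvg_comp _ _ _ (fun k => - (e k / y k)) expR _ (nbhs (- (0 / x)))); last exact: continuous_expR.
  by apply: cvgN; apply: cvgM.
move: H; rewrite mul0r oppr0 expR0 mulr1; apply: cvg_trans.
apply: near_eq_cvg; near=> k; rewrite /flat ifT//.
near: k; exact: (cvgr_gt x).
Unshelve. all: by end_near. Qed.

Lemma up_cvg x : 0 < x -> up (e k) x @[k --> \oo] --> x.
Proof.
move=> x0; have xe : x - e k @[k --> \oo] --> x.
  by rewrite -[X in _ --> X]subr0; apply: cvgB => //; exact: cvg_cst.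
rewrite -[X in _ --> X]mulr1; apply: cvgM => //.
by rewrite -[X in _ --> X](expr0 x^-1); exact: flat_cvg.
Qed.

Lemma dup_cvg x : 0 < x -> dup (e k) x @[k --> \oo] --> (1 : R).
Proof.
move=> x0; have xe : x - e k @[k --> \oo] --> x.
  by rewrite -[X in _ --> X]subr0; apply: cvgB => //; exact: cvg_cst.
rewrite -[X in _ --> X]addr0; apply: cvgD.
  by rewrite -[X in _ --> X](expr0 x^-1); exact: flat_cvg.
rewrite -[X in _ --> X](mul0r (x^-1 ^+ 1)); apply: cvgM => //.
exact: flat_cvg.
Qed.

Lemma dtheta_cvg x : 0 < x < 1 -> dtheta (e k) x @[k --> \oo] --> (1 : R).
Proof.
move=> /andP[x0 x1]; have x1' : 0 < 1 - x by rewrite subr_gt0.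
have -> : (1 : R) = (1 * (1 - x) + x * 1) / ((x + (1 - x)) * (x + (1 - x))).
  by rewrite (addrC x) subrK mul1r mulr1 subrK !mul1r invr1.
rewrite /dtheta; under eq_fun do rewrite expr2.
have H : up (e k) x + up (e k) (1 - x) @[k --> \oo] --> x + (1 - x).
  by apply: cvgD; exact: up_cvg.
apply: cvgM.
  by apply: cvgD; apply: cvgM; first [exact: up_cvg|exact: dup_cvg].
apply: cvgV; first by rewrite (addrC x) subrK mul1r oner_neq0.
exact: cvgM.
Qed.

Lemma bump_cvg x : 0 < x < 1 -> bump (e k) x @[k --> \oo] --> (1 : R).
Proof.
move=> /andP[x0 x1]; have x1' : 0 < 1 - x by rewrite subr_gt0.
rewrite /bump -[X in _ --> X]mulr1; apply: cvgM.
  rewrite -[X in _ --> X](expr0 x^-1); apply: flat_cvg => //.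
  by rewrite -[X in _ --> X]subr0; apply: cvgB => //; exact: cvg_cst.
rewrite -[X in _ --> X](expr0 (1 - x)^-1); apply: flat_cvg => //.
apply: cvgB; last exact: cvg_cst.
by rewrite -[X in _ --> X]subr0; apply: cvgB => //; exact: cvg_cst.
Qed.

End limits.

End smooth_one_variable.

(** * Smooth functions of several variables *)

Section smooth_several_variables.
Context {R : realType} {d : nat}.
Implicit Types (F G : 'rV[R]_d -> R^o) (i j : 'I_d) (n : nat).

Lemma cd_continuous (W : normedModType R) n (F : 'rV[R]_d -> W) :
  continuously_differentiable n F -> continuous F.
Proof. by case: n => [|n] []. Qed.

Lemma cdW (W : normedModType R) n (F : 'rV[R]_d -> W) :
  continuously_differentiable n.+1 F -> continuously_differentiable n F.
Proof.
elim: n F => [|n IH] F [cF H]; split=> //.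
by move=> i; have [dF cF'] := H i; split=> //; exact: IH.
Qed.

Lemma cd_cst (W : normedModType R) n (c : W) :
  continuously_differentiable n (cst c : 'rV[R]_d -> W).
Proof.
elim: n c => [|n IH] c; first by split=> // x; exact: cst_continuous.
split; first by move=> x; exact: cst_continuous.
move=> i; split; first by move=> x; exact: derivable_cst.
rewrite (_ : partial i _ = cst 0); first exact: IH.
by apply/funext => x; rewrite /partial derive_cst.
Qed.

Lemma cdD n F G : continuously_differentiable n F ->
  continuously_differentiable n G ->
  continuously_differentiable n (fun x => F x + G x : R^o).
Proof.
elim: n F G => [|n IH] F G [cF HF] [cG HG].
  by split=> // x; apply: continuousD; [exact: cF|exact: cG].
split; first by move=> x; apply: continuousD; [exact: cF|exact: cG].
move=> i; have [dF cF'] := HF i; have [dG cG'] := HG i.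
split; first by move=> x; exact: derivableD.
rewrite (_ : partial i _ = fun x => partial i F x + partial i G x); first exact: IH.
by apply/funext => x; rewrite /partial deriveD.
Qed.

Lemma cdM n F G : continuously_differentiable n F ->
  continuously_differentiable n G ->
  continuously_differentiable n (fun x => F x * G x : R^o).
Proof.
elim: n F G => [|n IH] F G CF CG.
  split=> // x; apply: (@continuousM R _ F G).
    exact: (cd_continuous CF).
  exact: (cd_continuous CG).
split.
  by move=> x; apply: (@continuousM R _ F G); [exact: (cd_continuous CF)|exact: (cd_continuous CG)].
move=> i; have [_ HF] := CF; have [_ HG] := CG.
have [dF cF'] := HF i; have [dG cG'] := HG i.
split; first by move=> x; exact: derivableM.
rewrite (_ : partial i _ = fun x => F x * partial i G x + G x * partial i F x).
  by apply: cdD; apply: IH => //; exact: cdW.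
by apply/funext => x; rewrite /partial deriveM.
Qed.

Lemma cd_sum (I : Type) (r : seq I) (P : pred I) n (F : I -> 'rV[R]_d -> R^o) :
  (forall k, P k -> continuously_differentiable n (F k)) ->
  continuously_differentiable n (fun x => \sum_(k <- r | P k) F k x : R^o).
Proof.
move=> H; elim: r => [|k r IH].
  by under eq_fun do rewrite big_nil; exact: cd_cst.
under eq_fun do rewrite big_cons.
by case: (boolP (P k)) => Pk //; apply: cdD => //; exact: H.
Qed.

Lemma cd_prod (I : Type) (r : seq I) (P : pred I) n (F : I -> 'rV[R]_d -> R^o) :
  (forall k, P k -> continuously_differentiable n (F k)) ->
  continuously_differentiable n (fun x => \prod_(k <- r | P k) F k x : R^o).
Proof.
move=> H; elim: r => [|k r IH].
  by under eq_fun do rewrite big_nil; exact: cd_cst.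
under eq_fun do rewrite big_cons.
by case: (boolP (P k)) => Pk //; apply: cdM => //; exact: H.
Qed.

Lemma coord_derive (psi dpsi : R -> R) i j (x : 'rV[R]_d) :
  is_derive (x ord0 j) (1 : R) psi (dpsi (x ord0 j)) ->
  is_derive x (delta_mx ord0 i) (fun x : 'rV[R]_d => psi (x ord0 j) : R^o)
    (if i == j then dpsi (x ord0 j) else 0).
Proof.
move=> [dp dE]; case: eqVneq => [->|ij].
  have E : (fun h : R => h^-1 *: (((fun x : 'rV[R]_d => psi (x ord0 j) : R^o) \o
        shift x) (h *: delta_mx ord0 j) - psi (x ord0 j))) =
      fun h => h^-1 *: ((psi \o shift (x ord0 j)) (h *: (1 : R)) - psi (x ord0 j)).
    by apply/funext => h /=; rewrite !mxE !eqxx/= /GRing.scale/=.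
  by split; [rewrite /derivable E; exact: dp|rewrite /derive E; exact: dE].
have E : (fun h : R => h^-1 *: (((fun x : 'rV[R]_d => psi (x ord0 j) : R^o) \o
      shift x) (h *: delta_mx ord0 i) - psi (x ord0 j))) = cst 0.
  apply/funext => h /=.
  by rewrite !mxE eqxx/= eq_sym (negbTE ij) mulr0 add0r subrr scaler0.
split; first by rewrite /derivable E; exact: is_cvg_cst.
by rewrite /derive E; apply: cvg_lim => //; exact: cvg_cst.
Qed.

Lemma cd_coord n j (psi : R -> R) : Cn n psi ->
  continuously_differentiable n (fun x : 'rV[R]_d => psi (x ord0 j) : R^o).
Proof.
elim: n psi => [|n IH] psi Cp.
  split=> // x; apply: (@continuous_comp _ _ _ (fun x : 'rV[R]_d => x ord0 j) psi).
    exact: coord_continuous.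
  exact: (Cn_continuous Cp).
split.
  move=> x; apply: (@continuous_comp _ _ _ (fun x : 'rV[R]_d => x ord0 j) psi).
    exact: coord_continuous.
  exact: (Cn_continuous Cp).
move: Cp => [_ [dpsi [dp Cd]]] i; split.
  by move=> x; have [] := coord_derive i (dp (x ord0 j)).
rewrite (_ : partial i _ =
    fun x : 'rV[R]_d => (if i == j then dpsi (x ord0 j) else 0) : R^o).
  by case: eqP => _; [exact: IH|exact: cd_cst].
by apply/funext => x; have [_ <-] := coord_derive i (dp (x ord0 j)).
Qed.

Lemma cd_row n m (H : 'rV[R]_d -> 'rV[R]_m) :
  (forall j : 'I_m, continuously_differentiable n (fun x => H x ord0 j : R^o)) ->
  continuously_differentiable n H.
Proof.
have cR (H' : 'rV[R]_d -> 'rV[R]_m) :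
    (forall j : 'I_m, continuous (fun x : 'rV[R]_d => H' x ord0 j : R^o)) -> continuous H'.
  move=> cH x; have FF : Filter (nbhs x) by exact: nbhs_filter.
  apply/(@cvgrPdist_le _ _ _ _ FF) => /= e e0.
  have : \forall y \near x, forall j : 'I_m, `|H' x ord0 j - H' y ord0 j| <= e.
    apply: (@filter_forall _ _ _ _ FF) => /= i.
    exact: ((@cvgrPdist_le _ _ _ _ FF _ _).1 (cH i x)).
  apply: filterS => y Hy.
  rewrite [leLHS]/Num.Def.normr/= mx_normrE (bigmax_le _ (ltW e0))//= => -[k j] _.
  by rewrite !mxE/= (ord1 k).
elim: n H => [|n IH] H CH.
  by split=> //; apply: cR => j; exact: (cd_continuous (CH j)).
split; first by apply: cR => j; exact: (cd_continuous (CH j)).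
move=> i; have dH x : derivable H x (delta_mx ord0 i).
  by apply/derivable_mxP => k j; rewrite (ord1 k); have [_ /(_ i)[]] := CH j.
split=> //; apply: IH => j.
rewrite (_ : (fun x => _) = partial i (fun x => H x ord0 j : R^o)).
  by have [_ /(_ i)[]] := CH j.
by apply/funext => x; rewrite /partial derive_mx// mxE.
Unshelve. all: by end_near. Qed.

(** Measurability of row vectors is generated by the coordinates, without reference to the topology.
    Rounding every coordinate down to a multiple of 1/(k+1) gives a measurable map with countably
    many values, and [F] after it converges pointwise to [F]. *)
Lemma continuous_measurable_rV (F : 'rV[R]_d -> R) :
  continuous F -> measurable_fun [set: 'rV[R]_d] F.
Proof.
move=> cF.
pose D k (x : 'rV[R]_d) : 'rV[int]_d := \row_i Num.floor (k.+1%:R * x ord0 i).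
pose E k (z : 'rV[int]_d) : 'rV[R]_d := \row_i ((z ord0 i)%:~R / k.+1%:R).
apply: (@measurable_fun_cvg _ _ _ setT (fun k x => F (E k (D k x)))).
  move=> k _ B mB; rewrite setTI.
  rewrite (_ : _ @^-1` B = \bigcup_(z in [set z | B (F (E k z))])
     [set x | D k x = z]); last first.
    apply/seteqP; split=> [x Bx|x [z /= Bz Dz]]; first by exists (D k x).
    by rewrite /preimage/= Dz.
  rewrite bigcup_mkcond; apply: countable_bigcupT_measurable => // z.
  case: ifP => // _; rewrite (_ : [set x | _] = \bigcap_(i in [set: 'I_d])
     ((fun x : 'rV[R]_d => k.+1%:R * x ord0 i) @^-1`
       `[(z ord0 i)%:~R, (z ord0 i + 1)%:~R[%classic)).
    apply: fin_bigcap_measurable; first exact: finite_finset.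
    move=> i _; rewrite -[X in measurable X]setTI.
    have mf : measurable_fun setT (fun x : 'rV[R]_d => k.+1%:R * x ord0 i).
      by apply: measurable_funM => //; exact: measurable_rV_coord.
    by apply: mf => //; exact: measurable_itv.
  apply/seteqP; split=> x /=.
    by move=> <- i _ /=; rewrite in_itv/= mxE floor_le floorD1_gt.
  move=> H; apply/rowP => i; rewrite mxE; apply: floor_def.
  by have := H i I; rewrite /= in_itv.
move=> x _; apply: (@cvg_comp _ _ _ (fun k => E k (D k x)) F _ (nbhs x)); last exact: cF.
apply/cvgrPdist_le => /= e e0; near=> k.
rewrite [leLHS]/Num.Def.normr/= mx_normrE (bigmax_le _ (ltW e0))//= => -[j i] _.
rewrite !mxE/= (ord1 j).
have k0 : 0 < k.+1%:R :> R by rewrite ltr0n.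
have H1 : (Num.floor (k.+1%:R * x ord0 i))%:~R <= k.+1%:R * x ord0 i := floor_le _.
have H2 : k.+1%:R * x ord0 i < (Num.floor (k.+1%:R * x ord0 i) + 1)%:~R.
  exact: floorD1_gt.
rewrite intrD in H2.
have H3 : k.+1%:R^-1 <= e.
  by apply: ltW; near: k; apply: (near_infty_natSinv_lt (PosNum e0)).
have -> : x ord0 i - (Num.floor (k.+1%:R * x ord0 i))%:~R / k.+1%:R =
   (k.+1%:R * x ord0 i - (Num.floor (k.+1%:R * x ord0 i))%:~R) / k.+1%:R.
  by field; rewrite gt_eqF.
rewrite normrM normfV (gtr0_norm k0) ler_pdivrMr// ger0_norm ?subr_ge0//.
apply: (@le_trans _ _ 1); first by lra.
by rewrite -(@ler_pdivrMr _ k.+1%:R)// mul1r.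
Unshelve. all: by end_near. Qed.

End smooth_several_variables.

(** * Lebesgue measure on row vectors *)

Section product_sets.
Context {R : realType}.
Implicit Types (n : nat).

Definition prodset n (B : 'I_n -> set R) : set 'rV[R]_n :=
  [set x | forall i, B i (x ord0 i)].

Lemma measurable_prodset n (B : 'I_n -> set R) :
  (forall i, measurable (B i)) -> measurable (prodset B).
Proof.
move=> mB; rewrite (_ : prodset B =
    \bigcap_(i in [set: 'I_n]) ((fun x : 'rV[R]_n => x ord0 i) @^-1` B i)).
  apply: fin_bigcap_measurable; first exact: finite_finset.
  move=> i _; rewrite -[X in measurable X]setTI.
  exact: measurable_rV_coord.
by apply/seteqP; split=> [x xB i _|x xB i]; exact: xB.
Qed.

Lemma measurable_rV_prodset n : @measurable _ 'rV[R]_n =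
  <<s [set A | exists2 B : 'I_n -> set R, (forall i, measurable (B i)) & A = prodset B] >>.
Proof.
apply/seteqP; split; last first.
  apply: smallest_sub; first exact: sigma_algebra_measurable.
  by move=> _ [B mB ->]; exact: measurable_prodset.
apply: smallest_sub; first exact: smallest_sigma_algebra.
move=> A; rewrite -bigcup_seq/= => -[i _ [D mD <-]].
apply: sub_sigma_algebra.
exists (fun j => if j == i then D else setT); first by move=> j; case: ifP.
rewrite setTI; apply/seteqP; split=> x /=.
  by move=> Dx j; case: ifPn => [/eqP->|].
by move=> /(_ i); rewrite eqxx.
Qed.

Lemma prodsetI n : setI_closed
  [set A | exists2 B : 'I_n -> set R, (forall i, measurable (B i)) & A = prodset B].
Proof.
move=> _ _ [B mB ->] [C mC ->]; exists (fun i => B i `&` C i).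
  by move=> i; exact: measurableI.
apply/seteqP; split=> x.
  by move=> [Bx Cx] i; split; [exact: Bx|exact: Cx].
by move=> H; split=> i; have [] := H i.
Qed.

Lemma lebesgue_rV_prodset n (B : 'I_n -> set R) :
  (forall i, measurable (B i)) ->
  lebesgue_rV n (prodset B) = (\prod_(i < n) lebesgue_measure (B i))%E.
Proof.
elim: n B => [|n IH] B mB.
  rewrite big_ord0 /= diracE (_ : _ \in _ = true)//.
  by apply/mem_set => -[].
rewrite /= /cons_measure /pushforward.
rewrite (_ : _ @^-1` _ = B ord0 `*` prodset (fun i => B (lift ord0 i))); last first.
  apply/seteqP; split=> -[x v] /=.
    move=> H; split.
      by have := H ord0; rewrite mxE unlift_none.
    by move=> i; have := H (lift ord0 i); rewrite !mxE liftK.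
  move=> [xI vI] i; rewrite mxE; case: (unliftP ord0 i) => [j ->|->] //=; exact: vI.
rewrite product_measure1E; [|exact: mB|exact: measurable_prodset].
by rewrite IH// big_ord_recl.
Qed.

Definition ins n (i : 'I_n.+1) (p : R * 'rV[R]_n) : 'rV[R]_n.+1 :=
  \row_j (if unlift i j is Some k then p.2 ord0 k else p.1).

Lemma ins_same n (i : 'I_n.+1) p : ins i p ord0 i = p.1.
Proof. by rewrite mxE unlift_none. Qed.

Lemma ins_lift n (i : 'I_n.+1) p k : ins i p ord0 (lift i k) = p.2 ord0 k.
Proof. by rewrite mxE liftK. Qed.

Lemma measurable_ins n (i : 'I_n.+1) :
  measurable_fun [set: R * 'rV[R]_n] (@ins n i).
Proof.
apply/measurable_fun_rVP => j.
case: (unliftP i j) => [k ->|->].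
  rewrite (_ : (fun _ => _) = (fun x : 'rV[R]_n => x ord0 k) \o snd); last first.
    by apply/funext => p /=; rewrite ins_lift.
  apply: measurableT_comp; last exact: measurable_snd.
  exact: measurable_rV_coord.
rewrite (_ : (fun _ => _) = fst); first exact: measurable_fst.
by apply/funext => p /=; rewrite ins_same.
Qed.

Lemma preimage_ins_prodset n (i : 'I_n.+1) (B : 'I_n.+1 -> set R) :
  @ins n i @^-1` prodset B = B i `*` prodset (fun k => B (lift i k)).
Proof.
apply/seteqP; split=> -[x v] /=.
  move=> H; split; first by have := H i; rewrite ins_same.
  by move=> k; have := H (lift i k); rewrite ins_lift.
move=> [xI vI] j; case: (unliftP i j) => [k ->|->].
  by rewrite ins_lift; exact: vI.
by rewrite ins_same.
Qed.

(** [lebesgue_rV] is built by splitting off the first coordinate; any other coordinate may be split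
    off as well, because both measures agree on products of measurable sets, a generating pi-system
    exhausted by cubes of finite measure. This permits integration along any axis. *)
Lemma lebesgue_rV_ins n (i : 'I_n.+1) (A : set 'rV[R]_n.+1) : measurable A ->
  lebesgue_rV n.+1 A =
  pushforward (@lebesgue_measure R \x lebesgue_rV n)%E (@ins n i) A.
Proof.
move=> mA.
pose m0 : {measure set 'rV[R]_n.+1 -> \bar R} :=
  pushforward (@lebesgue_measure R \x lebesgue_rV n)%E (@ins n i).
pose m2 := m0 (measurable_ins i).
rewrite -[RHS]/(m2 A).
pose g k := prodset (fun _ : 'I_n.+1 => `]- k%:R, k%:R[%classic : set R).
apply: (measure_unique _ g (measurable_rV_prodset n.+1) (@prodsetI n.+1)) => //.
- by move=> k; exists (fun=> `]- k%:R, k%:R[%classic).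
- apply/seteqP; split=> // x _.
  have [k Hk] : exists k : nat, forall j, `|x ord0 j| < k%:R.
    exists (Num.truncn (\sum_j `|x ord0 j|)).+1 => j.
    apply: le_lt_trans (truncnS_gt _).
    by rewrite (bigD1 j)//= lerDl sumr_ge0.
  by exists k => // j /=; rewrite in_itv/= -ltr_norml.
- move=> _ [B mB ->]; apply: (eq_trans (lebesgue_rV_prodset mB)).
  rewrite (bigD1_ord i)//= /m2/= /pushforward preimage_ins_prodset product_measure1E; [|exact: mB|exact: measurable_prodset].
  by rewrite lebesgue_rV_prodset.
- move=> k; have mg (j : 'I_n.+1) : measurable (`]- k%:R, k%:R[%classic : set R).
    exact: measurable_itv.
  have E := lebesgue_rV_prodset mg.
  pose J : set R := `]- k%:R, k%:R[%classic.
  suff [_ H] : (0 <= \prod_(j < n.+1) lebesgue_measure J /\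
      \prod_(j < n.+1) lebesgue_measure J < +oo)%E by move: H; rewrite -E.
  apply: (big_ind (fun x : \bar R => 0 <= x /\ x < +oo)%E) => //.
  + by split=> //; rewrite ltry.
  + move=> x y [x0 xy] [y0 yy]; split; first exact: mule_ge0.
    by rewrite lte_mul_pinfty// ge0_fin_numE.
  + move=> j _; split=> //; rewrite /J lebesgue_measure_itv/=; case: ifP => // _.
    by rewrite -EFinB ltry.
Qed.

Lemma integral_ins n (i : 'I_n.+1) (F : 'rV[R]_n.+1 -> \bar R) :
  (lebesgue_rV n.+1).-integrable setT F ->
  (\int[lebesgue_rV n.+1]_x F x =
   \int[lebesgue_rV n]_y \int[lebesgue_measure]_t F (ins i (t, y)))%E.
Proof.
move=> iF; have mF : measurable_fun setT F by exact: (measurable_int _ iF).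
pose m0 : {measure set 'rV[R]_n.+1 -> \bar R} :=
  pushforward (@lebesgue_measure R \x lebesgue_rV n)%E (@ins n i).
pose m2 := m0 (measurable_ins i).
have iFi : (@lebesgue_measure R \x lebesgue_rV n)%E.-integrable setT (F \o @ins n i).
  apply/integrableP; split.
    by apply: measurableT_comp => //; exact: measurable_ins.
  move/integrableP : iF => [_]; apply: le_lt_trans.
  rewrite (eq_measure_integral m2); last first.
    by move=> A mA _; exact: lebesgue_rV_ins.
  rewrite ge0_integral_pushforward//.
    exact: measurable_ins.
  by apply: measurableT_comp.
rewrite (eq_measure_integral m2); last first.
  by move=> A mA _; exact: lebesgue_rV_ins.
rewrite integral_pushforward//; last exact: measurable_ins.
by rewrite preimage_setT -integral21_prod_meas1.
Qed.

Lemma FTC_segment (F f : R -> R) (p q : R) : p < q -> continuous f ->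
  (forall x, is_derive x (1 : R) F (f x)) ->
  (\int[lebesgue_measure]_(t in `]p, q[) (f t)%:E = (F q - F p)%:E)%E.
Proof.
move=> pq cf dF; rewrite EFinB -(@continuous_FTC2 _ f F)//.
- rewrite (@integral_itv_bndoo _ _ _ (EFin \o f) true false)//.
  by apply/measurable_EFinP/measurable_funTS; exact: continuous_measurable_fun.
- exact: continuous_subspaceT.
- have cF : continuous F.
    by move=> x; apply/differentiable_continuous/derivable1_diffP; case: (dF x).
  split.
  + by move=> x _; case: (dF x).
  + by apply: cvg_at_right_filter; exact: cF.
  + by apply: cvg_at_left_filter; exact: cF.
- by move=> x _; rewrite derive1E; case: (dF x).
Qed.

End product_sets.

(** * Averages over a finite partition *)

Section finite_measure.
Context {disp} {T : measurableType disp} {R : realType}.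
Variable mu : {measure set T -> \bar R}.
Hypothesis mu_fin : (mu setT < +oo)%E.
Implicit Types (f g h : T -> R).

Local Notation I f := (Rintegral mu setT f).
Definition integ f := mu.-integrable setT (EFin \o f).

Lemma integ_measurable f : integ f -> measurable_fun setT f.
Proof. by move=> /(measurable_int _) /measurable_EFinP. Qed.

Lemma integD f g : integ f -> integ g -> integ (fun x => f x + g x).
Proof. by move=> iF ig; exact: (integrableD measurableT iF ig). Qed.

Lemma integB f g : integ f -> integ g -> integ (fun x => f x - g x).
Proof. by move=> iF ig; exact: (integrableB measurableT iF ig). Qed.

Lemma integZ c f : integ f -> integ (fun x => c * f x).
Proof. by move=> iF; exact: (integrableZl measurableT c iF). Qed.

Lemma integ_sum (J : Type) (r : seq J) (P : pred J) (F : J -> T -> R) :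
  (forall j, P j -> integ (F j)) -> integ (fun x => \sum_(j <- r | P j) F j x).
Proof.
move=> iF; elim: r => [|j r IH].
  rewrite /integ (_ : EFin \o _ = cst 0%E); first exact: integrable0.
  by apply/funext => x /=; rewrite big_nil.
rewrite /integ (_ : EFin \o _ =
  EFin \o (fun x => (if P j then F j x else 0) + \sum_(j <- r | P j) F j x)).
  apply: integD => //; case: (boolP (P j)) => Pj; first exact: iF.
  exact: integrable0.
apply/funext => x /=; rewrite big_cons.
by case: ifP => // _; rewrite add0r.
Qed.

Lemma integ_le f g : measurable_fun setT f -> integ g ->
  (forall x, `|f x| <= g x) -> integ f.
Proof.
move=> mf ig fg; apply: (le_integrable measurableT _ _ ig).
  exact/measurable_EFinP.
by move=> x _ /=; rewrite lee_fin (le_trans (fg x))// ler_norm.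
Qed.

Lemma integ_bounded f M : measurable_fun setT f -> (forall x, `|f x| <= M) -> integ f.
Proof.
move=> mf fM; apply: measurable_bounded_integrable => //.
exists M; split; first exact: num_real.
by move=> y My x _; exact: le_trans (fM x) (ltW My).
Qed.

Lemma integ_norm f : integ f -> integ (fun x => `|f x|).
Proof. exact: integrable_norm. Qed.

Lemma ID f g : integ f -> integ g -> I (fun x => f x + g x) = I f + I g.
Proof. by move=> iF ig; rewrite RintegralD. Qed.

Lemma IB f g : integ f -> integ g -> I (fun x => f x - g x) = I f - I g.
Proof. by move=> iF ig; rewrite RintegralB. Qed.

Lemma IZ c f : integ f -> I (fun x => c * f x) = c * I f.
Proof. by move=> iF; rewrite RintegralZl. Qed.

Lemma I_sum (J : Type) (r : seq J) (P : pred J) (F : J -> T -> R) :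
  (forall j, P j -> integ (F j)) ->
  I (fun x => \sum_(j <- r | P j) F j x) = \sum_(j <- r | P j) I (F j).
Proof.
move=> iF; elim: r => [|j r IH].
  rewrite big_nil; under eq_fun do rewrite big_nil.
  by rewrite Rintegral_cst// mul0r.
rewrite big_cons; under eq_fun do rewrite big_cons.
case: (boolP (P j)) => Pj //.
by rewrite ID// ?IH//; [exact: iF|exact: integ_sum].
Qed.

Lemma I_le f g : integ f -> integ g -> (forall x, f x <= g x) -> I f <= I g.
Proof. by move=> iF ig fg; apply: le_Rintegral. Qed.

Lemma I_ge0 f : (forall x, 0 <= f x) -> 0 <= I f.
Proof. by move=> f0; apply: Rintegral_ge0. Qed.

Lemma I_cst c : I (fun=> c) = c * fine (mu setT).
Proof. by rewrite Rintegral_cst. Qed.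

Lemma I_abs f : integ f -> `|I f| <= I (fun x => `|f x|).
Proof. by move=> iF; apply: le_normr_Rintegral. Qed.

Lemma I_ae f g : measurable_fun setT f -> measurable_fun setT g ->
  {ae mu, forall x, f x = g x} -> I f = I g.
Proof.
move=> mf mg fg; congr fine; apply: ae_eq_integral => //.
- exact/measurable_EFinP.
- exact/measurable_EFinP.
- by apply: filterS fg => x /= -> _.
Qed.

Lemma I_le_ae f g : integ f -> integ g -> {ae mu, forall x, f x <= g x} -> I f <= I g.
Proof.
move=> iF ig fg; have mf := integ_measurable iF; have mg := integ_measurable ig.
have -> : I f = I (fun x => Num.min (f x) (g x)).
  apply: I_ae => //; first exact: measurable_minr.
  by apply: filterS fg => x fgx; rewrite min_l.
apply: I_le => // [|x]; last by rewrite ge_min lexx orbT.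
apply: (@integ_le _ (fun x => `|f x| + `|g x|)).
- exact: measurable_minr.
- by apply: integD; exact: integ_norm.
- move=> x; rewrite minEle; case: ifP => _; [exact: ler_wpDr|exact: ler_wpDl].
Qed.

Lemma I_eq0_ae f : integ f -> (forall x, 0 <= f x) -> I f = 0 ->
  {ae mu, forall x, f x = 0}.
Proof.
move=> iF f0 If0.
have : (\int[mu]_x `|(EFin \o f) x| = 0)%E.
  have -> : (\int[mu]_x `|(EFin \o f) x| = \int[mu]_x (EFin \o f) x)%E.
    by apply: eq_integral => x _ /=; rewrite ger0_norm.
  rewrite -[LHS]fineK; last exact: integrable_fin_num.
  by congr EFin; exact: If0.
move/(ae_eq_integral_abs mu measurableT (measurable_int _ iF)).
by apply: filterS => x /= /(_ Logic.I) [].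
Qed.

Lemma I_dominated (F : nat -> T -> R) f g : (forall k, measurable_fun setT (F k)) ->
  measurable_fun setT f -> integ g -> (forall k x, `|F k x| <= g x) ->
  {ae mu, forall x, F k x @[k --> \oo] --> f x} ->
  I (F k) @[k --> \oo] --> I f.
Proof.
move=> mF mf ig Fg Ff.
have H : {ae mu, forall x, setT x -> (EFin \o F k) x @[k --> \oo] --> (EFin \o f) x}.
  by apply: filterS Ff => x Fx _; apply: cvg_EFin; [exact: nearW|exact: Fx].
have mF' k : measurable_fun setT (EFin \o F k) by exact/measurable_EFinP.
have mf' : measurable_fun setT (EFin \o f) by exact/measurable_EFinP.
have Fg' : {ae mu, forall x k, setT x -> (`|(EFin \o F k) x| <= (EFin \o g) x)%E}.
  by apply: aeW => x k _ /=; rewrite lee_fin; exact: Fg.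
have [iff _ c] := dominated_convergence measurableT mF' mf' H ig Fg'.
by apply: fine_cvg; rewrite fineK; [exact: c|exact: integrable_fin_num].
Qed.

Definition L2 f := measurable_fun setT f /\ integ (fun x => f x ^+ 2).

Lemma L2_measurable f : L2 f -> measurable_fun setT f. Proof. by case. Qed.

Lemma L2_mul f g : L2 f -> L2 g -> integ (fun x => f x * g x).
Proof.
move=> [mf iF] [mg ig]; apply: (@integ_le _ (fun x => f x ^+ 2 + g x ^+ 2)).
- exact: measurable_funM.
- exact: integD.
- by move=> x; rewrite ler_norml; apply/andP; split; nra.
Qed.

Lemma L2_bounded f M : measurable_fun setT f -> (forall x, `|f x| <= M) -> L2 f.
Proof.
move=> mf fM; split=> //; apply: (@integ_bounded _ (M ^+ 2)).
  exact: measurable_funX.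
by move=> x; rewrite normrX lerXn2r// nnegrE ?normr_ge0// (le_trans _ (fM x)).
Qed.

Lemma L2_integ f : L2 f -> integ f.
Proof.
move=> Lf; have /(L2_mul Lf) : L2 (cst 1).
  by apply: (@L2_bounded _ 1) => // x; rewrite normr1.
by rewrite /integ; congr (_.-integrable _ _); apply/funext => x /=; rewrite mulr1.
Qed.

Lemma L2D f g : L2 f -> L2 g -> L2 (fun x => f x + g x).
Proof.
move=> Lf Lg; split; first by apply: measurable_funD; [case: Lf|case: Lg].
have := integD (integD Lf.2 (integZ 2 (L2_mul Lf Lg))) Lg.2.
by rewrite /integ; congr (_.-integrable _ _); apply/funext => x /=; congr EFin; ring.
Qed.

Lemma L2Z c f : L2 f -> L2 (fun x => c * f x).
Proof.
move=> Lf; split; first by apply: measurable_funM => //; case: Lf.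
have := integZ (c ^+ 2) Lf.2.
by rewrite /integ; congr (_.-integrable _ _); apply/funext => x /=; congr EFin; ring.
Qed.

Lemma L2B f g : L2 f -> L2 g -> L2 (fun x => f x - g x).
Proof.
move=> Lf Lg; have := L2D Lf (L2Z (-1) Lg).
by congr L2; apply/funext => x; rewrite mulN1r.
Qed.

Definition ip f g := I (fun x => f x * g x).

Lemma ipC f g : ip f g = ip g f.
Proof. by rewrite /ip; under eq_fun do rewrite mulrC. Qed.

Lemma ipDl f g h : L2 f -> L2 g -> L2 h -> ip (fun x => f x + g x) h = ip f h + ip g h.
Proof.
move=> Lf Lg Lh; rewrite /ip -ID; [|exact: L2_mul|exact: L2_mul].
by congr (Rintegral _ _ _); apply/funext => x; rewrite mulrDl.
Qed.

Lemma ipZl c f h : L2 f -> L2 h -> ip (fun x => c * f x) h = c * ip f h.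
Proof.
move=> Lf Lh; rewrite /ip -IZ; last exact: L2_mul.
by congr (Rintegral _ _ _); apply/funext => x; rewrite mulrA.
Qed.

Lemma ipBl f g h : L2 f -> L2 g -> L2 h -> ip (fun x => f x - g x) h = ip f h - ip g h.
Proof.
move=> Lf Lg Lh; rewrite /ip -IB; [|exact: L2_mul|exact: L2_mul].
by congr (Rintegral _ _ _); apply/funext => x; rewrite mulrBl.
Qed.

Lemma ipBr f g h : L2 f -> L2 g -> L2 h -> ip h (fun x => f x - g x) = ip h f - ip h g.
Proof. by move=> *; rewrite ipC ipBl// !(ipC h). Qed.

Lemma ipDr f g h : L2 f -> L2 g -> L2 h -> ip h (fun x => f x + g x) = ip h f + ip h g.
Proof. by move=> *; rewrite ipC ipDl// !(ipC h). Qed.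

Lemma ipZr c f h : L2 f -> L2 h -> ip h (fun x => c * f x) = c * ip h f.
Proof. by move=> *; rewrite ipC ipZl// (ipC h). Qed.

Lemma ip_ge0 f : 0 <= ip f f.
Proof. by apply: I_ge0 => x; rewrite -expr2 sqr_ge0. Qed.

Lemma ip_sub f g : L2 f -> L2 g ->
  ip (fun x => f x - g x) (fun x => f x - g x) = ip f f - 2 * ip f g + ip g g.
Proof.
move=> Lf Lg; rewrite ipBl//; last exact: L2B.
by rewrite !ipBr// (ipC g f); ring.
Qed.

Lemma ip_add f g : L2 f -> L2 g ->
  ip (fun x => f x + g x) (fun x => f x + g x) = ip f f + 2 * ip f g + ip g g.
Proof.
move=> Lf Lg; rewrite ipDl//; last exact: L2D.
by rewrite !ipDr// (ipC g f); ring.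
Qed.

Lemma CauchySchwarz f g : L2 f -> L2 g -> `|ip f g| <= Num.sqrt (ip f f) * Num.sqrt (ip g g).
Proof.
move=> Lf Lg.
have H t : 0 <= ip f f * t ^+ 2 - 2 * ip f g * t + ip g g.
  have := ip_ge0 (fun x => t * f x - g x).
  rewrite ip_sub//; last exact: L2Z.
  rewrite ipZl//; last exact: L2Z.
  by rewrite ipZr// ipZl//; nra.
rewrite -sqrtrM ?ip_ge0// -sqrtr_sqr ler_sqrt ?mulr_ge0 ?ip_ge0//.
have [f0|f0] := eqVneq (ip f f) 0.
  have g0 : ip f g = 0.
    apply/eqP; rewrite -[_ == _]negbK; apply/negP => n0.
    have := H ((ip g g + 1) / (2 * ip f g)); rewrite f0 mul0r add0r.
    have -> : 2 * ip f g * ((ip g g + 1) / (2 * ip f g)) = ip g g + 1 by field.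
    lra.
  by rewrite f0 g0 mul0r expr0n.
have fp : 0 < ip f f by rewrite lt_neqAle eq_sym f0 ip_ge0.
have := H (ip f g / ip f f).
have -> : ip f f * (ip f g / ip f f) ^+ 2 - 2 * ip f g * (ip f g / ip f f) + ip g g =
  (ip f f * ip g g - ip f g ^+ 2) / ip f f by field.
by rewrite pmulr_lge0 ?invr_gt0// subr_ge0.
Qed.

Lemma L1_le_L2 f : L2 f -> I (fun x => `|f x|) <= Num.sqrt (ip f f) * Num.sqrt (fine (mu setT)).
Proof.
move=> Lf; have L1 : L2 (cst 1) by apply: (@L2_bounded _ 1) => // x; rewrite normr1.
have Ln : L2 (fun x => `|f x|).
  split; first by apply: measurableT_comp => //; case: Lf.
  by case: Lf => _; rewrite /integ; congr (_.-integrable _ _); apply/funext => x /=; rewrite real_normK ?num_real.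
have := CauchySchwarz Ln L1.
have -> : ip (fun x => `|f x|) (fun x => `|f x|) = ip f f.
  rewrite /ip; congr (Rintegral _ _ _); apply/funext => x.
  by rewrite -expr2 real_normK ?num_real// expr2.
have -> : ip (cst 1) (cst 1) = fine (mu setT).
  by rewrite /ip; under eq_fun do rewrite mulr1; rewrite I_cst mul1r.
have -> : ip (fun x => `|f x|) (cst 1) = I (fun x => `|f x|).
  by rewrite /ip; congr (Rintegral _ _ _); apply/funext => x; rewrite mulr1.
by apply: le_trans; rewrite ler_norm.
Qed.

Lemma powR_ge1E (x q : R) : 0 < x -> x `^ q = x * x `^ (q - 1).
Proof.
move=> x0; rewrite -[X in X * _](powRr1 (ltW x0)) -powRD.
  by congr (_ `^ _); rewrite addrC subrK.
by rewrite (gt_eqF x0) implybT.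
Qed.

Section partition.
Variables (J : finType) (C : J -> set T).

(** Covering holds only almost everywhere, as the hyperplanes of a grid are left out, and empty
    cells are allowed. *)
Definition is_part := [/\ (forall r, measurable (C r)),
  (forall r s x, C r x -> C s x -> r = s) &
  {ae mu, forall x, exists r, C r x}].

Hypothesis Cpart : is_part.
Implicit Types (w : J -> R) (r s : J).

Let mC r : measurable (C r). Proof. by case: Cpart. Qed.

Definition step w x : R := \sum_r w r * \1_(C r) x.
Definition vol r : R := fine (mu (C r)).
Definition cm g r : R := (vol r)^-1 * I (fun x => g x * \1_(C r) x).
Definition avg g := step (cm g).

Lemma step_in w r x : C r x -> step w x = w r.
Proof.
move=> Crx; rewrite /step (bigD1 r)//= indicE mem_set// mulr1 big1 ?addr0// => s sr.
rewrite indicE memNset ?mulr0// => Csx; move/eqP: sr; apply.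
by have [_ + _] := Cpart; apply; [exact: Csx|].
Qed.

Lemma step_out w x : ~ (exists r, C r x) -> step w x = 0.
Proof.
move=> nC; rewrite /step big1// => s _.
by rewrite indicE memNset ?mulr0// => Csx; apply: nC; exists s.
Qed.

(** Pointwise identities between step functions reduce to these two cases; [w] is quantified inside,
    so that the same cell serves several step functions at once. *)
Lemma stepP x : (exists2 r, C r x & forall w, step w x = w r) \/
  (forall w, step w x = 0).
Proof.
have [[r Crx]|nC] := pselect (exists r, C r x).
  by left; exists r => // w; exact: step_in.
by right => w; exact: step_out.
Qed.

Lemma measurable_step w : measurable_fun setT (step w).
Proof.
by apply: measurable_sum => r; apply: measurable_funM.
Qed.

Lemma step_le w M x : 0 <= M -> (forall r, `|w r| <= M) -> `|step w x| <= M.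
Proof. by move=> M0 wM; have [[r _ ->]|->] := stepP x; rewrite ?normr0. Qed.

Lemma step_L2 w : L2 (step w).
Proof.
apply: (@L2_bounded _ (\sum_r `|w r|)); first exact: measurable_step.
move=> x; apply: step_le; first by apply: sumr_ge0.
by move=> r; rewrite (bigD1 r)//= lerDl sumr_ge0.
Qed.

Lemma stepB w1 w2 x : step (fun r => w1 r - w2 r) x = step w1 x - step w2 x.
Proof. by have [[r _ E]|E] := stepP x; rewrite !E// subr0. Qed.

Lemma stepM w1 w2 x : step (fun r => w1 r * w2 r) x = step w1 x * step w2 x.
Proof. by have [[r _ E]|E] := stepP x; rewrite !E// mulr0. Qed.

Lemma step_map (phi : R -> R) w x : phi 0 = 0 ->
  step (fun r => phi (w r)) x = phi (step w x).
Proof. by move=> p0; have [[r _ E]|E] := stepP x; rewrite !E. Qed.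

Lemma integ_indic g r : integ g -> integ (fun x => g x * \1_(C r) x).
Proof.
move=> ig; apply: (@integ_le _ (fun x => `|g x|)).
- by apply: measurable_funM; [exact: integ_measurable|exact: measurable_indic].
- exact: integ_norm.
- move=> x; rewrite normrM ler_piMr// indicE.
  by case: (_ \in _); rewrite ?normr1 ?normr0.
Qed.

Lemma indic_ge0 r x : 0 <= \1_(C r) x :> R.
Proof. by rewrite indicE; case: (_ \in _). Qed.

Lemma vol_ge0 r : 0 <= vol r.
Proof. by rewrite fine_ge0. Qed.

Lemma I_indic_vol0 g r : integ g -> vol r = 0 -> I (fun x => g x * \1_(C r) x) = 0.
Proof.
move=> ig v0; have -> : 0 = I (cst 0) :> R by rewrite I_cst mul0r.
apply: I_ae => //; first exact: (integ_measurable (integ_indic r ig)).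
exists (C r); split=> //.
  have : mu (C r) \is a fin_num.
    rewrite ge0_fin_numE//; apply: le_lt_trans mu_fin.
    by apply: le_measure => //; rewrite inE.
  by move=> /fineK <-; rewrite -/(vol r) v0.
move=> x /= H; apply: contrapT => nCx; apply: H.
by rewrite indicE memNset// mulr0.
Qed.

(** On a null cell the division by 0 makes [cm] vanish, and the identity survives because the
    integral vanishes too. *)
Lemma I_indic g r : integ g -> I (fun x => g x * \1_(C r) x) = vol r * cm g r.
Proof.
move=> ig; have [v0|v0] := eqVneq (vol r) 0.
  by rewrite v0 mul0r I_indic_vol0.
by rewrite /cm mulrA divff// mul1r.
Qed.

Lemma I_split g : integ g -> I g = \sum_r I (fun x => g x * \1_(C r) x).
Proof.
move=> ig; rewrite -I_sum; last by move=> r _; exact: integ_indic.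
have [_ _ cov] := Cpart.
apply: I_ae; first exact: integ_measurable.
  by apply: integ_measurable; apply: integ_sum => r _; exact: integ_indic.
apply: filterS cov => x [r Crx].
by rewrite -big_distrr/= -[LHS]mulr1; congr (_ * _); have := step_in (fun=> 1) Crx;
  rewrite /step => <-; apply: eq_bigr => s _; rewrite mul1r.
Qed.

Lemma I_cm g : integ g -> I g = \sum_r vol r * cm g r.
Proof. by move=> ig; rewrite I_split//; apply: eq_bigr => r _; rewrite I_indic. Qed.

Lemma I_step w g : integ g ->
  I (fun x => step w x * g x) = \sum_r w r * (vol r * cm g r).
Proof.
move=> ig; transitivity (I (fun x => \sum_r w r * (g x * \1_(C r) x))).
  congr (Rintegral _ _ _); apply/funext => x; rewrite /step mulr_suml.
  by apply: eq_bigr => r _; rewrite mulrAC mulrA.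
rewrite I_sum; last by move=> r _; apply: integZ; exact: integ_indic.
by apply: eq_bigr => r _; rewrite IZ ?I_indic//; exact: integ_indic.
Qed.

Lemma I_stepE w : I (step w) = \sum_r w r * vol r.
Proof.
have i1 : integ (cst 1) by apply: (@integ_bounded _ 1) => // x; rewrite normr1.
have := @I_step w _ i1; under eq_fun do rewrite mulr1.
move=> ->; apply: eq_bigr => r _; congr (_ * _).
have [v0|v0] := eqVneq (vol r) 0; first by rewrite v0 mul0r.
rewrite /cm mulrA divff// mul1r.
under eq_fun do rewrite mul1r.
by rewrite /Rintegral integral_indic// setIT.
Qed.

(** Against a step function only the integrals of [g] over the cells count: averaging is the
    L^2-orthogonal projection onto step functions. *)
Lemma avg_ip g w : L2 g -> ip (avg g) (step w) = ip g (step w).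
Proof.
move=> Lg; rewrite /ip; under eq_fun do rewrite -stepM.
rewrite I_stepE; under [in RHS]eq_fun do rewrite mulrC.
rewrite I_step; last exact: L2_integ.
by apply: eq_bigr => r _; ring.
Qed.

Lemma avg_sym f g : L2 f -> L2 g -> ip (avg f) g = ip f (avg g).
Proof. by move=> Lf Lg; rewrite [LHS]ipC -[LHS](avg_ip (cm f) Lg) [LHS]ipC; exact: (avg_ip (cm g) Lf). Qed.

Lemma avg_orth f : L2 f ->
  ip (fun x => f x - avg f x) (fun x => f x - avg f x) = ip f f - ip (avg f) (avg f).
Proof.
move=> Lf; rewrite ip_sub//; last exact: step_L2.
by rewrite -(avg_ip (cm f) Lf) -/(avg f); ring.
Qed.

Lemma avg_le f : L2 f -> ip (avg f) (avg f) <= ip f f.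
Proof.
move=> Lf; rewrite -subr_ge0 -avg_orth//; exact: ip_ge0.
Qed.

Lemma cmB f g r : integ f -> integ g -> cm (fun x => f x - g x) r = cm f r - cm g r.
Proof.
move=> iF ig; rewrite /cm -mulrBr -IB; [|exact: integ_indic|exact: integ_indic].
by congr (_ * _); congr (Rintegral _ _ _); apply/funext => x; rewrite mulrBl.
Qed.

Lemma avgB f g x : integ f -> integ g -> avg (fun x => f x - g x) x = avg f x - avg g x.
Proof.
by move=> iF ig; rewrite /avg -stepB /step; apply: eq_bigr => r _; rewrite cmB.
Qed.

Lemma avgD f g x : integ f -> integ g -> avg (fun x => f x + g x) x = avg f x + avg g x.
Proof.
move=> iF ig; have := avgB x (integD iF ig) ig.
by under eq_fun do rewrite addrK; move=> ->; rewrite subrK.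
Qed.

Lemma avgZ c g x : integ g -> avg (fun x => c * g x) x = c * avg g x.
Proof.
move=> ig; rewrite /avg /step mulr_sumr; apply: eq_bigr => r _.
rewrite mulrA; congr (_ * _); rewrite /cm mulrCA; congr (_ * _).
rewrite -IZ; last exact: integ_indic.
by congr (Rintegral _ _ _); apply/funext => y; rewrite mulrA.
Qed.

Lemma cm_abs g r : integ g -> `|cm g r| <= cm (fun x => `|g x|) r.
Proof.
move=> ig; rewrite /cm normrM ger0_norm ?invr_ge0 ?vol_ge0//.
rewrite ler_wpM2l ?invr_ge0 ?vol_ge0//.
apply: (le_trans (I_abs (integ_indic r ig))).
rewrite le_eqVlt; apply/orP; left; apply/eqP; congr (Rintegral _ _ _).
by apply/funext => x; rewrite normrM (ger0_norm (indic_ge0 _ _)).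
Qed.

(** An elementary substitute for Jensen's inequality, at the price of 2^q. With c the cell mean of
    |g|, integrating the bound [pw] over the cell gives c <= c/2 + (c/2)^(1-q) mean(|g|^q);
    absorbing c/2 yields (c/2)^q <= mean(|g|^q). *)
Lemma avg_powR q g : 1 <= q -> integ g -> integ (fun x => `|g x| `^ q) ->
  I (fun x => `|avg g x| `^ q) <= 2 `^ q * I (fun x => `|g x| `^ q).
Proof.
move=> q1 ig igq; have q0 : q != 0 by rewrite gt_eqF//; lra.
under eq_fun do rewrite -(@step_map (fun x => `|x| `^ q)) ?normr0 ?powR0//.
rewrite I_stepE I_cm// mulr_sumr; apply: ler_sum => r _.
have [v0|v0] := eqVneq (vol r) 0; first by rewrite v0 mulr0 mul0r mulr0.
have vp : 0 < vol r by rewrite lt_neqAle eq_sym v0 vol_ge0.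
set c := cm (fun x => `|g x|) r.
have cg : `|cm g r| <= c by exact: cm_abs.
have c0 : 0 <= c by exact: le_trans cg.
have [ce0|ce0] := eqVneq c 0.
  have -> : cm g r = 0 by apply/eqP; rewrite -normr_le0 -ce0.
  rewrite normr0 powR0// mul0r mulr_ge0 ?powR_ge0// -I_indic//.
  by apply: I_ge0 => x; rewrite mulr_ge0 ?powR_ge0// indic_ge0.
have cp : 0 < c by rewrite lt_neqAle eq_sym ce0.
have c2 : 0 < c / 2 by rewrite divr_gt0.
(* Either t is below the threshold c/2, or t = t^(1-q) t^q with t^(1-q) <= (c/2)^(1-q). *)
have pw t : 0 <= t -> t <= c / 2 + (c / 2) `^ (1 - q) * t `^ q.
  move=> t0; have [tc|tc] := leP t (c / 2).
    by rewrite ler_wpDr// mulr_ge0 ?powR_ge0.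
  apply: ler_wpDl; first exact: ltW.
  have tp : 0 < t by exact: lt_trans tc.
  rewrite (powR_ge1E _ tp) mulrCA; apply: ler_peMr => //.
  rewrite -opprB powRN mulrC ler_pdivlMr ?powR_gt0// mul1r.
  by apply: ge0_ler_powR; rewrite ?nnegrE; lra.
have H : c * vol r <= c / 2 * vol r + (c / 2) `^ (1 - q) * (vol r * cm (fun x => `|g x| `^ q) r).
  have ing := integ_norm ig.
  have -> : c * vol r = I (fun x => `|g x| * \1_(C r) x) by rewrite I_indic// mulrC.
  rewrite -I_indic// -IZ; last exact: integ_indic.
  have <- : I (fun x => c / 2 * \1_(C r) x) = c / 2 * vol r.
    rewrite IZ; last by have := @integ_indic (cst 1) r; under eq_fun do rewrite mul1r;
       apply; apply: (@integ_bounded _ 1) => // x; rewrite normr1.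
    by rewrite /Rintegral integral_indic// setIT.
  have ii : integ (fun x => c / 2 * \1_(C r) x).
    apply: integZ; have := @integ_indic (cst 1) r; under eq_fun do rewrite mul1r.
    by apply; apply: (@integ_bounded _ 1) => // x; rewrite normr1.
  rewrite -ID//; last by apply: integZ; exact: integ_indic.
  apply: I_le.
  - by apply: integ_indic; exact: integ_norm.
  - by apply: integD => //; apply: integZ; exact: integ_indic.
  - move=> x; rewrite [in leRHS]mulrA -mulrDl ler_wpM2r ?indic_ge0//.
    exact: pw.
have H2 : (c / 2) * vol r <= (c / 2) `^ (1 - q) * (vol r * cm (fun x => `|g x| `^ q) r).
  have -> : c / 2 * vol r = c * vol r - c / 2 * vol r by field.
  by rewrite lerBlDl.
have H3 : (c / 2) `^ q * vol r <= vol r * cm (fun x => `|g x| `^ q) r.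
  rewrite (powR_ge1E _ c2) mulrAC -ler_pdivlMr ?powR_gt0//.
  by rewrite (le_trans H2)// -opprB powRN mulrC.
apply: (@le_trans _ _ (2 `^ q * ((c / 2) `^ q * vol r))); last first.
  by rewrite ler_wpM2l ?powR_ge0.
rewrite mulrA -powRM//; last exact: ltW.
rewrite ler_wpM2r ?vol_ge0// mulrCA divff// mulr1.
by apply: ge0_ler_powR; rewrite ?nnegrE//; lra.
Qed.

End partition.

End finite_measure.

(** * Total variation *)

Section test_fields.
Context {R : realType} {d : nat}.
Variables (a l : 'rV[R]_d).
Hypothesis l_gt0 : forall i, 0 < l ord0 i.

Local Notation Om := (hyperrectangle a l).
Local Notation mu := (lebesgue_on a l).
Local Notation I f := (Rintegral mu setT f).

Let mOm : measurable Om := measurable_hyperrectangle a l.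

Lemma lebesgue_onE (A : set 'rV[R]_d) : mu A = lebesgue_rV d (A `&` Om).
Proof. by []. Qed.

Let mu_setC : mu (~` Om) = 0%E.
Proof. by rewrite lebesgue_onE setICl measure0. Qed.

Lemma lebesgue_on_fin : (mu setT < +oo)%E.
Proof.
rewrite lebesgue_onE setTI lebesgue_rV_hyperrectangle ?ltry// => i.
exact: ltW.
Qed.

Lemma lebesgue_on_ae : {ae mu, forall x, Om x}.
Proof.
by exists (~` Om); split=> //; exact: measurableC.
Qed.

Lemma ge0_integral_lebesgue_on (F : 'rV[R]_d -> \bar R) : measurable_fun setT F ->
  (forall x, 0 <= F x)%E -> (\int[mu]_x F x = \int[lebesgue_rV d]_(x in Om) F x)%E.
Proof.
move=> mF F0; rewrite (ge0_negligible_integral (measurableC mOm))//.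
rewrite setTD setCK; apply: eq_measure_integral => A mA AO.
by rewrite [LHS]lebesgue_onE setIidl.
Qed.

Lemma integ_lebesgue_on (F : 'rV[R]_d -> R) : integ mu F ->
  (lebesgue_rV d).-integrable Om (EFin \o F).
Proof.
move=> /integrableP[mF iF]; apply/integrableP; split; first exact: measurable_funS mF.
by rewrite -ge0_integral_lebesgue_on//; exact: measurableT_comp.
Qed.

(** The measure [mu] lives on the whole space and does not charge the complement of [Om]; this
    returns to the integral over [Om] used in [TV]. *)
Lemma integral_lebesgue_on (F : 'rV[R]_d -> R) : integ mu F ->
  (\int[lebesgue_rV d]_(x in Om) (F x)%:E)%E = (I F)%:E.
Proof.
move=> iF; have mF := integ_measurable iF.
rewrite /Rintegral fineK; last exact: integrable_fin_num.
rewrite (negligible_integral (N := ~` Om))//; last exact: measurableC.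
rewrite setTD setCK; apply: eq_measure_integral => A mA AO.
by rewrite [RHS]lebesgue_onE setIidl.
Qed.

Section one_test_field.
Variable H : 'rV[R]_d -> 'rV[R]_d.
Hypothesis tH : test_fields Om H.

Definition comp i : 'rV[R]_d -> R^o := fun x => H x ord0 i.

Lemma test_out x : ~ Om x -> H x = 0.
Proof.
move=> nx; apply: contrapT => /eqP Hx; apply: nx; case: tH => _ _ + _; apply.
exact: subset_closure.
Qed.

Lemma comp_out i x : ~ Om x -> comp i x = 0.
Proof. by move=> nx; rewrite /comp test_out// mxE. Qed.

Lemma comp_le1 i x : `|comp i x| <= 1.
Proof.
have [Ox|nOx] := pselect (Om x); last by rewrite comp_out// normr0.
case: tH => _ _ _ /(_ _ Ox); apply: le_trans.
rewrite [leRHS]/Num.Def.normr/= mx_normrE.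
by apply: le_trans (le_bigmax _ _ (ord0, i)).
Qed.

Lemma comp_continuous i : continuous (comp i).
Proof.
case: tH => /(_ 0%N)[cH _] _ _ _ x.
apply: (@continuous_comp _ _ _ H (fun v : 'rV[R]_d => v ord0 i)); first exact: cH.
exact: coord_continuous.
Qed.

Let derH (i : 'I_d) (x : 'rV[R]_d) : derivable H x (delta_mx ord0 i).
Proof. by case: tH => /(_ 1%N)[_ /(_ i)[+ _]] _ _ _; exact. Qed.

Lemma comp_derivable (i j : 'I_d) (x : 'rV[R]_d) : derivable (comp i) x (delta_mx ord0 j).
Proof. have [+ _] := derivable_mxP H x (delta_mx ord0 j).
by move=> /(_ (@derH j x) ord0 i). Qed.

Lemma partial_compE i j : partial j (comp i) = fun x => partial j H x ord0 i.
Proof. by apply/funext => x; rewrite /partial derive_mx// mxE. Qed.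

Lemma partial_continuous i j : continuous (partial j (comp i)).
Proof.
rewrite partial_compE => x.
case: tH => /(_ 1%N)[_ /(_ j)[_ [cH _]]] _ _ _.
apply: (@continuous_comp _ _ _ (partial j H) (fun v : 'rV[R]_d => v ord0 i)); first exact: cH.
exact: coord_continuous.
Qed.

(** On the compact support by continuity; off it the field vanishes in a neighbourhood, hence so
    does the derivative. *)
Lemma partial_bounded i j : exists2 M, 0 <= M & forall x, `|partial j (comp i) x| <= M.
Proof.
case: tH => _ cK _ _; set K := closure _ in cK.
have : compact ((fun x => `|partial j (comp i) x|) @` K).
  apply: continuous_compact => //; apply: continuous_subspaceT => x.
  apply: (@continuous_comp _ _ _ (partial j (comp i)) (fun y : R => `|y|)); first exact: partial_continuous.
  exact: norm_continuous.
move=> /compact_bounded[M [_ HM]].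
exists (`|M| + 1); first by rewrite addr_ge0.
move=> x; have [Kx|nKx] := pselect (K x).
  have := HM (`|M| + 1); rewrite ltr_pwDr ?ler_norm// => /(_ isT).
  by move=> /(_ `|partial j (comp i) x|) ; rewrite /= normr_id; apply; exists x.
rewrite (_ : partial j (comp i) x = 0) ?normr0 ?addr_ge0//.
have oK : open (~` K) by apply: closed_openC; exact: closed_closure.
have nx : \near x, comp i x = (cst 0 : 'rV[R]_d -> R^o) x.
  apply: filterS (open_nbhs_nbhs (conj oK nKx)) => y nKy.
  rewrite /comp (_ : H y = 0) ?mxE//.
  by apply: contrapT => /eqP Hy; apply: nKy; exact: subset_closure.
by rewrite /partial (near_eq_derive _ nx) derive_cst.
Qed.

Lemma partial_integ i j : integ mu (partial j (comp i)).
Proof.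
have [M _ HM] := partial_bounded i j.
apply: (@integ_bounded _ _ _ _ lebesgue_on_fin _ M) => //.
exact: continuous_measurable_rV (@partial_continuous i j).
Qed.

Lemma divergence_L2 : L2 mu (divergence H).
Proof.
have H2 (s : seq 'I_d) : L2 mu (fun x => \sum_(i <- s) partial i (comp i) x).
  elim: s => [|i s IH].
    under eq_fun do rewrite big_nil.
    by apply: (@L2_bounded _ _ _ _ lebesgue_on_fin _ 0) => // x; rewrite normr0.
  under eq_fun do rewrite big_cons.
  apply: L2D => //.
  have [M _ HM] := partial_bounded i i.
  apply: (@L2_bounded _ _ _ _ lebesgue_on_fin _ M) => //.
  exact: continuous_measurable_rV (@partial_continuous i i).
exact: H2.
Qed.

End one_test_field.

(** For [u] in L^2 the pairing with a bounded divergence is integrable, so the extended integral in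
    [TV] is a real number. *)
Lemma TV_ge (u : 'rV[R]_d -> R) H : L2 mu u -> test_fields Om H ->
  ((I (fun x => u x * divergence H x))%:E <= TV Om u)%E.
Proof.
move=> Lu tH; apply: ereal_sup_ubound; exists H => //.
by rewrite integral_lebesgue_on//; apply: L2_mul => //; exact: divergence_L2.
Qed.

Lemma TV_le (u : 'rV[R]_d -> R) (M : \bar R) : L2 mu u ->
  (forall H, test_fields Om H -> ((I (fun x => u x * divergence H x))%:E <= M)%E) ->
  (TV Om u <= M)%E.
Proof.
move=> Lu HM; apply: ge_ereal_sup => _ [H tH <-].
rewrite integral_lebesgue_on; first exact: HM.
by apply: L2_mul => //; exact: divergence_L2.
Qed.

Lemma test_fields0 : test_fields Om (cst 0).
Proof.
have E : [set x : 'rV[R]_d | (cst 0 x : 'rV[R]_d) != 0] = set0.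
  by apply/seteqP; split=> x //=; rewrite eqxx.
split.
- by move=> n; exact: cd_cst.
- by rewrite E closure0; exact: compact0.
- by rewrite E closure0.
- by move=> x _; rewrite normr0.
Qed.

Lemma TV_ge0 (u : 'rV[R]_d -> R) : (0 <= TV Om u)%E.
Proof.
apply: ereal_sup_ubound; exists (cst 0); first exact: test_fields0.
rewrite integral0_eq// => x _; rewrite (_ : divergence _ x = 0) ?mulr0//.
by rewrite /divergence big1// => i _; rewrite /partial; under eq_fun do rewrite mxE; rewrite derive_cst.
Qed.

(** Each pairing with a test field is linear in the function, and [TV] is their supremum. *)
Lemma TV_convex (v w : 'rV[R]_d -> R) (t V W : R) : L2 mu v -> L2 mu w ->
  0 <= t <= 1 -> (TV Om v <= V%:E)%E -> (TV Om w <= W%:E)%E ->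
  (TV Om (fun x => (v x + t * (w x - v x))%R) <= (V + t * (W - V))%:E)%E.
Proof.
move=> Lv Lw /andP[t0 t1] hV hW.
have Ld : L2 mu (fun x => t * (w x - v x)) by apply: L2Z; exact: L2B.
apply: TV_le; first exact: L2D.
move=> H tH; rewrite lee_fin; have LH := divergence_L2 tH.
have := le_trans (TV_ge Lv tH) hV; rewrite lee_fin => h1.
have := le_trans (TV_ge Lw tH) hW; rewrite lee_fin => h2.
have -> : I (fun x => (v x + t * (w x - v x)) * divergence H x) =
   ip mu v (divergence H) + t * (ip mu w (divergence H) - ip mu v (divergence H)).
  by rewrite -ipBl// -ipZl//; [rewrite -ipDl|exact: L2B].
rewrite /ip; nra.
Qed.

Lemma TV_cst0 : (TV Om (cst 0%R) <= 0)%E.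
Proof.
apply: TV_le.
  by apply: (@L2_bounded _ _ _ _ lebesgue_on_fin _ 0) => // x; rewrite normr0.
move=> H tH; under eq_fun do rewrite mul0r.
by rewrite (I_cst mu 0) mul0r.
Qed.

End test_fields.

(** * Grids *)

Section grid_one_direction.
Context {R : realType}.
Implicit Types (alpha beta : R) (N : nat) (p : nat -> R).

(* The nodes are padded by repeating the right endpoint, so that grids with
   different numbers of nodes in each direction share a single bound N; the
   padding only creates empty cells. *)
Definition nodes alpha beta N p := [/\ p 0%N = alpha, p N = beta &
  forall m, (p m < p m.+1 /\ p m.+1 <= beta) \/ (p m = beta /\ p m.+1 = beta)].

Variables (alpha beta : R) (N : nat) (p : nat -> R).
Hypothesis Hp : nodes alpha beta N p.

Lemma nodes_leS m : p m <= p m.+1.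
Proof. by case: Hp => _ _ /(_ m)[[/ltW]|[-> ->]]. Qed.

Lemma nodes_homo : {homo p : m k / (m <= k)%N >-> m <= k}.
Proof. by apply: homo_leq => [x|y x z|]; [exact: lexx|exact: le_trans|exact: nodes_leS]. Qed.

Lemma nodes_le m : p m <= beta.
Proof. by case: Hp => _ _ /(_ m)[[/ltW h1 h2]|[-> _]]//; exact: le_trans h2. Qed.

Lemma nodes_ge m : alpha <= p m.
Proof. by case: Hp => <- _ _; exact: nodes_homo. Qed.

Lemma nodes_degenerate m : p m.+1 <= p m -> p m = beta /\ p m.+1 = beta.
Proof. by case: Hp => _ _ /(_ m)[[h _]|//]; rewrite leNgt h. Qed.

Lemma nodes_pad m : (N <= m)%N -> p m = beta.
Proof.
move=> Nm; apply/eqP; rewrite eq_le nodes_le/=.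
by have := nodes_homo Nm; case: Hp => _ -> _.
Qed.

Lemma nodes_disj m k t : p m < t < p m.+1 -> p k < t < p k.+1 -> m = k.
Proof.
move=> /andP[h1 h2] /andP[h3 h4]; have [mk|km|//] := ltngtP m k.
  by have := lt_le_trans h2 (nodes_homo mk); rewrite ltNge (ltW h3).
by have := lt_le_trans h4 (nodes_homo km); rewrite ltNge (ltW h1).
Qed.

Lemma nodes_cov t : alpha < t < beta -> (forall m : 'I_N.+1, t <> p m) ->
  exists m : 'I_N, p m < t < p m.+1.
Proof.
move=> /andP[at_ tb] tp.
have ex : exists m, t < p m by exists N; case: Hp => _ -> _.
pose m := ex_minn ex; have : t < p m /\ forall k, t < p k -> (m <= k)%N.
  by rewrite /m; case: ex_minnP.
move=> [tm mmin]; have m0 : (0 < m)%N.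
  by rewrite lt0n; apply/eqP => m0; move: tm; rewrite m0; case: Hp => -> _ _; rewrite ltNge (ltW at_).
have mN : (m <= N)%N by apply: mmin; case: Hp => _ -> _.
have m1N : (m.-1 < N)%N by rewrite prednK.
exists (Ordinal m1N) => /=; rewrite prednK// tm andbT lt_neqAle.
have -> /= : p m.-1 <= t.
  by rewrite leNgt; apply/negP => /mmin; rewrite leqNgt ltn_predL m0.
rewrite andbT; apply/eqP => E.
have m1N1 : (m.-1 < N.+1)%N by exact: leq_trans m1N _.
by apply: (tp (Ordinal m1N1)); rewrite -E.
Qed.

End grid_one_direction.

Section grids.
Context {R : realType} {d : nat}.
Variables (a l : 'rV[R]_d).
Hypothesis l_gt0 : forall i, 0 < l ord0 i.
Local Notation Om := (hyperrectangle a l).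
Local Notation mu := (lebesgue_on a l).

Definition is_padded N (p : 'I_d -> nat -> R) :=
  forall i, nodes (a ord0 i) (a ord0 i + l ord0 i) N (p i).

Definition gcell N (p : 'I_d -> nat -> R) (r : {ffun 'I_d -> 'I_N}) : set 'rV[R]_d :=
  prodset (fun i => [set` `]p i (r i), p i (r i).+1[]).

Lemma gcellP N (p : 'I_d -> nat -> R) (r : {ffun 'I_d -> 'I_N}) x :
  gcell p r x <-> forall i, p i (r i) < x ord0 i < p i (r i).+1.
Proof. by split=> H i; have := H i; rewrite /= in_itv. Qed.

Lemma measurable_gcell N p (r : {ffun 'I_d -> 'I_N}) : measurable (gcell p r).
Proof. by apply: measurable_prodset => i; exact: measurable_itv. Qed.

Let hyperplaneE i (c : R) : [set x : 'rV[R]_d | x ord0 i = c] =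
  prodset (fun j => if j == i then [set c] else setT).
Proof.
apply/seteqP; split=> x /=; first by move=> <- j; case: eqP => [->|].
by move=> /(_ i); rewrite eqxx.
Qed.

Lemma lebesgue_rV_hyperplane i (c : R) :
  lebesgue_rV d [set x : 'rV[R]_d | x ord0 i = c] = 0%E.
Proof.
rewrite hyperplaneE lebesgue_rV_prodset; last by move=> j; case: ifP.
by rewrite (bigD1 i)//= eqxx lebesgue_measure_set1 mul0e.
Qed.

Lemma ae_hyperplane i (c : R) : {ae mu, forall x : 'rV[R]_d, x ord0 i <> c}.
Proof.
have mh : measurable [set x : 'rV[R]_d | x ord0 i = c].
  by rewrite hyperplaneE; apply: measurable_prodset => j; case: ifP.
exists [set x : 'rV[R]_d | x ord0 i = c]; split=> //.
  apply/eqP; rewrite eq_le; apply/andP; split; last exact: measure_ge0.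
  rewrite -(lebesgue_rV_hyperplane i c) lebesgue_onE; apply: le_measure; rewrite ?inE//.
  by apply: measurableI => //; exact: measurable_hyperrectangle.
by move=> x /= /contrapT.
Qed.

Variables (N : nat) (p : 'I_d -> nat -> R).
Hypothesis Hp : is_padded N p.

Lemma gcell_sub (r : {ffun 'I_d -> 'I_N}) : gcell p r `<=` Om.
Proof.
move=> x /gcellP xr i; have /andP[h1 h2] := xr i; apply/andP; split.
  by apply: le_lt_trans h1; exact: nodes_ge (Hp i) _.
by apply: lt_le_trans h2 _; exact: nodes_le (Hp i) _.
Qed.

Lemma gcell_off_nodes (x : 'rV[R]_d) : Om x ->
  (forall i (m : 'I_N.+1), x ord0 i <> p i m) ->
  exists r : {ffun 'I_d -> 'I_N}, gcell p r x.
Proof.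
move=> Ox xp.
have H i : exists m : 'I_N, p i m < x ord0 i < p i m.+1.
  by apply: (nodes_cov (Hp i)); [exact: Ox|exact: xp].
exists [ffun i => sval (cid (H i))]; apply/gcellP => i; rewrite ffunE.
exact: svalP (cid (H i)).
Qed.

(** Only the hyperplanes through the nodes are missed; they are finitely many and null. *)
Lemma gcell_part : is_part mu (@gcell N p).
Proof.
split; first exact: measurable_gcell.
  move=> r s x /gcellP xr /gcellP xs; apply/ffunP => i; apply: val_inj => /=.
  exact: (nodes_disj (Hp i) (xr i) (xs i)).
have H : {ae mu, forall x : 'rV[R]_d, forall im : 'I_d * 'I_N.+1, x ord0 im.1 <> p im.1 im.2}.
  apply: (@filter_forall _ _ _ _ (ae_filter_ringOfSetsType mu)) => im; exact: ae_hyperplane.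
apply: filterS2 (lebesgue_on_ae a l) H => x Ox xp; apply: gcell_off_nodes => // i m.
exact: (xp (i, m)).
Qed.

Lemma gcell_vol (r : {ffun 'I_d -> 'I_N}) :
  vol mu (@gcell N p) r = \prod_i (p i (r i).+1 - p i (r i)).
Proof.
rewrite /vol lebesgue_onE setIidl; last exact: gcell_sub.
rewrite lebesgue_rV_prodset; last by move=> i; exact: measurable_itv.
have -> : (\prod_(i < d) lebesgue_measure [set` `]p i (r i), p i (r i).+1[] =
    (\prod_(i < d) (p i (r i).+1 - p i (r i)))%:E)%E.
  rewrite -prodEFin; apply: eq_bigr => i _.
  rewrite lebesgue_measure_itv/=; case: ltP => h; first by rewrite EFinB.
  rewrite lee_fin in h.
  by have [-> ->] := nodes_degenerate (Hp i) h; rewrite subrr.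
by [].
Qed.

End grids.

(** * Step functions as test fields *)

Section finite_sums.
Context {R : realType}.

Lemma cvg_bigsum (J : Type) (r : seq J) (F : nat -> J -> R) (G : J -> R) :
  (forall j, F k j @[k --> \oo] --> G j) ->
  \sum_(j <- r) F k j @[k --> \oo] --> \sum_(j <- r) G j.
Proof.
move=> FG; elim: r => [|j r IH].
  by rewrite big_nil; under eq_fun do rewrite big_nil; exact: cvg_cst.
rewrite big_cons; under eq_fun do rewrite big_cons.
by apply: cvgD => //; exact: FG.
Qed.

Lemma cvg_bigprod (J : Type) (r : seq J) (F : nat -> J -> R) (G : J -> R) :
  (forall j, F k j @[k --> \oo] --> G j) ->
  \prod_(j <- r) F k j @[k --> \oo] --> \prod_(j <- r) G j.
Proof.
move=> FG; elim: r => [|j r IH].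
  by rewrite big_nil; under eq_fun do rewrite big_nil; exact: cvg_cst.
rewrite big_cons; under eq_fun do rewrite big_cons.
by apply: cvgM => //; exact: FG.
Qed.

Lemma is_derive_bigsum (J : Type) (r : seq J) (F : J -> R -> R) (dF : J -> R) (x : R) :
  (forall j, is_derive x (1 : R) (F j) (dF j)) ->
  is_derive x (1 : R) (fun t => \sum_(j <- r) F j t) (\sum_(j <- r) dF j).
Proof.
move=> H; elim: r => [|j r IH].
  by rewrite big_nil; under eq_fun do rewrite big_nil; exact: is_derive_cst.
rewrite big_cons; under eq_fun do rewrite big_cons.
by have := H j => Hj; apply: is_deriveD.
Qed.

(** Summation by parts turns the sum into a combination of the values of [c] with the nonnegative
    weights [th m - th m.+1] and [th N], whose total is [th 0]. Applied to smoothed ramps, it keeps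
    a component of a field within [-1, 1]. *)
Lemma sum_by_parts_le1 (c th : nat -> R) N :
  c 0%N = 0 -> (forall m, `|c m| <= 1) -> (forall m, th m.+1 <= th m) ->
  (forall m, 0 <= th m <= 1) ->
  `|\sum_(m < N) (c m.+1 - c m) * th m| <= 1.
Proof.
move=> c0 c1 thS th01.
have -> : \sum_(m < N) (c m.+1 - c m) * th m =
    \sum_(m < N) c m.+1 * (th m - th m.+1) + c N * th N.
  elim: N => [|N IH]; first by rewrite !big_ord0 c0 mul0r addr0.
  by rewrite !big_ord_recr/= IH; ring.
apply: (@le_trans _ _ (th 0%N)); last by have /andP[] := th01 0%N.
have -> : th 0%N = \sum_(m < N) (th m - th m.+1) + th N.
  elim: N => [|N IH]; first by rewrite big_ord0 add0r.
  by rewrite big_ord_recr/= IH; ring.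
apply: (le_trans (ler_normD _ _)); apply: lerD; last first.
  by have /andP[t0 _] := th01 N; rewrite normrM (ger0_norm t0) ler_piMl.
apply: (le_trans (ler_norm_sum _ _ _)); apply: ler_sum => m _.
by rewrite normrM (@ger0_norm _ (_ - _)) ?subr_ge0// ler_piMl// subr_ge0.
Qed.

Lemma min_pos (J : finType) (f : J -> R) :
  exists2 del, 0 < del & forall j, 0 < f j -> del <= f j.
Proof.
suff [del d0 H] : exists2 del, 0 < del & forall j, j \in enum J -> 0 < f j -> del <= f j.
  by exists del => // j; apply: H; rewrite mem_enum.
elim: (enum J) => [|j s [del d0 H]]; first by exists 1.
have [fj|fj] := ltP 0 (f j).
  exists (Num.min del (f j)); first by rewrite lt_min d0.
  move=> k; rewrite inE => /predU1P[->|ks] fk; first by rewrite ge_min lexx orbT.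
  by rewrite ge_min H.
exists del => // k; rewrite inE => /predU1P[->|]; first by rewrite ltNge fj.
exact: H.
Qed.

Lemma prodr_le1 (J : Type) (r : seq J) (F : J -> R) :
  (forall j, 0 <= F j <= 1) -> 0 <= \prod_(j <- r) F j <= 1.
Proof.
move=> F01; elim: r => [|j r /andP[IH0 IH1]]; first by rewrite big_nil ler01 lexx.
rewrite big_cons; have /andP[f0 f1] := F01 j.
by rewrite mulr_ge0//= mulr_ile1.
Qed.

End finite_sums.

Section rescaled_profiles.
Context {R : realType}.
Variables (alpha beta : R) (N : nat) (p : nat -> R).
Hypothesis Hp : nodes alpha beta N p.

(* For an empty cell the division by 0 gives 0, where the profiles vanish. *)
Definition tau m t : R := (t - p m) / (p m.+1 - p m).

Lemma tau_gt e m t : 0 < e -> e < tau m t ->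
  0 < p m.+1 - p m /\ p m + e * (p m.+1 - p m) < t.
Proof.
move=> e0; have := nodes_leS Hp m; rewrite le_eqVlt => /predU1P[E|h].
  by rewrite /tau E subrr invr0 mulr0 => /(lt_trans e0); rewrite ltxx.
rewrite -subr_gt0 in h; split => //; rewrite -ltrBrDl -ltr_pdivlMr//.
Qed.

Lemma tau_lt e m t : 0 < p m.+1 - p m -> tau m t < 1 - e ->
  t < p m.+1 - e * (p m.+1 - p m).
Proof.
by move=> s0; rewrite /tau ltr_pdivrMr// => H; move: H; rewrite mulrBl mul1r; lra.
Qed.

Lemma tau_in m t : 0 < tau m t < 1 -> p m < t < p m.+1.
Proof.
move=> /andP[t0 t1]; have := nodes_leS Hp m; rewrite le_eqVlt => /predU1P[E|h].
  by move: t0; rewrite /tau E subrr invr0 mulr0 ltxx.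
rewrite -subr_gt0 in h; move: t0 t1; rewrite /tau pmulr_lgt0 ?invr_gt0// subr_gt0 => ->/=.
by rewrite ltr_pdivrMr// mul1r ltrD2r.
Qed.

Lemma in_tau m t : p m < t < p m.+1 -> 0 < tau m t < 1.
Proof.
move=> /andP[h1 h2]; have s0 : 0 < p m.+1 - p m by rewrite subr_gt0 (lt_trans h1).
apply/andP; split; first by rewrite /tau divr_gt0// subr_gt0.
by rewrite /tau ltr_pdivrMr// mul1r ltrD2r.
Qed.

Section small.
Variable e : R.
Hypotheses (e0 : 0 < e) (e8 : e <= 8^-1).

Lemma bump_tau_in m t : bump e (tau m t) != 0 -> p m < t < p m.+1.
Proof.
move: (e0) => e0' b0; apply: tau_in; apply/andP; split; rewrite ltNge; apply/negP => h;
  move/eqP: b0; apply; apply: bump_out; [left|right]; lra.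
Qed.

(** The bumps sit in disjoint intervals, so at most one term is nonzero. *)
Lemma sum_bump_le1 t : 0 <= \sum_(m < N) bump e (tau m t) <= 1.
Proof.
apply/andP; split; first by apply: sumr_ge0 => m _; exact: bump_ge0.
have [[m bm]|H] := pselect (exists m : 'I_N, bump e (tau m t) != 0).
  rewrite (bigD1 m)//= big1 ?addr0; first exact: bump_le1.
  move=> k km; apply: contrapT => /eqP bk; move/eqP: km; apply; apply: val_inj => /=.
  exact: (nodes_disj Hp (bump_tau_in bk) (bump_tau_in bm)).
rewrite big1// => m _; apply: contrapT => /eqP bm; apply: H; by exists m.
Qed.

(** If the ramp of the next interval has started, then t lies beyond [p m.+1] and the ramp of
    interval [m] is already 1. *)
Lemma theta_tauS m t : theta e (tau m.+1 t) <= theta e (tau m t).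
Proof.
move: (e0) => e0'; have [h|h] := leP (tau m.+1 t) e; first by rewrite theta_le// theta_ge0.
have [s1 h1] := tau_gt e0 h.
have s0 : 0 < p m.+1 - p m.
  rewrite subr_gt0 ltNge; apply/negP => /(nodes_degenerate Hp)[_ E].
  by move: s1; rewrite E subr_gt0 ltNge (nodes_le Hp).
rewrite [leRHS]theta_ge ?theta_le1//.
apply: (@le_trans _ _ 1); first lra.
by rewrite /tau ler_pdivlMr// mul1r; nra.
Qed.

End small.

Lemma bump_tau_cvg (e : nat -> R) m t : (forall k, 0 < e k) -> e k @[k --> \oo] --> 0 ->
  bump (e k) (tau m t) @[k --> \oo] --> ((nat_of_bool ((p m < t)%R && (t < p m.+1)%R))%:R : R).
Proof.
move=> e0 ec; have [h|h] := boolP ((p m < t) && (t < p m.+1)).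
  by apply: bump_cvg => //; exact: in_tau.
under eq_fun => k.
  rewrite bump_out; last first.
    have [h0|h0] := leP (tau m t) 0; first by left; rewrite (le_trans h0)// ltW.
    have [h1|h1] := leP 1 (tau m t).
      by right; rewrite (le_trans _ h1)// gerBl ltW.
    by move: h; rewrite tau_in// h0.
  over.
exact: cvg_cst.
Qed.

Lemma dtheta_tau_cvg (e : nat -> R) m t : (forall k, 0 < e k) -> (forall k, e k <= 8^-1) ->
  e k @[k --> \oo] --> 0 ->
  dtheta (e k) (tau m t) @[k --> \oo] --> ((nat_of_bool ((p m < t)%R && (t < p m.+1)%R))%:R : R).
Proof.
move=> e0 e8 ec; have [h|h] := boolP ((p m < t) && (t < p m.+1)).
  by apply: dtheta_cvg => //; exact: in_tau.
under eq_fun => k.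
  rewrite dtheta_out; last first.
    have [h0|h0] := leP (tau m t) 0; first by left; rewrite (le_trans h0)// ltW.
    have [h1|h1] := leP 1 (tau m t).
      by right; rewrite (le_trans _ h1)// gerBl ltW.
    by move: h; rewrite tau_in// h0.
  over.
exact: cvg_cst.
Qed.

Lemma Cn_tau k m f : Cn k f -> Cn k (fun t => f (tau m t)).
Proof.
move=> Cf; have := @Cn_affine _ k (p m.+1 - p m)^-1 (- p m / (p m.+1 - p m)) _ Cf.
by congr Cn; apply/funext => t; rewrite /tau mulrBl mulrC mulNr.
Qed.

Lemma is_derive_tau m t (f df : R -> R) :
  is_derive (tau m t) (1 : R) f (df (tau m t)) ->
  is_derive t (1 : R) (fun t => f (tau m t)) (df (tau m t) / (p m.+1 - p m)).
Proof.
move=> df'; have d1 : is_derive t (1 : R) (fun t => tau m t) (p m.+1 - p m)^-1.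
  have d2 : is_derive t (1 : R) (fun t => t - p m) 1.
    by apply: is_derive_eq; rewrite subr0.
  rewrite (_ : (fun t => _) = (fun t => (p m.+1 - p m)^-1 *: (t - p m))); last first.
    by apply/funext => x; rewrite /tau mulrC.
  by apply: is_derive_eq; rewrite /GRing.scale/= mulr1.
exact: (@is_derive1_comp _ f (fun t => tau m t)).
Qed.

End rescaled_profiles.

Section line_derivative.
Context {R : realType} {d : nat}.

Lemma derive_along_axis (i : 'I_d) (F : 'rV[R]_d -> R^o) (g : R -> R) (dg : R)
    (x : 'rV[R]_d) :
  (forall h, F (h *: delta_mx ord0 i + x) = g (h + x ord0 i)) ->
  is_derive (x ord0 i) (1 : R) g dg -> is_derive x (delta_mx ord0 i) F dg.
Proof.
move=> Fg [dp dE].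
have E : (fun h : R => h^-1 *: ((F \o shift x) (h *: delta_mx ord0 i) - F x)) =
    fun h => h^-1 *: ((g \o shift (x ord0 i)) (h *: (1 : R)) - g (x ord0 i)).
  apply/funext => h /=; rewrite Fg /GRing.scale/= mulr1.
  by have := Fg 0; rewrite scale0r !add0r => ->.
by split; [rewrite /derivable E; exact: dp|rewrite /derive E; exact: dE].
Qed.

End line_derivative.

Section step_fields.
Context {R : realType} {n : nat}.
Variables (a l : 'rV[R]_n.+1).
Hypothesis l_gt0 : forall i, 0 < l ord0 i.
Local Notation Om := (hyperrectangle a l).
Local Notation mu := (lebesgue_on a l).
Local Notation I f := (Rintegral mu setT f).

Variables (N : nat) (p : 'I_n.+1 -> nat -> R).
Hypothesis Hp : is_padded a l N p.

Definition insidx (i : 'I_n.+1) (m : 'I_N) (r' : {ffun 'I_n -> 'I_N}) :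
    {ffun 'I_n.+1 -> 'I_N} :=
  [ffun j => if unlift i j is Some k then r' k else m].

Lemma insidx_same i m r' : insidx i m r' i = m.
Proof. by rewrite ffunE unlift_none. Qed.

Lemma insidx_lift i m r' k : insidx i m r' (lift i k) = r' k.
Proof. by rewrite ffunE liftK. Qed.

Lemma sum_insidx i (F : {ffun 'I_n.+1 -> 'I_N} -> R) :
  \sum_r F r = \sum_r' \sum_m F (insidx i m r').
Proof.
rewrite pair_big/= (reindex (fun q : {ffun 'I_n -> 'I_N} * 'I_N => insidx i q.2 q.1))//=.
exists (fun r : {ffun 'I_n.+1 -> 'I_N} => ([ffun k => r (lift i k)], r i)) => [[r' m]|r] _ /=.
  by rewrite insidx_same; congr pair; apply/ffunP => k; rewrite ffunE insidx_lift.
apply/ffunP => j; case: (unliftP i j) => [k ->|->].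
  by rewrite insidx_lift ffunE.
by rewrite insidx_same.
Qed.

(** The volume, one dimension lower, of the face orthogonal to direction [i] with transverse index
    [r']. *)
Definition fvol i (r' : {ffun 'I_n -> 'I_N}) : R :=
  \prod_k (p (lift i k) (r' k).+1 - p (lift i k) (r' k)).

Lemma vol_insidx i m r' :
  vol mu (@gcell _ _ N p) (insidx i m r') = (p i m.+1 - p i m) * fvol i r'.
Proof.
rewrite (gcell_vol Hp) (bigD1_ord i)//= insidx_same; congr (_ * _).
by apply: eq_bigr => k _; rewrite insidx_lift.
Qed.

Lemma gcell_insidx i m r' x : gcell p (insidx i m r') x <->
  p i m < x ord0 i < p i m.+1 /\ forall k, p (lift i k) (r' k) < x ord0 (lift i k) < p (lift i k) (r' k).+1.
Proof.
split=> [/gcellP H|[H1 H2]].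
  by split=> [|k]; [have := H i; rewrite insidx_same|have := H (lift i k); rewrite insidx_lift].
apply/gcellP => j; case: (unliftP i j) => [k ->|->].
  by rewrite insidx_lift.
by rewrite insidx_same.
Qed.

(** Nodal values of a field: [c i m r'] is meant as the value of the component [i] on the face [r']
    of the hyperplane through the node [m]. Vanishing at both ends says that the normal component is
    0 on the boundary; [c_right] covers the padding nodes as well. *)
Variable c : 'I_n.+1 -> nat -> {ffun 'I_n -> 'I_N} -> R.
Hypothesis c_le1 : forall i m r', `|c i m r'| <= 1.
Hypothesis c_left : forall i r', c i 0%N r' = 0.
Hypothesis c_right : forall i m r', p i m = a ord0 i + l ord0 i -> c i m r' = 0.

Let s i m := p i m.+1 - p i m.
Let dc i m r' := c i m.+1 r' - c i m r'.

Let dc_degenerate i m r' : s i m <= 0 -> dc i m r' = 0.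
Proof.
rewrite /s subr_le0 => /(nodes_degenerate (Hp i))[E1 E2].
by rewrite /dc !c_right ?subr0.
Qed.

Section one_field.
Variable e : R.
Hypotheses (e0 : 0 < e) (e8 : e <= 8^-1).

Definition prodb i (r' : {ffun 'I_n -> 'I_N}) (x : 'rV[R]_n.+1) : R :=
  \prod_k bump e (tau (p (lift i k)) (r' k) (x ord0 (lift i k))).

(** A smoothed version of the interpolation, affine between nodes, of the nodal values
    [c i m r']. *)
Definition prim i r' t : R := \sum_(m < N) dc i m r' * theta e (tau (p i) m t).

(** As [e] tends to 0 the component becomes affine in its own variable and constant in the others on
    each cell, like a Raviart-Thomas field of lowest order; its jumps across transverse faces do not
    enter the divergence. *)
Definition step_field_comp i (x : 'rV[R]_n.+1) : R^o :=
  \sum_r' prodb i r' x * prim i r' (x ord0 i).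

Definition step_field (x : 'rV[R]_n.+1) : 'rV[R]_n.+1 := \row_i step_field_comp i x.

Let prodb01 i r' x : 0 <= prodb i r' x <= 1.
Proof. by apply: prodr_le1 => k; rewrite bump_ge0 bump_le1. Qed.

Lemma prim_le1 i r' t : `|prim i r' t| <= 1.
Proof.
apply: (@sum_by_parts_le1 _ (c i ^~ r') (fun m => theta e (tau (p i) m t))) => //.
- by move=> m; exact: (theta_tauS (Hp i)).
- by move=> m; rewrite theta_ge0 ?theta_le1.
Qed.

(** Each [prim] is at most 1, and the sum of the products [prodb] factors into a product over the
    directions of sums of bumps, each at most 1. *)
Lemma step_field_comp_le1 i x : `|step_field_comp i x| <= 1.
Proof.
apply: (le_trans (ler_norm_sum _ _ _)).
apply: (@le_trans _ _ (\sum_r' prodb i r' x)).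
  apply: ler_sum => r' _; have /andP[b0 _] := prodb01 i r' x.
  by rewrite normrM (ger0_norm b0) ler_piMr// prim_le1.
rewrite /prodb -(bigA_distr_bigA (fun k (m : 'I_N) => bump e (tau (p (lift i k)) m (x ord0 (lift i k)))))/=.
by have /andP[] := prodr_le1 (index_enum 'I_n) (fun k => sum_bump_le1 (Hp (lift i k)) e0 (x ord0 (lift i k))).
Qed.

Lemma step_field_smooth : smooth step_field.
Proof.
move=> k; apply: cd_row => i.
rewrite (_ : (fun x => _) = step_field_comp i); last by apply/funext => x; rewrite mxE.
apply: cd_sum => r' _; apply: cdM.
  apply: cd_prod => j _; apply: (@cd_coord _ _ _ _ (fun t => bump e (tau (p (lift i j)) (r' j) t))).
  by apply: Cn_tau; exact: bump_Cn.
apply: cd_sum => m _; apply: cdM; first exact: cd_cst.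
apply: (@cd_coord _ _ _ _ (fun t => theta e (tau (p i) m t))).
by apply: Cn_tau; exact: theta_Cn.
Qed.

Definition step_field_div i (x : 'rV[R]_n.+1) : R :=
  \sum_r' \sum_(m < N) prodb i r' x *
    (dc i m r' * (dtheta e (tau (p i) m (x ord0 i)) / s i m)).

Lemma step_field_derive i x :
  is_derive x (delta_mx ord0 i) (step_field_comp i) (step_field_div i x).
Proof.
apply: (@derive_along_axis _ _ _ _ (fun t => \sum_r' prodb i r' x * prim i r' t)).
  move=> h; apply: eq_bigr => r' _; congr (_ * _); last first.
    by rewrite !mxE !eqxx mulr1.
  apply: eq_bigr => k _; congr (bump e (tau _ _ _)).
  by rewrite !mxE eqxx/= eq_sym (negbTE (neq_lift i k)) mulr0 add0r.
apply: is_derive_bigsum => r'; rewrite -mulr_sumr.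
have dp : is_derive (x ord0 i) (1 : R) (prim i r')
    (\sum_(m < N) dc i m r' * (dtheta e (tau (p i) m (x ord0 i)) / s i m)).
  apply: is_derive_bigsum => m.
  have dm := is_derive_tau (p := p i) (m := m) (theta_derive e0 e8 (tau (p i) m (x ord0 i))).
  exact: (@is_deriveZ _ _ _ (fun t => theta e (tau (p i) m t)) (dc i m r') _ 1 _ dm).
exact: (@is_deriveZ _ _ _ (prim i r') (prodb i r' x) _ 1 _ dp).
Qed.

Section support.
Variable del : R.
Hypothesis del_le : forall j (m : 'I_N), 0 < s j m -> del <= e * s j m.

Let bump_support j (m : 'I_N) t : bump e (tau (p j) m t) != 0 ->
  a ord0 j + del < t < a ord0 j + l ord0 j - del.
Proof.
move=> bm; have e0' := e0; have h1 : e < tau (p j) m t.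
  by rewrite ltNge; apply/negP => h; move/eqP: bm; apply; apply: bump_out; left.
have h2 : tau (p j) m t < 1 - e.
  by rewrite ltNge; apply/negP => h; move/eqP: bm; apply; apply: bump_out; right.
have [s0 h3] := tau_gt (Hp j) e0 h1; have h4 := tau_lt s0 h2.
have := del_le s0; have := nodes_ge (Hp j) m; have := nodes_le (Hp j) m.+1.
by rewrite /s => ? ? ?; apply/andP; split; lra.
Qed.

Let prim_left i r' t : t <= a ord0 i + del -> prim i r' t = 0.
Proof.
move=> ht; rewrite /prim big1// => m _; have [h|h] := leP (tau (p i) m t) e.
  by rewrite theta_le// mulr0.
have [s0 h3] := tau_gt (Hp i) e0 h.
have := del_le s0; have := nodes_ge (Hp i) m.
by rewrite /s => ? ?; exfalso; lra.
Qed.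

(** Close to the right end every ramp of positive length has reached 1, so the increments telescope
    to the difference of the two boundary values, which are 0. Empty cells have increment 0. *)
Let prim_right i r' t : a ord0 i + l ord0 i - del <= t -> prim i r' t = 0.
Proof.
move=> ht; rewrite /prim (eq_bigr (fun m : 'I_N => dc i m r')); last first.
  move=> m _; have [s0|s0] := ltP 0 (s i m); last by rewrite dc_degenerate// mul0r.
  have [h|h] := leP (1 - e) (tau (p i) m t); first by rewrite theta_ge// mulr1.
  have h4 := tau_lt s0 h; have := del_le s0; have := nodes_le (Hp i) m.+1.
  by rewrite /s => ? ?; exfalso; lra.
rewrite -(big_mkord xpredT (fun m => c i m.+1 r' - c i m r')) telescope_sumr//.
by rewrite c_left c_right ?subrr//; case: (Hp i).
Qed.

Lemma step_field_support i x : step_field_comp i x != 0 ->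
  forall j, a ord0 j + del <= x ord0 j <= a ord0 j + l ord0 j - del.
Proof.
move=> Hx j; have [r' Hr] : exists r', prodb i r' x * prim i r' (x ord0 i) != 0.
  apply: contrapT => H; move/eqP: Hx; apply; apply: big1 => r' _.
  by apply: contrapT => /eqP h; apply: H; exists r'.
move: Hr; rewrite mulf_eq0 negb_or => /andP[b0 p0].
case: (unliftP i j) => [k ->|->].
  have : bump e (tau (p (lift i k)) (r' k) (x ord0 (lift i k))) != 0.
    by apply: contraNneq b0 => bk; rewrite /prodb (bigD1 k)//= bk mul0r.
  by move=> /bump_support/andP[/ltW -> /ltW ->].
apply/andP; split; rewrite leNgt; apply/negP => /ltW h.
  by move/eqP: p0; apply; exact: prim_left.
by move/eqP: p0; apply; exact: prim_right.
Qed.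

End support.

(** The support keeps a distance from the boundary of at least [e] times the smallest positive cell
    length, so it lies in a closed box inside [Om]. *)
Lemma step_field_test : test_fields Om step_field.
Proof.
have [del0 d0 Hdel0] := min_pos (fun jm : 'I_n.+1 * 'I_N => e * s jm.1 jm.2).
have Hdel j (m : 'I_N) : 0 < s j m -> del0 <= e * s j m.
  by move=> s0; apply: (Hdel0 (j, m)); rewrite mulr_gt0.
pose K : set 'rV[R]_n.+1 := [set v | forall j,
  [set` `[a ord0 j + del0, a ord0 j + l ord0 j - del0]] (v ord0 j)].
have cK : compact K.
  apply: (@rV_compact R n.+1 (fun j => [set` `[a ord0 j + del0, a ord0 j + l ord0 j - del0]])) => j.
  exact: segment_compact.
have sK : [set x | step_field x != 0] `<=` K.
  move=> x /= Hx; have [i Hi] : exists i, step_field_comp i x != 0.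
    apply: contrapT => H; move/eqP: Hx; apply; apply/rowP => i; rewrite !mxE.
    by apply: contrapT => /eqP h; apply: H; exists i.
  by move=> j /=; rewrite in_itv/=; exact: (step_field_support Hdel Hi).
have scK : closure [set x | step_field x != 0] `<=` K.
  have clK : closed K by apply: compact_closed => //; exact: norm_hausdorff.
  by rewrite [X in _ `<=` X](closure_id K).1//; exact: closure_subset.
split.
- exact: step_field_smooth.
- by apply: subclosed_compact cK scK; exact: closed_closure.
- move=> x /scK Kx i; have := Kx i; rewrite /= in_itv/= => /andP[h1 h2].
  by move: d0 => d0; apply/andP; split; lra.
- move=> x _; rewrite [leLHS]/Num.Def.normr/= mx_normrE (bigmax_le _ ler01)//= => -[k i] _.
  by rewrite /= (ord1 k) mxE; exact: step_field_comp_le1.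
Qed.

Lemma step_field_divergence x : divergence step_field x = \sum_i step_field_div i x.
Proof.
apply: eq_bigr => i _; rewrite /partial.
rewrite (_ : (fun y => _) = step_field_comp i); last by apply/funext => y; rewrite mxE.
by have [_ ->] := step_field_derive i x.
Qed.

(** Here 8 = 2 * 4, from an increment of [c] and from [dtheta]. The bound is independent of [e]. *)
Lemma step_field_div_le i x :
  `|step_field_div i x| <= \sum_(r' : {ffun 'I_n -> 'I_N}) \sum_(m < N) 8 * `|s i m|^-1.
Proof.
apply: (le_trans (ler_norm_sum _ _ _)); apply: ler_sum => r' _.
apply: (le_trans (ler_norm_sum _ _ _)); apply: ler_sum => m _.
have /andP[b0 b1] := prodb01 i r' x.
have h2 := dtheta_le4 e0 e8 (tau (p i) m (x ord0 i)).
move: (dtheta _ _) h2 => D h2; rewrite !normrM normfV (ger0_norm b0).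
have h1 : `|dc i m r'| <= 2.
  by rewrite (le_trans (ler_normB _ _))// (_ : 2 = 1 + 1)// lerD.
have h3 : 0 <= `|s i m|^-1 by rewrite invr_ge0.
rewrite mulrA mulrA ler_wpM2r// .
have h4 : prodb i r' x * `|dc i m r'| <= 2.
  by apply: le_trans h1; rewrite ler_piMl.
apply: (@le_trans _ _ (2 * 4)); last by rewrite -natrM.
by apply: ler_pM => //; rewrite mulr_ge0.
Qed.

End one_field.

(** The smooth fields for [e] tending to 0 are admissible and their divergences converge boundedly
    to the increments of [c] divided by the cell lengths; dominated convergence does the rest. This
    is the only source of lower bounds on [TV] from now on. *)
Lemma TV_ge_step (u : 'rV[R]_n.+1 -> R) : L2 mu u ->
  ((\sum_i \sum_r' \sum_(m < N) (c i m.+1 r' - c i m r') *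
     (fvol i r' * cm mu (@gcell _ _ N p) u (insidx i m r')))%:E <= TV Om u)%E.
Proof.
move=> Lu; have Cp := gcell_part Hp; have fin := lebesgue_on_fin a l_gt0.
have iu := L2_integ fin Lu.
pose e k : R := (k.+1%:R)^-1 / 8.
have e0 k : 0 < e k by rewrite divr_gt0// invr_gt0 ltr0n.
have e8 k : e k <= 8^-1.
  by rewrite /e ler_piMl ?invr_ge0// invf_le1 ?ltr0n// ler1n.
have ec : e k @[k --> \oo] --> 0.
  rewrite -(mul0r (8^-1)); apply: cvgM; last exact: cvg_cst.
  exact: cvg_harmonic.
pose lim_i x : R := \sum_i \sum_r' \sum_(m < N)
  (dc i m r' / s i m) * \1_(gcell p (insidx i m r')) x.
have pw x : \sum_i step_field_div (e k) i x @[k --> \oo] --> lim_i x.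
  apply: cvg_bigsum => i; apply: cvg_bigsum => r'; apply: cvg_bigsum => m.
  have -> : \1_(gcell p (insidx i m r')) x = (\prod_k
      (nat_of_bool ((p (lift i k) (r' k) < x ord0 (lift i k))%R && (x ord0 (lift i k) < p (lift i k) (r' k).+1)%R))%:R) *
      (nat_of_bool ((p i m < x ord0 i)%R && (x ord0 i < p i m.+1)%R))%:R :> R.
    rewrite indicE; have [xc|xc] := pselect (gcell p (insidx i m r') x).
      rewrite mem_set//; have [-> H] := (gcell_insidx i m r' x).1 xc.
      by rewrite big1 ?mulr1// => k _; rewrite H.
    rewrite memNset//; case: (boolP (_ && _)) => [h|_]; last by rewrite mulr0.
    have [k Hk] : exists k, ~~ (p (lift i k) (r' k) < x ord0 (lift i k) < p (lift i k) (r' k).+1).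
      apply: contrapT => H; apply: xc; apply/gcell_insidx; split=> // k.
      by apply: contrapT => /negP nk; apply: H; exists k.
    by rewrite (bigD1 k)//= (negbTE Hk) mul0r mul0r.
  rewrite mulrCA; apply: cvgM.
    by apply: cvg_bigprod => k; exact: (bump_tau_cvg (Hp (lift i k))).
  rewrite mulrAC; rewrite -mulrA; apply: cvgM; first exact: cvg_cst.
  by apply: cvgM; [exact: (dtheta_tau_cvg (Hp i))|exact: cvg_cst].
pose M : R := \sum_i \sum_(r' : {ffun 'I_n -> 'I_N}) \sum_(m < N) 8 * `|s i m|^-1.
have c1 : I (fun x => u x * divergence (step_field (e k)) x) @[k --> \oo] -->
    I (fun x => u x * lim_i x).
  have mdiv k : measurable_fun setT (divergence (step_field (e k))).
    by have [] := divergence_L2 l_gt0 (step_field_test (e0 k) (e8 k)).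
  have mu_ : measurable_fun setT u by case: Lu.
  apply: (@I_dominated _ _ _ _ _ _ (fun x => M * `|u x|)).
  - by move=> k; apply: measurable_funM.
  - apply: measurable_funM => //.
    apply: measurable_sum => i; apply: measurable_sum => r'; apply: measurable_sum => m.
    by apply: measurable_funM => //; apply: measurable_indic; exact: measurable_gcell.
  - by apply: integZ; exact: integ_norm.
  - move=> k x; rewrite normrM mulrC ler_wpM2r// step_field_divergence//.
    apply: (le_trans (ler_norm_sum _ _ _)); apply: ler_sum => i _.
    exact: step_field_div_le.
  - apply: aeW => x; apply: cvgM; first exact: cvg_cst.
    under eq_fun do rewrite step_field_divergence//.
    exact: pw.
have c2 : I (fun x => u x * lim_i x) = \sum_i \sum_r' \sum_(m < N) (c i m.+1 r' - c i m r') *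
     (fvol i r' * cm mu (@gcell _ _ N p) u (insidx i m r')).
  rewrite (_ : (fun x => _) = fun x => \sum_i \sum_r' \sum_(m < N)
      (dc i m r' / s i m) * (u x * \1_(gcell p (insidx i m r')) x)); last first.
    apply/funext => x; rewrite /lim_i mulr_sumr; apply: eq_bigr => i _.
    rewrite mulr_sumr; apply: eq_bigr => r' _; rewrite mulr_sumr; apply: eq_bigr => m _.
    by rewrite mulrCA.
  have ii i r' (m : 'I_N) : integ mu (fun x => dc i m r' / s i m * (u x * \1_(gcell p (insidx i m r')) x)).
    by apply: integZ; apply: (integ_indic Cp).
  rewrite I_sum; last by move=> i _; do 2 (apply: integ_sum => ? _); exact: ii.
  apply: eq_bigr => i _; rewrite I_sum; last by move=> r' _; apply: integ_sum => ? _; exact: ii.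
  apply: eq_bigr => r' _; rewrite I_sum; last by move=> ? _; exact: ii.
  apply: eq_bigr => m _; rewrite IZ; last exact: (integ_indic Cp).
  rewrite (I_indic fin Cp)// vol_insidx.
  (* The cell volume is the length times [fvol], so the length cancels; on an empty cell the
     increment of [c] is already 0. *)
  have [s0|s0] := eqVneq (s i m) 0.
    by rewrite -/(dc i m r') dc_degenerate ?s0// !mul0r.
  by rewrite -/(dc i m r') -/(s i m); field.
rewrite -c2; have := TV_ge0 a l u; case E : (TV Om u) => [t| |]//; last by move=> _; exact: leey.
move=> _; rewrite lee_fin; apply: (ler_cvg_to c1 (cvg_cst t)).
apply: nearW => k; rewrite -lee_fin -E; apply: TV_ge => //.
exact: step_field_test.
Qed.

End step_fields.

(** * Variation of step functions *)

Section step_variation.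
Context {R : realType} {n : nat}.
Variables (a l : 'rV[R]_n.+1).
Hypothesis l_gt0 : forall i, 0 < l ord0 i.
Local Notation Om := (hyperrectangle a l).
Local Notation mu := (lebesgue_on a l).
Local Notation I f := (Rintegral mu setT f).

(** Discrete summation by parts on both sides: with zero boundary values only the products of a jump
    and an interior nodal value remain. *)
Lemma sum_by_parts2 (w v F G : nat -> R) N : F 0%N = 0 -> G 0%N = 0 -> F N = 0 -> G N = 0 ->
  (forall m, (m.+1 < N)%N -> (w m.+1 - w m) * F m.+1 = (v m.+1 - v m) * G m.+1) ->
  \sum_(m < N) w m * (F m.+1 - F m) = \sum_(m < N) v m * (G m.+1 - G m).
Proof.
case: N => [|N] F0 G0 FN GN H; first by rewrite !big_ord0.
have D K : (K < N.+1)%N -> \sum_(m < K.+1) w m * (F m.+1 - F m) -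
    \sum_(m < K.+1) v m * (G m.+1 - G m) = w K * F K.+1 - v K * G K.+1.
  elim: K => [|K IH] KN; first by rewrite !big_ord1 F0 G0 !subr0.
  rewrite big_ord_recr/= [X in _ - X]big_ord_recr/=.
  have := IH (ltnW KN) => /eqP; rewrite subr_eq => /eqP ->.
  by have := H K KN => HK; lra.
by apply/eqP; rewrite -subr_eq0 D// FN GN !mulr0 subrr.
Qed.

Variables (N : nat) (p : 'I_n.+1 -> nat -> R).
Hypothesis Hp : is_padded a l N p.

Definition face i (r' : {ffun 'I_n -> 'I_N}) : set 'rV[R]_n :=
  prodset (fun k => [set` `]p (lift i k) (r' k), p (lift i k) (r' k).+1[]).

Lemma measurable_face i r' : measurable (face i r').
Proof. by apply: measurable_prodset => k; exact: measurable_itv. Qed.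

Lemma lebesgue_face i r' : lebesgue_rV n (face i r') = (fvol p i r')%:E.
Proof.
rewrite lebesgue_rV_prodset; last by move=> k; exact: measurable_itv.
rewrite -prodEFin; apply: eq_bigr => k _.
rewrite lebesgue_measure_itv/=; case: ltP => h; first by rewrite EFinB.
rewrite lee_fin in h.
by have [-> ->] := nodes_degenerate (Hp (lift i k)) h; rewrite subrr.
Qed.

Lemma lebesgue_face_lty i r' : (lebesgue_rV n (face i r') < +oo)%E.
Proof. by rewrite lebesgue_face ltry. Qed.

Section one_test_field.
Variable H : 'rV[R]_n.+1 -> 'rV[R]_n.+1.
Hypothesis tH : test_fields Om H.

Let insE i t h (y : 'rV[R]_n) : ins i (h + t, y) = h *: delta_mx ord0 i + ins i (t, y).
Proof.
apply/rowP => j; case: (unliftP i j) => [k ->|->].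
  by rewrite ins_lift mxE ins_lift !mxE eqxx eq_sym (negbTE (neq_lift i k)) mulr0 add0r.
by rewrite ins_same mxE ins_same !mxE !eqxx mulr1.
Qed.

Let ins_continuous i (y : 'rV[R]_n) : continuous (fun t : R => ins i (t, y)).
Proof.
rewrite (_ : (fun t => _) = (fun t : R => t *: delta_mx ord0 i + ins i (0, y))); last first.
  by apply/funext => t; rewrite -insE addr0.
move=> t; apply: (@continuousD R 'rV[R]_n.+1 R (fun t : R => t *: delta_mx ord0 i) (cst (ins i (0, y)))).
  exact: scalel_continuous.
exact: cst_continuous.
Qed.

Let is_derive_ins i t (y : 'rV[R]_n) : is_derive t (1 : R)
  (fun t => comp H i (ins i (t, y)) : R) (partial i (comp H i) (ins i (t, y))).
Proof.
have dH := @comp_derivable _ _ _ _ _ tH i i (ins i (t, y)).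
have E : (fun h : R => h^-1 *: (((fun t => comp H i (ins i (t, y)) : R) \o shift t) (h *: (1 : R))
      - comp H i (ins i (t, y)))) =
    fun h => h^-1 *: ((comp H i \o shift (ins i (t, y))) (h *: delta_mx ord0 i) - comp H i (ins i (t, y))).
  by apply/funext => h /=; rewrite -insE /GRing.scale/= mulr1.
by split; [rewrite /derivable E; exact: dH|rewrite /derive E].
Qed.

Definition face_int i m r' : R :=
  \int[lebesgue_rV n]_(y in face i r') (comp H i (ins i (p i m, y)) : R).

Let mcomp i t : measurable_fun setT (fun y : 'rV[R]_n => comp H i (ins i (t, y))).
Proof.
apply: (@measurableT_comp _ _ _ _ _ _ (comp H i) _ (fun y => ins i (t, y))).
  exact: continuous_measurable_rV (comp_continuous tH (i := i)).
apply: (@measurableT_comp _ _ _ _ _ _ (@ins R n i) _ (fun y => (t, y))).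
  exact: measurable_ins.
by apply/measurable_fun_pairP; split; [exact: measurable_cst|exact: measurable_id].
Qed.

Let icomp i r' t : (lebesgue_rV n).-integrable (face i r') (EFin \o (fun y => comp H i (ins i (t, y)))).
Proof.
apply: measurable_bounded_integrable; first exact: measurable_face.
- exact: lebesgue_face_lty.
- exact: measurable_funTS.
- exists 1; split; first exact: num_real.
  move=> M M1 y _; apply: le_trans (ltW M1); exact: (comp_le1 tH).
Qed.

Lemma face_int_le i m r' : `|face_int i m r'| <= fvol p i r'.
Proof.
have ii := icomp i r' (p i m); apply: (le_trans (le_normr_Rintegral (measurable_face i r') ii)).
have -> : fvol p i r' = \int[lebesgue_rV n]_(y in face i r') 1.
  rewrite Rintegral_cst; last exact: measurable_face.
  by rewrite mul1r; exact: (esym (congr1 fine (lebesgue_face i r'))).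
apply: le_Rintegral.
- exact: measurable_face.
- exact: integrable_norm.
- apply: measurable_bounded_integrable; first exact: measurable_face.
  + exact: lebesgue_face_lty.
  + exact: measurable_cst.
  + exists 1; split; first exact: num_real.
    by move=> M M1 y _; rewrite /= normr1; exact: ltW.
- by move=> y _; exact: (comp_le1 tH).
Qed.

Lemma face_int_boundary i m r' : p i m = a ord0 i \/ p i m = a ord0 i + l ord0 i ->
  face_int i m r' = 0.
Proof.
move=> pm; rewrite /face_int (_ : (fun y => _) = cst 0).
  by rewrite Rintegral_cst ?mul0r//; exact: measurable_face.
apply/funext => y; apply: (comp_out tH) => /(_ i); rewrite ins_same/=.
by case: pm => ->; rewrite ltxx ?andbF.
Qed.

(** Gauss's theorem on one cell for the component [i] alone: along each line in direction [i] the
    fundamental theorem of calculus gives the difference of the end values, and Fubini integrates it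
    over the face. *)
Lemma face_divergence i (m : 'I_N) r' :
  I (fun x => partial i (comp H i) x * \1_(gcell p (insidx i m r')) x) =
  face_int i m.+1 r' - face_int i m r'.
Proof.
have Cp := gcell_part Hp; have fin := lebesgue_on_fin a l_gt0.
have [E|h] : p i m = p i m.+1 \/ p i m < p i m.+1.
  by have := nodes_leS (Hp i) m; rewrite le_eqVlt => /predU1P[->|]; [left|right].
  rewrite /face_int E subrr (_ : (fun x => _) = cst 0); first by rewrite (I_cst mu 0) mul0r.
  apply/funext => x; rewrite indicE memNset ?mulr0// => /gcell_insidx[/andP[h1 h2] _].
  by move: (lt_trans h1 h2); rewrite E ltxx.
have ig : integ mu (fun x => partial i (comp H i) x * \1_(gcell p (insidx i m r')) x).
  by apply: (integ_indic Cp); exact: (partial_integ l_gt0 tH).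
apply: EFin_inj; rewrite -(integral_lebesgue_on ig).
set F := fun x => (partial i (comp H i) x * \1_(gcell p (insidx i m r')) x)%:E.
have mF : measurable_fun setT F by apply/measurable_EFinP; exact: integ_measurable ig.
have FE : F \_ Om = F.
  apply/funext => x; rewrite patchE; case: ifPn => // xO.
  rewrite /F indicE memNset ?mulr0// => /(gcell_sub Hp) xO'.
  by move: xO; rewrite mem_set.
have iF : (lebesgue_rV n.+1).-integrable setT F.
  rewrite -FE; apply/(integrable_mkcond _ (measurable_hyperrectangle a l)).
  exact: integ_lebesgue_on.
rewrite integral_mkcond FE (integral_ins i iF).
have inner y : (\int[lebesgue_measure]_t F (ins i (t, y)) =
    ((fun y => comp H i (ins i (p i m.+1, y)) - comp H i (ins i (p i m, y))) \_ (face i r') y)%:E)%E.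
  rewrite patchE; case: ifPn => [yf|yf]; last first.
    rewrite integral0_eq// => t _; rewrite /F indicE memNset ?mulr0//.
    move=> /gcell_insidx[_ hk]; move/negP: yf; apply; rewrite inE => k /=.
    by rewrite in_itv/=; have := hk k; rewrite ins_lift.
  have cf : continuous (fun t : R => partial i (comp H i) (ins i (t, y)) : R).
    move=> t; apply: (@continuous_comp _ _ _ (fun t => ins i (t, y)) (partial i (comp H i))).
      exact: ins_continuous.
    exact: (partial_continuous tH).
  apply: etrans (FTC_segment h cf (fun t => @is_derive_ins i t y)).
  rewrite [RHS]integral_mkcond; apply: eq_integral => t _.
  rewrite /F patchE; case: ifPn => ht.
    rewrite indicE mem_set ?mulr1//; apply/gcell_insidx; split.
      by rewrite ins_same; move: ht; rewrite inE/= in_itv.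
    by move=> k; rewrite ins_lift; move: yf; rewrite inE => /(_ k)/=; rewrite in_itv.
  rewrite indicE memNset ?mulr0// => /gcell_insidx[].
  rewrite ins_same/= => ht' _; move/negP: ht; apply.
  by rewrite inE/= in_itv.
under eq_integral do rewrite inner.
have mf := measurable_face i r'.
rewrite /face_int -RintegralB//.
rewrite Rintegral_mkcond /Rintegral fineK//; apply: integrable_fin_num => //.
have := (integrable_mkcond _ mf).1
  (integrableB mf (icomp i r' (p i m.+1)) (icomp i r' (p i m))).
by congr (is_true (integrable _ _ _)); apply/funext => y; rewrite !patchE; case: ifP.
Qed.

End one_test_field.

(* The dual fields for the modified step function are dual fields for u: at an
   interior node the jump of w is the jump of the means of u multiplied by a
   factor of absolute value at most 1, which is absorbed in the nodal value. *)
Lemma TV_step_le (u : 'rV[R]_n.+1 -> R) (w : {ffun 'I_n.+1 -> 'I_N} -> R) : L2 mu u ->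
  (forall r s, `|w r - w s| <= `|cm mu (@gcell _ _ N p) u r - cm mu (@gcell _ _ N p) u s|) ->
  (TV Om (step (@gcell _ _ N p) w) <= TV Om u)%E.
Proof.
move=> Lu wv; have Cp := gcell_part Hp; have fin := lebesgue_on_fin a l_gt0.
have Lw : L2 mu (step (@gcell _ _ N p) w) by exact: (step_L2 fin Cp).
apply: (TV_le l_gt0 Lw) => H tH.
pose ex (g : {ffun 'I_n.+1 -> 'I_N} -> R) i r' (m : nat) : R :=
  oapp (fun m' : 'I_N => g (insidx i m' r')) 0 (insub m).
have exE g i r' (m : 'I_N) : ex g i r' m = g (insidx i m r').
  by rewrite /ex insubT//= => mN; congr (g (insidx i _ r')); exact: val_inj.
pose v := cm mu (@gcell _ _ N p) u.
pose q i r' m : R := if (0 < m < N)%N then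
  (ex w i r' m - ex w i r' m.-1) / (ex v i r' m - ex v i r' m.-1) else 0.
have q1 i r' m : `|q i r' m| <= 1.
  rewrite /q; case: ifPn => [/andP[m0 mN]|_]; last by rewrite normr0.
  have m1N : (m.-1 < N)%N by exact: leq_ltn_trans (leq_pred m) mN.
  have em g : ex g i r' m = g (insidx i (Ordinal mN) r') := exE g i r' (Ordinal mN).
  have em1 g : ex g i r' m.-1 = g (insidx i (Ordinal m1N) r') := exE g i r' (Ordinal m1N).
  rewrite !em !em1; set dw := w _ - w _; set dv := v _ - v _.
  have dwv : `|dw| <= `|dv| by exact: wv.
  have [->|dv0] := eqVneq dv 0; first by rewrite invr0 mulr0 normr0.
  by rewrite normrM normfV ler_pdivrMr ?normr_gt0// mul1r.
(* The mean of [H] over the face, multiplied by the jump ratio. Division by [fvol] brings it below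
   1; on a null face the flux is 0 as well, so [cE] still recovers it. *)
pose c i m r' : R := q i r' m * face_int H i m r' / fvol p i r'.
have fv0 i r' : 0 <= fvol p i r'.
  by apply: prodr_ge0 => k _; rewrite subr_ge0 (nodes_leS (Hp (lift i k))).
have F1 i m r' := face_int_le tH i m r'.
have cE i m r' : c i m r' * fvol p i r' = q i r' m * face_int H i m r'.
  have [f0|f0] := eqVneq (fvol p i r') 0; last by rewrite /c divfK.
  have := F1 i m r'; rewrite f0 normr_le0 => /eqP ->.
  by rewrite !mulr0.
have c_le1 i m r' : `|c i m r'| <= 1.
  have [f0|f0] := eqVneq (fvol p i r') 0; first by rewrite /c f0 invr0 mulr0 normr0.
  have fp : 0 < fvol p i r' by rewrite lt_neqAle eq_sym f0 fv0.
  rewrite /c normrM normfV (gtr0_norm fp) ler_pdivrMr// mul1r normrM.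
  by apply: le_trans (F1 i m r'); rewrite ler_piMl.
have c_left i r' : c i 0%N r' = 0 by rewrite /c /q/= !mul0r.
have c_right i m r' : p i m = a ord0 i + l ord0 i -> c i m r' = 0.
  by move=> pm; rewrite /c (face_int_boundary tH) ?mulr0 ?mul0r//; right.
apply: le_trans (TV_ge_step l_gt0 Hp c_le1 c_left c_right Lu).
rewrite lee_fin le_eqVlt; apply/orP; left; apply/eqP.
have ip_ i : integ mu (partial i (comp H i)) by exact: (partial_integ l_gt0 tH).
transitivity (\sum_i I (fun x => step (@gcell _ _ N p) w x * partial i (comp H i) x)).
  rewrite -I_sum; last first.
    move=> i _; apply: (L2_mul Lw).
    have [M _ HM] := partial_bounded tH i i.
    apply: (L2_bounded fin (M := M)) => //.
    exact: continuous_measurable_rV (partial_continuous tH (i := i) (j := i)).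
  by congr (Rintegral _ _ _); apply/funext => x; rewrite -mulr_sumr.
apply: eq_bigr => i _; rewrite (I_step fin Cp)//.
rewrite (sum_insidx i); apply: eq_bigr => r' _.
transitivity (\sum_(m < N) ex w i r' m * (face_int H i m.+1 r' - face_int H i m r')).
  by apply: eq_bigr => m _; rewrite exE -(I_indic fin Cp)// (face_divergence tH).
have p0 : p i 0%N = a ord0 i by case: (Hp i).
have pN : p i N = a ord0 i + l ord0 i by case: (Hp i).
rewrite (@sum_by_parts2 _ (ex v i r') (fun m => face_int H i m r') (fun m => q i r' m * face_int H i m r')).
- apply: eq_bigr => m _; rewrite exE -!cE -mulrBl.
  by rewrite -/(c i m.+1 r') -/(c i m r') /v; ring.
- by rewrite (face_int_boundary tH)//; left.
- by rewrite /q/= mul0r.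
- by rewrite (face_int_boundary tH)//; right.
- by rewrite (face_int_boundary tH) ?mulr0//; right.
- move=> m mN; rewrite mulrA; congr (_ * _).
  rewrite /q/= mN/=.
  have m1N : (m < N)%N by exact: ltnW.
  (* When the means do not jump, the ratio is the default 0; the hypothesis on [w] then forbids a
     jump of [w], and both sides vanish. *)
  have [E|dv0] := eqVneq (ex v i r' m.+1 - ex v i r' m) 0; last by rewrite mulrC divfK.
  rewrite E mul0r; apply/eqP; rewrite -normr_le0.
  have em g : ex g i r' m.+1 = g (insidx i (Ordinal mN) r') := exE g i r' (Ordinal mN).
  have em1 g : ex g i r' m = g (insidx i (Ordinal m1N) r') := exE g i r' (Ordinal m1N).
  move: E; rewrite !em !em1 => E.
  by have := wv (insidx i (Ordinal mN) r') (insidx i (Ordinal m1N) r'); rewrite -/v E normr0.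
Qed.

End step_variation.

(** * Convergence of averages *)

Lemma quarter_bound (R : realFieldType) (x y z w v : R) :
  x <= 2 * y + 2 * z -> z <= w -> w <= v / 4 -> y <= v / 4 -> x <= v.
Proof. by move=> *; lra. Qed.

Section averaging_convergence.
Context {disp} {T : measurableType disp} {R : realType}.
Variable mu : {measure set T -> \bar R}.
Hypothesis mu_fin : (mu setT < +oo)%E.
Local Notation I f := (Rintegral mu setT f).
Variables (J : nat -> finType) (C : forall k, J k -> set T).
Hypothesis Cp : forall k, is_part mu (@C k).
Implicit Types f g : T -> R.

Local Notation nsq f := (ip mu f f).
Local Notation av k f := (avg mu (@C k) f).
Definition avg_err k f : R := nsq (fun x => f x - av k f x).
Local Notation err := avg_err.
Definition avg_good f := L2 mu f /\ err k f @[k --> \oo] --> 0.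

Local Notation good := avg_good.

Let err_le k f : L2 mu f -> err k f <= nsq f.
Proof. by move=> Lf; rewrite /avg_err avg_orth// gerBl ip_ge0. Qed.

Lemma nsq_add_le f g : L2 mu f -> L2 mu g ->
  nsq (fun x => f x + g x) <= 2 * nsq f + 2 * nsq g.
Proof.
move=> Lf Lg; rewrite ip_add//.
have := ip_ge0 mu (fun x => f x - g x); rewrite ip_sub// => H; lra.
Qed.

Let err_add_le k f g : L2 mu f -> L2 mu g ->
  err k (fun x => f x + g x) <= 2 * err k f + 2 * err k g.
Proof.
move=> Lf Lg; have iF := L2_integ mu_fin Lf; have ig := L2_integ mu_fin Lg.
apply: le_trans (nsq_add_le _ _); last 2 first.
- by apply: L2B => //; exact: step_L2.
- by apply: L2B => //; exact: step_L2.
rewrite /avg_err le_eqVlt; apply/orP; left; apply/eqP; congr (ip mu _ _);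
  by apply/funext => x; rewrite (avgD (Cp k))//; ring.
Qed.

(** Averaging is a projection, so the error of a difference is at most its norm, whatever the grid;
    convergence thus passes to L^2 limits. *)
Let good_limit f : L2 mu f ->
  (forall e, 0 < e -> exists2 g, good g & nsq (fun x => f x - g x) <= e) -> good f.
Proof.
move=> Lf H; split=> //; apply/cvgrPdist_le => /= e e0.
have e4 : 0 < e / 4 by rewrite divr_gt0.
have [g [Lg Vg] fg] := H _ e4.
move/cvgrPdist_le : Vg => /(_ _ e4) Vg.
near=> k; rewrite sub0r normrN ger0_norm ?ip_ge0//.
have E : (fun x => f x) = (fun x => g x + (f x - g x)) by apply/funext => x; rewrite addrC subrK.
have LB : L2 mu (fun x => f x - g x) by exact: L2B.
have := err_add_le k Lg LB; rewrite -E => h1.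
have := err_le k LB => h2.
have : `|0 - err k g| <= e / 4 by near: k.
rewrite sub0r normrN ger0_norm ?ip_ge0//.
exact: quarter_bound h1 h2 fg.
Unshelve. all: by end_near. Qed.

Let good_add f g : good f -> good g -> good (fun x => f x + g x).
Proof.
move=> [Lf Vf] [Lg Vg]; split; first exact: L2D.
have c : 2 * err k f + 2 * err k g @[k --> \oo] --> (0 : R).
  have -> : (0 : R) = 2 * 0 + 2 * 0 by rewrite mulr0 addr0.
  by apply: cvgD; apply: cvgM; [exact: cvg_cst|exact: Vf|exact: cvg_cst|exact: Vg].
apply: (squeeze_cvgr _ (cvg_cst 0) c).
by apply: nearW => k; rewrite ip_ge0/= err_add_le.
Qed.

Let good_scale c f : good f -> good (fun x => c * f x).
Proof.
move=> [Lf Vf]; split; first exact: L2Z.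
have iF := L2_integ mu_fin Lf.
rewrite (_ : (fun k => _) = (fun k => c ^+ 2 * err k f)).
  by rewrite -(mulr0 (c ^+ 2)); apply: cvgM; [exact: cvg_cst|exact: Vf].
apply/funext => k; rewrite /avg_err.
have Ld : L2 mu (fun x => f x - av k f x) by apply: L2B => //; exact: step_L2.
rewrite (_ : (fun x => _) = (fun x => c * (f x - av k f x))); last first.
  by apply/funext => x; rewrite (avgZ (Cp k))// mulrBr.
by rewrite ipZl// ?ipZr//; [ring|exact: L2Z].
Qed.

Let L2_indic (E : set T) : measurable E -> L2 mu (\1_E : T -> R).
Proof.
move=> mE; apply: (L2_bounded mu_fin (M := 1)); first exact: measurable_indic.
by move=> x; rewrite indicE; case: (_ \in _); rewrite ?normr1 ?normr0.
Qed.

Section from_pi_system.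
Variable G : set (set T).
Hypothesis mG : @measurable _ T = <<s G >>.
Hypothesis GT : G setT.
Hypothesis GI : setI_closed G.
Hypothesis Gind : forall E, G E -> good (\1_E).

(** The sets with convergent averages form a lambda-system: differences by linearity, increasing
    unions by [good_limit]. It contains the generating pi-system [G]. *)
Let good_measurable (E : set T) : measurable E -> good (\1_E : T -> R).
Proof.
have mGE A : G A -> measurable A by rewrite mG; exact: sub_sigma_algebra.
suff H : <<s G >> `<=` [set E | measurable E /\ good (\1_E : T -> R)].
  by rewrite mG => /H[].
apply: lambda_system_subset; [exact: GI| | |by []].
- split.
  + by [].
  + by split=> //; exact: Gind.
  + move=> A B BA [mA gA] [mB gB]; split; first exact: measurableD.
    have -> : \1_(A `\` B) = (fun x => \1_A x + (-1) * \1_B x) :> (T -> R).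
      apply/funext => x; rewrite !indicE in_setD.
      have [xB|xB] := boolP (x \in B); last by rewrite andbT mulr0 addr0.
      have -> : x \in A by move: xB; rewrite !inE; exact: BA.
      by rewrite andbF mulN1r subrr.
    by apply: good_add; [exact: gA|exact: (good_scale _ gB)].
  + move=> F ndF HF; have mF k : measurable (F k) by have [] := HF k.
    have mU : measurable (\bigcup_i F i) by exact: bigcupT_measurable.
    split=> //; apply: good_limit; first exact: L2_indic.
    move=> e e0.
    have c : nsq (fun x => \1_(\bigcup_i F i) x - \1_(F k) x) @[k --> \oo] --> (0 : R).
      have -> : (0 : R) = I (cst 0) by rewrite (I_cst mu 0) mul0r.
      apply: (@I_dominated _ _ _ mu _ _ (cst 1)) => //.
      * move=> k; apply: measurable_funM; apply: measurable_funB; exact: measurable_indic.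
      * by apply: (integ_bounded mu_fin (M := 1)) => // x; rewrite normr1.
      * move=> k x; rewrite !indicE; do 2 case: (_ \in _);
          rewrite ?subrr ?mulr0 ?subr0 ?mulr1 ?sub0r ?mulrNN ?mulr1 ?normr0 ?normr1 //=.
      * apply: aeW => x; apply: cvg_near_cst.
        have [[i _ Fix]|nU] := pselect ((\bigcup_i F i) x); last first.
          apply: nearW => k; rewrite !indicE memNset// memNset ?subrr ?mul0r//.
          by move=> Fk; apply: nU; exists k.
        near=> k; rewrite !indicE mem_set; last by exists i.
        rewrite mem_set ?subrr ?mul0r//.
        have ik : (i <= k)%N by near: k; exact: nbhs_infty_ge.
        by have /subsetPset := ndF _ _ ik; exact.
    move/cvgrPdist_le : c => /(_ _ e0)[k _ /(_ k (leqnn k))].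
    rewrite sub0r normrN ger0_norm ?ip_ge0// => h.
    by exists (\1_(F k)) => //; have [] := HF k.
- by move=> B GB; split; [exact: mGE|exact: Gind].
Unshelve. all: by end_near. Qed.

Let good_sum n (w : 'I_n -> R) (E : 'I_n -> set T) : (forall i, measurable (E i)) ->
  good (fun x => \sum_i w i * \1_(E i) x).
Proof.
elim: n w E => [|n IH] w E mE.
  under eq_fun do rewrite big_ord0.
  have -> : (fun _ : T => 0 : R) = (fun x : T => 0 * \1_setT x) by apply/funext => x; rewrite mul0r.
  exact/good_scale/Gind.
under eq_fun do rewrite big_ord_recl.
by apply: good_add; [exact/good_scale/good_measurable|apply: IH].
Qed.

Let good_nneg f : L2 mu f -> (forall x, 0 <= f x) -> good f.
Proof.
move=> Lf f0; have mf := L2_measurable Lf.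
have mf' : measurable_fun setT (EFin \o f) by exact/measurable_EFinP.
pose g k : T -> R := nnsfun_approx measurableT mf' k.
apply: good_limit => // e e0.
have gE k x : 0 <= g k x <= f x.
  rewrite fun_ge0/= -lee_fin /g nnsfun_approxE; apply: le_approx => // y _.
  by rewrite lee_fin.
have c : nsq (fun x => f x - g k x) @[k --> \oo] --> (0 : R).
  have -> : (0 : R) = I (cst 0) by rewrite (I_cst mu 0) mul0r.
  apply: (@I_dominated _ _ _ mu _ _ (fun x => f x ^+ 2)) => //.
  - by move=> k; apply: measurable_funM; apply: measurable_funB.
  - by have [] := Lf.
  - move=> k x; have /andP[g0 gf] := gE k x.
    rewrite -expr2 ger0_norm ?sqr_ge0// ler_sqr ?nnegrE ?subr_ge0//.
    by rewrite gerBl.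
  - apply: aeW => x.
    have cg : g k x @[k --> \oo] --> f x.
      have H := @cvg_nnsfun_approx _ _ _ _ measurableT _ mf' _ x Logic.I.
      have {}H := H (fun y _ => eqbRL (lee_fin _ _) (f0 y)).
      by have /fine_cvgP[] := H.
    have -> : cst 0 x = (f x - f x) * (f x - f x) by rewrite subrr mulr0.
    by apply: cvgM; apply: cvgB => //; exact: cvg_cst.
move/cvgrPdist_le : c => /(_ _ e0)[k _ /(_ k (leqnn k))].
rewrite sub0r normrN ger0_norm ?ip_ge0// => h.
exists (g k) => //.
set h' := nnsfun_approx measurableT mf' k.
rewrite (_ : g k = fun x => \sum_(i < #|` fset_set (range h')|)
   (fset_set (range h'))`_i * \1_(h' @^-1` [set (fset_set (range h'))`_i]) x).
  by apply: good_sum => i; exact: measurable_funPTI.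
by apply/funext => x; exact: fimfunEord.
Qed.

Theorem avg_cvg f : L2 mu f -> err k f @[k --> \oo] --> 0.
Proof.
move=> Lf; have mf := L2_measurable Lf.
have L s : `|s| <= 1 -> L2 mu (fun x => Num.max (s * f x) 0).
  move=> s1; split; first by apply: measurable_maxr => //; exact: measurable_funM.
  apply: (@integ_le _ _ _ mu _ (fun x => f x ^+ 2)); last 1 first.
  - move=> x; rewrite ger0_norm ?sqr_ge0// -(real_normK (num_real (f x))).
    rewrite ler_sqr ?nnegrE ?normr_ge0// ?le_max ?lexx ?orbT//.
    rewrite ge_max normr_ge0 andbT (le_trans (ler_norm _))// normrM.
    by rewrite ler_piMl.
  - apply: measurable_funX; apply: measurable_maxr => //; exact: measurable_funM.
  - by have [] := Lf.
suff [] : good f by [].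
rewrite (_ : f = fun x => Num.max (1 * f x) 0 + -1 * Num.max (-1 * f x) 0).
  apply: good_add; [|apply: good_scale]; apply: good_nneg => [|x].
  - by apply: L; rewrite normr1.
  - by rewrite le_max lexx orbT.
  - by apply: L; rewrite normrN normr1.
  - by rewrite le_max lexx orbT.
apply/funext => x; rewrite mul1r !mulN1r.
have [f0|f0] := leP 0 (f x).
- by rewrite (max_idPr _) ?oppr_le0// subr0.
- by rewrite (max_idPl _) ?oppr_ge0 ?(ltW f0)// opprK add0r.
Qed.

End from_pi_system.
End averaging_convergence.

Section cell_means.
Context {disp} {T : measurableType disp} {R : realType}.
Variable mu : {measure set T -> \bar R}.
Hypothesis mu_fin : (mu setT < +oo)%E.
Local Notation I f := (Rintegral mu setT f).
Variables (J : finType) (C : J -> set T).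
Hypothesis Cp : is_part mu C.

Lemma I_indic_vol r : I (\1_(C r)) = vol mu C r.
Proof. by case: (Cp) => mC _ _; rewrite /Rintegral integral_indic// setIT. Qed.

Lemma cm_const (g : T -> R) c r : vol mu C r != 0 -> (forall x, C r x -> g x = c) ->
  cm mu C g r = c.
Proof.
move=> v0 gc; rewrite /cm.
have -> : (fun x => g x * \1_(C r) x) = (fun x => c * \1_(C r) x).
  apply/funext => x; rewrite indicE; have [xC|xC] := boolP (x \in C r); last by rewrite !mulr0.
  by rewrite gc//; exact/set_mem.
have i1 : integ mu (\1_(C r)).
  have := @integ_indic _ _ _ mu _ _ Cp (cst 1) r; under eq_fun do rewrite mul1r; apply.
  by apply: (integ_bounded mu_fin (M := 1)) => // x; rewrite normr1.
by rewrite IZ// I_indic_vol mulrCA mulVf// mulr1.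
Qed.

Lemma cm_le (g : T -> R) M r : integ mu g -> 0 <= M -> {ae mu, forall x, `|g x| <= M} ->
  `|cm mu C g r| <= M.
Proof.
move=> ig M0 gM; apply: le_trans (cm_abs Cp r ig) _.
have [v0|v0] := eqVneq (vol mu C r) 0; first by rewrite /cm v0 invr0 mul0r.
have v_gt0 : 0 < vol mu C r by rewrite lt_neqAle eq_sym v0 vol_ge0.
rewrite /cm mulrC ler_pdivrMr// -I_indic_vol.
have i1 : integ mu (\1_(C r)).
  have := @integ_indic _ _ _ mu _ _ Cp (cst 1) r; under eq_fun do rewrite mul1r; apply.
  by apply: (integ_bounded mu_fin (M := 1)) => // x; rewrite normr1.
rewrite -IZ//; apply: I_le_ae => //.
- by apply: integ_indic => //; exact: integ_norm.
- exact: integZ.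
- by apply: filterS gM => x gM; rewrite ler_wpM2r// indicE; case: (_ \in _).
Qed.

End cell_means.

(** * Averages over grids of vanishing mesh *)

Section grid_averaging_convergence.
Context {R : realType} {d : nat}.
Variables (a l : 'rV[R]_d).
Hypothesis l_gt0 : forall i, 0 < l ord0 i.
Local Notation Om := (hyperrectangle a l).
Local Notation mu := (lebesgue_on a l).

(** A generating pi-system for which convergence is visible by hand; the threshold +oo leaves a
    coordinate free, so the whole space belongs to it. *)
Definition orthant (c : 'I_d -> \bar R) : set 'rV[R]_d :=
  [set x | forall i, ((x ord0 i)%:E < c i)%E].

Let G := [set A | exists c, A = orthant c].

Let GT : G setT.
Proof. by exists (fun=> +oo%E); apply/seteqP; split=> // x _ i; rewrite ltry. Qed.

Let GI : setI_closed G.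
Proof.
move=> _ _ [c ->] [e ->]; exists (fun i => Order.min (c i) (e i)).
apply/seteqP; split=> x.
  by move=> [xc xe] i; rewrite lt_min xc xe.
by move=> H; split=> i; have := H i; rewrite lt_min => /andP[].
Qed.

Lemma measurable_orthant c : measurable (orthant c).
Proof.
rewrite (_ : orthant c = prodset (fun i => [set t : R | (t%:E < c i)%E]))//.
apply: measurable_prodset => i; rewrite -[X in measurable X]setTI.
have := @emeasurable_fun_infty_o _ _ R setT (EFin : R -> \bar R) measurableT _ (c i).
apply; exact: EFin_measurable.
Qed.

Let mG : @measurable _ 'rV[R]_d = <<s G >>.
Proof.
apply/seteqP; split; last first.
  apply: smallest_sub; first exact: sigma_algebra_measurable.
  by move=> _ [c ->]; exact: measurable_orthant.
apply: smallest_sub; first exact: smallest_sigma_algebra.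
move=> A; rewrite -bigcup_seq/= => -[i _ [D mD <-]]; rewrite setTI.
move: D mD; rewrite [measurable](@RGenInftyO.measurableE R).
suff H : <<s @RGenInftyO.G R >> `<=` image_set_system setT (fun x : 'rV[R]_d => x ord0 i) <<s G >>.
  by move=> D /H; rewrite /image_set_system/= setTI.
apply: smallest_sub; first by apply: sigma_algebra_image; exact: smallest_sigma_algebra.
move=> _ [c ->]; rewrite /image_set_system/= setTI.
apply: sub_sigma_algebra; exists (fun j => if j == i then c%:E else +oo%E).
apply/seteqP; split=> x /=.
  by rewrite in_itv/= => xc j; case: eqP => [->|_]; rewrite ?lte_fin ?ltry.
by move=> /(_ i); rewrite eqxx lte_fin in_itv.
Qed.

Variables (N : nat -> nat) (p : nat -> 'I_d -> nat -> R) (h : nat -> R).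
Hypothesis Hp : forall k, is_padded a l (N k) (p k).
Hypothesis Hh : forall k i m, p k i m.+1 - p k i m <= h k.
Hypothesis h0 : h k @[k --> \oo] --> 0.

Let mu_fin : (mu setT < +oo)%E := lebesgue_on_fin a l_gt0.

Let gcell_vol_gt0 k r x : @gcell _ _ (N k) (p k) r x -> vol mu (@gcell _ _ (N k) (p k)) r != 0.
Proof.
move=> /gcellP xr; rewrite gcell_vol//; apply/prodf_neq0 => i _.
by have /andP[h1 h2] := xr i; rewrite subr_eq0 gt_eqF// (lt_trans h1).
Qed.

Let orthant_nbhs c (x : 'rV[R]_d) : (forall i, (x ord0 i)%:E <> c i) ->
  exists2 e : R, 0 < e &
    forall y : 'rV[R]_d, (forall i, `|y ord0 i - x ord0 i| < e) -> orthant c y <-> orthant c x.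
Proof.
move=> xc.
have H i : exists2 e : R, 0 < e & forall t : R, `|t - x ord0 i| < e ->
    ((t%:E < c i)%E = ((x ord0 i)%:E < c i)%E).
  case Eci : (c i) => [r| |].
  - have xr : x ord0 i - r != 0.
      by rewrite subr_eq0; apply/eqP => E; apply: (xc i); rewrite Eci E.
    exists `|x ord0 i - r|; first by rewrite normr_gt0.
    move=> t; rewrite !lte_fin ltr_norml => /andP[h1 h2].
    have [xr0|xr0|xr0] := ltgtP (x ord0 i) r.
    + move: h1 h2; rewrite (ltr0_norm (eqbRL (subr_lt0 _ _) xr0)) => h1 h2.
      by apply/idP; lra.
    + move: h1 h2; rewrite (gtr0_norm (eqbRL (subr_gt0 _ _) xr0)) => h1 h2.
      by apply/negbTE; rewrite -leNgt; lra.
    + by move: xr; rewrite xr0 subrr eqxx.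
  - by exists 1 => // t _; rewrite !ltry.
  - by exists 1.
pose e i := projT1 (cid2 (H i)).
have e0 i : 0 < e i by rewrite /e; case: cid2.
have eP i t : `|t - x ord0 i| < e i -> ((t%:E < c i)%E = ((x ord0 i)%:E < c i)%E).
  by rewrite /e; case: cid2 => //= ? _; exact.
exists (\big[Order.min/1]_i e i).
  by apply: lt_bigmin.
move=> y ye; have E i : ((y ord0 i)%:E < c i)%E = ((x ord0 i)%:E < c i)%E.
  by apply: eP; apply: lt_le_trans (ye i) _; exact: bigmin_le.
by split=> H' i; [rewrite -E|rewrite E].
Qed.

(** Off the boundary hyperplanes the indicator is constant near x, hence on the cell containing x as
    soon as the mesh is small: the averages are eventually exact. *)
Let avg_orthant_cvg c : {ae mu, forall x,
  avg mu (@gcell _ _ (N k) (p k)) (\1_(orthant c)) x @[k --> \oo] --> (\1_(orthant c) x : R)}.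
Proof.
have H1 : \forall x \ae mu, forall i : 'I_d, ((x : 'rV[R]_d) ord0 i)%:E <> c i.
  have A i : {ae mu, forall x : 'rV[R]_d, (x ord0 i)%:E <> c i}.
    case: (c i) => [r| |]; last 2 first.
    - exact: aeW.
    - exact: aeW.
    by apply: filterS (ae_hyperplane a l i r) => x xr [] /xr.
  by apply: filter_forall.
have H2 : \forall x \ae mu, forall k, exists r, @gcell _ _ (N k) (p k) r x.
  by apply/ae_foralln => k; case: (gcell_part (Hp k)).
apply: filterS2 H1 H2 => x xc xr.
have [e e0 He] := orthant_nbhs xc.
apply: cvg_near_cst.
have : \forall k \near \oo, h k < e.
  by apply: (cvgr_lt 0).
apply: filterS => k hk.
have [r xr'] := xr k; rewrite /avg (step_in (gcell_part (Hp k)) _ xr').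
apply: cm_const => //; first exact: (gcell_part (Hp k)).
  exact: gcell_vol_gt0 xr'.
move=> y yr; rewrite !indicE; congr (_%:R); congr nat_of_bool.
have : orthant c y <-> orthant c x.
  apply: He => i; move/gcellP : xr' => /(_ i) /andP[x1 x2]; move/gcellP : yr => /(_ i) /andP[y1 y2].
  by have := Hh k i (r i); rewrite ltr_norml => s; apply/andP; split; lra.
by move=> E; apply/idP/idP; rewrite !inE => /E.
Qed.

Theorem grid_avg_cvg f : L2 mu f ->
  ip mu (fun x => f x - avg mu (@gcell _ _ (N k) (p k)) f x)
        (fun x => f x - avg mu (@gcell _ _ (N k) (p k)) f x) @[k --> \oo] --> 0.
Proof.
move=> Lf.
apply: (@avg_cvg _ _ _ mu mu_fin _ (fun k => @gcell _ _ (N k) (p k)) _ G mG GT GI _ _ Lf).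
  by move=> k; exact: gcell_part.
move=> _ [c ->]; have mE := measurable_orthant c.
have LE : L2 mu (\1_(orthant c) : _ -> R).
  apply: (L2_bounded mu_fin (M := 1)); first exact: measurable_indic.
  by move=> x; rewrite indicE; case: (_ \in _); rewrite ?normr1 ?normr0.
split=> //.
have -> : (0 : R) = Rintegral mu setT (cst 0) by rewrite (I_cst mu 0) mul0r.
have mA k : measurable_fun setT (avg mu (@gcell _ _ (N k) (p k)) (\1_(orthant c))).
  exact: measurable_step (gcell_part (Hp k)) _.
have A1 k x : `|avg mu (@gcell _ _ (N k) (p k)) (\1_(orthant c)) x| <= 1.
  apply: (step_le (gcell_part (Hp k))) => // r.
  apply: (cm_le mu_fin (gcell_part (Hp k))) => //; first exact: L2_integ.
  by apply: aeW => y; rewrite indicE; case: (_ \in _); rewrite ?normr1 ?normr0.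
apply: (@I_dominated _ _ _ mu _ _ (cst 4)) => //.
- by move=> k; apply: measurable_funM; apply: measurable_funB => //; exact: measurable_indic.
- by apply: (integ_bounded mu_fin (M := 4)) => // x; rewrite ger0_norm.
- move=> k x; rewrite -expr2 ger0_norm ?sqr_ge0//.
  have -> : cst 4 x = 2 ^+ 2 :> R by rewrite /= expr2; lra.
  rewrite -(real_normK (num_real (_ - _))) ler_sqr ?nnegrE//.
  apply: le_trans (ler_normB _ _) _; have := A1 k x.
  have : `|\1_(orthant c) x| <= 1 :> R by rewrite indicE; case: (_ \in _); rewrite ?normr1 ?normr0.
  by move=> h1 h2; lra.
- apply: filterS (avg_orthant_cvg c) => x ax.
  have -> : cst 0 x = (\1_(orthant c) x - \1_(orthant c) x) * (\1_(orthant c) x - \1_(orthant c) x) :> R.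
    by rewrite subrr mulr0.
  by apply: cvgM; (apply: cvgB; [exact: cvg_cst|exact: ax]).
Qed.

End grid_averaging_convergence.

(** * Poincare inequality by bisection *)

Section pairs.
Variable N : nat.

Lemma even_ord_proof (b : 'I_N) : (b.*2 < N.*2)%N. Proof. by rewrite ltn_double. Qed.
Lemma odd_ord_proof (b : 'I_N) : (b.*2.+1 < N.*2)%N. Proof. by rewrite ltn_Sdouble. Qed.
Lemma half_ord_proof (m : 'I_(N.*2)) : (m./2 < N)%N.
Proof. by rewrite -(ltn_double _ N) (leq_ltn_trans _ (ltn_ord m))// -{2}(odd_double_half m) leq_addl. Qed.

Definition even_ord b := Ordinal (even_ord_proof b).
Definition odd_ord b := Ordinal (odd_ord_proof b).
Definition half_ord m := Ordinal (half_ord_proof m).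

Lemma half_even_ord b : half_ord (even_ord b) = b.
Proof. by apply: val_inj; rewrite /= doubleK. Qed.

Lemma half_odd_ord b : half_ord (odd_ord b) = b.
Proof. by apply: val_inj; rewrite /= uphalf_double. Qed.

Lemma half_ordP m : m = even_ord (half_ord m) \/ m = odd_ord (half_ord m).
Proof.
have := odd_double_half m; case: (odd m) => /= h; [right|left]; apply: val_inj => /=.
  by rewrite -{1}h.
by rewrite -{1}h.
Qed.

Lemma sum_pairs (R : nmodType) (F : 'I_(N.*2) -> R) :
  \sum_m F m = \sum_b (F (even_ord b) + F (odd_ord b)).
Proof.
rewrite (partition_big half_ord xpredT)//=; apply: eq_bigr => b _.
have ne : odd_ord b != even_ord b by rewrite -val_eqE/= gtn_eqF.
rewrite (bigD1 (even_ord b))/= ?half_even_ord//; congr (_ + _).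
rewrite (bigD1 (odd_ord b))/= ?half_odd_ord ?eqxx// big1 ?addr0// => m /andP[/andP[/eqP <- m1] m2].
by case: (half_ordP m) m1 m2 => <-; rewrite eqxx.
Qed.

End pairs.

Section bisection.
Context {R : realType} {n : nat}.
Variables (a l : 'rV[R]_n.+1).
Hypothesis l_gt0 : forall i, 0 < l ord0 i.
Local Notation Om := (hyperrectangle a l).
Local Notation mu := (lebesgue_on a l).
Local Notation I f := (Rintegral mu setT f).

(** For even m the two halves of the index coincide and give an old node; for odd m they are
    consecutive and give the midpoint. *)
Definition bisect (i0 : 'I_n.+1) (p : 'I_n.+1 -> nat -> R) i m : R :=
  if i == i0 then (p i m./2 + p i (uphalf m)) / 2 else p i m.

Variables (N : nat) (p : 'I_n.+1 -> nat -> R).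
Hypothesis Hp : is_padded a l N p.
Variable i0 : 'I_n.+1.
Local Notation p' := (bisect i0 p).
Local Notation C := (@gcell _ _ N p).
Local Notation C' := (@gcell _ _ (N.*2) p').

Lemma bisect_even b : p' i0 b.*2 = p i0 b.
Proof. by rewrite /bisect eqxx doubleK uphalf_double; lra. Qed.

Lemma bisect_odd b : p' i0 b.*2.+1 = (p i0 b + p i0 b.+1) / 2.
Proof. by rewrite /bisect eqxx/= uphalf_double doubleK. Qed.

Lemma bisect_step m : p' i0 m.+1 - p' i0 m = (p i0 (m./2).+1 - p i0 m./2) / 2.
Proof.
rewrite -(odd_double_half m); case: (odd m) => /=; rewrite ?add1n ?add0n.
  by rewrite -doubleS bisect_even bisect_odd uphalf_double; lra.
by rewrite bisect_odd bisect_even doubleK; lra.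
Qed.

Lemma bisect_padded : is_padded a l N.*2 p'.
Proof.
move=> i; have [h1 h2 h3] := Hp i; have [->|ne] := eqVneq i i0; last first.
  rewrite /bisect (negbTE ne); split=> //.
  by apply: (nodes_pad (Hp i)); rewrite -addnn leq_addr.
have {}h1 := let: And3 h _ _ := Hp i0 in h.
have {}h2 := let: And3 _ h _ := Hp i0 in h.
have {}h3 := let: And3 _ _ h := Hp i0 in h.
split.
- by rewrite -h1 -(bisect_even 0).
- by rewrite bisect_even.
move=> m; have := h3 m./2; have <- := odd_double_half m; move: (odd m) (m./2) => o b.
rewrite half_bit_double.
move=> [[k1 k2]|[k1 k2]]; [left|right];
  case: o; rewrite /= ?add1n ?add0n -?doubleS ?bisect_even ?bisect_odd; split; lra.
Qed.

Lemma bisect_lift k m : p' (lift i0 k) m = p (lift i0 k) m.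
Proof. by rewrite /bisect eq_sym (negbTE (neq_lift i0 k)). Qed.

Lemma fine_in_coarse b (r' : {ffun 'I_n -> 'I_(N.*2)}) (s : {ffun 'I_n.+1 -> 'I_N}) m x : half_ord m = b ->
  C' (insidx i0 m r') x -> C s x -> s i0 = b /\ forall k, s (lift i0 k) = r' k :> nat.
Proof.
move=> mb /gcell_insidx[/= x0 xk] /gcellP xs; split.
  apply: val_inj => /=; apply: (nodes_disj (Hp i0) (xs i0)); rewrite -mb.
  have mono := nodes_homo (bisect_padded i0).
  move: x0; rewrite ?in_itv/= => /andP[h1 h2]; rewrite -!bisect_even; apply/andP; split.
    apply: le_lt_trans h1; apply: mono.
    by rewrite -{2}(odd_double_half m) leq_addl.
  apply: lt_le_trans h2 _; apply: mono.
  by rewrite doubleS -{1}(odd_double_half m) /=; case: (odd m); rewrite ?add1n ?add0n.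
move=> k; apply: (nodes_disj (Hp (lift i0 k)) (xs _)).
by have := xk k; rewrite !bisect_lift.
Qed.

(** Only the midpoint hyperplane has to be avoided, and it is null. *)
Lemma coarse_in_fine b (r' : {ffun 'I_n -> 'I_(N.*2)}) (s : {ffun 'I_n.+1 -> 'I_N}) (x : 'rV[R]_n.+1) : s i0 = b ->
  (forall k, s (lift i0 k) = r' k :> nat) -> x ord0 i0 <> p' i0 b.*2.+1 ->
  \1_(C s) x = \1_(C' (insidx i0 (even_ord b) r')) x + \1_(C' (insidx i0 (odd_ord b) r')) x :> R.
Proof.
move=> sb sr xm.
have par := gcell_part bisect_padded.
have half (m : 'I_(N.*2)) : half_ord m = b -> C' (insidx i0 m r') x -> C s x.
  move=> mb /gcell_insidx[/= x0 xk]; apply/gcellP => j.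
  case: (unliftP i0 j) => [k ->|->].
    by have := xk k; rewrite !bisect_lift sr.
  have mono := nodes_homo (bisect_padded i0).
  move: x0; rewrite ?in_itv/= sb => /andP[h1 h2]; rewrite -!bisect_even; apply/andP; split.
    apply: le_lt_trans h1; apply: mono.
    by rewrite -mb /= -{2}(odd_double_half m) leq_addl.
  apply: lt_le_trans h2 _; apply: mono.
  by rewrite -mb doubleS -{1}(odd_double_half m) /=; case: (odd m); rewrite ?add1n ?add0n.
have [xs|xs] := pselect (C s x); last first.
  rewrite !indicE !memNset ?addr0//.
    by move/(half _ (half_odd_ord b)).
  by move/(half _ (half_even_ord b)).
have xk k : p' (lift i0 k) (r' k) < x ord0 (lift i0 k) < p' (lift i0 k) (r' k).+1.
  by move/gcellP : xs => /(_ (lift i0 k)); rewrite sr !bisect_lift.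
move/gcellP : (xs) => /(_ i0); rewrite sb -!bisect_even => /andP[h1 h2].
have [lt|lt|//] := ltgtP (x ord0 i0) (p' i0 b.*2.+1).
- have x1 : C' (insidx i0 (even_ord b) r') x.
    by apply/gcell_insidx; split=> [|k]; rewrite /= ?in_itv/= ?h1.
  rewrite !indicE (mem_set xs) (mem_set x1) memNset ?addr0//.
  case: par => _ dis _ x2; have := dis _ _ _ x1 x2.
  by move/(congr1 (fun r : {ffun _ -> _} => nat_of_ord (r i0))); rewrite !insidx_same/= => /n_Sn.
- have x1 : C' (insidx i0 (odd_ord b) r') x.
    by apply/gcell_insidx; split=> [|k]; rewrite /= ?in_itv/= ?lt -?doubleS.
  rewrite !indicE (mem_set xs) (mem_set x1) memNset ?add0r//.
  case: par => _ dis _ x2; have := dis _ _ _ x1 x2.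
  by move/(congr1 (fun r : {ffun _ -> _} => nat_of_ord (r i0))); rewrite !insidx_same/= => /esym/n_Sn.
Qed.

Variable u : 'rV[R]_n.+1 -> R.
Hypothesis Lu : L2 mu u.
Let fin := lebesgue_on_fin a l_gt0.
Let iu := L2_integ fin Lu.

Let v m r' := cm mu C' u (insidx i0 m r').
Let jump b r' := v (odd_ord b) r' - v (even_ord b) r'.

Let restr (r : {ffun 'I_n.+1 -> 'I_(N.*2)}) : {ffun 'I_n -> 'I_(N.*2)} := [ffun k => r (lift i0 k)].

Let restrK (r : {ffun 'I_n.+1 -> 'I_(N.*2)}) : insidx i0 (r i0) (restr r) = r.
Proof.
by apply/ffunP => j; case: (unliftP i0 j) => [k ->|->]; rewrite ?insidx_lift ?insidx_same// ffunE.
Qed.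

(** The two halves of a cell have equal volume. *)
Let coarse_mean b r' s m x : half_ord m = b -> C' (insidx i0 m r') x -> C s x ->
  cm mu C u s = (v (even_ord b) r' + v (odd_ord b) r') / 2.
Proof.
move=> mb xr xs; have [sb sr] := fine_in_coarse mb xr xs.
have part' := gcell_part bisect_padded.
have E : I (fun y => u y * \1_(C s) y) =
    vol mu C' (insidx i0 (even_ord b) r') * v (even_ord b) r' +
    vol mu C' (insidx i0 (odd_ord b) r') * v (odd_ord b) r'.
  have i' r := integ_indic part' r iu.
  rewrite -!(I_indic fin part' _ iu) -(ID (i' _) (i' _)).
  have H : integ mu (fun y => u y * \1_(C' (insidx i0 (even_ord b) r')) y +
      u y * \1_(C' (insidx i0 (odd_ord b) r')) y).
    by apply: integD; exact: integ_indic.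
  apply: I_ae.
  - exact: integ_measurable (integ_indic (gcell_part Hp) s iu).
  - exact: integ_measurable H.
  - apply: filterS (ae_hyperplane a l i0 (p' i0 b.*2.+1)) => y yb.
    by rewrite (coarse_in_fine sb sr)// mulrDr.
have Fs : \prod_k (p (lift i0 k) (s (lift i0 k)).+1 - p (lift i0 k) (s (lift i0 k))) = fvol p' i0 r'.
  by apply: eq_bigr => k _; rewrite sr !bisect_lift.
rewrite {1}/cm E !(vol_insidx bisect_padded) /= !bisect_step /= uphalf_double doubleK.
rewrite (gcell_vol Hp) (bigD1_ord i0)//= Fs sb.
have s0 : p i0 b.+1 - p i0 b != 0.
  by move/gcellP : xs => /(_ i0); rewrite sb => /andP[h1 h2]; rewrite subr_eq0 gt_eqF// (lt_trans h1).
have f0 : fvol p' i0 r' != 0.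
  rewrite -Fs; apply/prodf_neq0 => k _.
  by move/gcellP : xs => /(_ (lift i0 k)) /andP[h1 h2]; rewrite subr_eq0 gt_eqF// (lt_trans h1).
by move: (v _ _) (v _ _) => y z; field; rewrite s0 f0.
Qed.

(* The dual variable is supported on the new nodes, where it is the opposite of
   the sign of the jump of the fine means. *)
Lemma bisect_cost H : (forall m, p i0 m.+1 - p i0 m <= H) ->
  ((I (fun x => `|avg mu C' u x - avg mu C u x|))%:E <= (H / 2)%:E * TV Om u)%E.
Proof.
move=> sH; have part' := gcell_part bisect_padded; have part := gcell_part Hp.
have H0 : 0 <= H.
  apply: le_trans (sH 0%N); rewrite subr_ge0; exact: nodes_leS (Hp i0) _.
(* The mean over either half differs from the coarse mean by half of the jump, up to sign. *)
pose w (r : {ffun 'I_n.+1 -> 'I_(N.*2)}) := `|jump (half_ord (r i0)) (restr r)| / 2.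
have -> : I (fun x => `|avg mu C' u x - avg mu C u x|) = I (step C' w).
  have m1 : measurable_fun setT (avg mu C' u) by exact: (measurable_step part').
  have m2 : measurable_fun setT (avg mu C u) by exact: (measurable_step part).
  apply: I_ae.
  - by apply: measurableT_comp => //; exact: measurable_funB.
  - exact: (measurable_step part').
  - case: (part) (part') => _ _ cov [_ _ cov'].
    apply: filterS2 cov cov' => x [s xs] [r xr].
    rewrite /avg !(step_in part' _ xr) (step_in part _ xs).
    have xr2 := xr; rewrite -(restrK r) in xr2.
    rewrite (coarse_mean erefl xr2 xs) /w /jump -{1}(restrK r) -/(v (r i0) (restr r)).
    have -> : forall z : R, `|z| / 2 = `|z / 2| by move=> z; rewrite normrM (ger0_norm (_ : 0 <= 2^-1))// invr_ge0.
    have [E|E] := half_ordP (r i0).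
      by rewrite {1}E -normrN; congr (`|_|); lra.
    by rewrite {1}E; congr (`|_|); lra.
rewrite (I_stepE fin part') (sum_insidx i0).
pose e := a ord0 i0 + l ord0 i0.
(* The new nodes have odd index. The test [p' i m < e] gives 0 on the padding nodes, which sit at
   the right endpoint where a field must vanish. *)
pose c (i : 'I_n.+1) (m : nat) (r' : {ffun 'I_n -> 'I_(N.*2)}) : R :=
  if [&& i == i0, odd m & p' i m < e] then
    if insub m./2 is Some b then - Num.sg (jump b r') else 0
  else 0.
have c1 i m r' : `|c i m r'| <= 1.
  rewrite /c; case: ifP => _; last by rewrite normr0.
  case: insubP => [b _ _|_]; last by rewrite normr0.
  by rewrite normrN normr_sg; case: (_ != 0).
have c2 i r' : c i 0%N r' = 0 by rewrite /c /= andbF.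
have c3 i m r' : p' i m = a ord0 i + l ord0 i -> c i m r' = 0.
  by rewrite /c => E; case: eqP => //= ii; rewrite E ii ltxx andbF.
have := TV_ge_step l_gt0 bisect_padded c1 c2 c3 Lu.
rewrite (bigD1 i0)//= [X in (_ + X)%R]big1 ?addr0; last first.
  move=> i ii; apply: big1 => r' _; apply: big1 => m _.
  by rewrite /c (negbTE ii)/= subr0 mul0r.
move=> TVge.
apply: (@le_trans _ _ ((H / 2)%:E * (\sum_r' \sum_(m < N.*2) (c i0 m.+1 r' - c i0 m r') *
     (fvol p' i0 r' * cm mu C' u (insidx i0 m r')))%:E)%E); last first.
  by apply: lee_wpmul2l => //; rewrite lee_fin divr_ge0.
rewrite -EFinM lee_fin mulr_sumr; apply: ler_sum => r' _.
rewrite !sum_pairs mulr_sumr; apply: ler_sum => b _.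
have fv : 0 <= fvol p' i0 r'.
  by apply: prodr_ge0 => k _; rewrite subr_ge0; exact: nodes_leS (bisect_padded _) _.
rewrite /= -/(v (even_ord b) r') -/(v (odd_ord b) r').
have cE m : c i0 m.*2 r' = 0 by rewrite /c odd_double andbF.
have cO : c i0 b.*2.+1 r' = if p' i0 b.*2.+1 < e then - Num.sg (jump b r') else 0.
  rewrite /c eqxx /= odd_double /=; case: ifP => // _.
  by rewrite uphalf_double (valK b).
rewrite -doubleS !cE cO !(vol_insidx bisect_padded)/= !bisect_step/= uphalf_double doubleK.
have wE m : half_ord m = b -> w (insidx i0 m r') = `|jump b r'| / 2.
  move=> mb; rewrite /w insidx_same mb; congr (`|jump _ _| / 2).
  by apply/ffunP => k; rewrite ffunE insidx_lift.
rewrite !wE ?half_even_ord ?half_odd_ord//.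
have [lt|ge] := ltP (p' i0 b.*2.+1) e; last first.
  have h1 := bisect_odd b; have h2 := nodes_le (Hp i0) b; have h3 := nodes_le (Hp i0) b.+1.
  have s0 : p i0 b.+1 - p i0 b = 0.
    by have h4 := nodes_leS (Hp i0) b; move: ge; rewrite /e => ge; lra.
  by rewrite s0 !(mul0r, mulr0, addr0, subr0).
rewrite subr0 sub0r opprK.
have -> : - Num.sg (jump b r') * (fvol p' i0 r' * v (even_ord b) r') +
   Num.sg (jump b r') * (fvol p' i0 r' * v (odd_ord b) r') = fvol p' i0 r' * `|jump b r'|.
  by rewrite normrEsg /jump; ring.
have := sH b; move: fv (normr_ge0 (jump b r')) => fv j0 hb.
set F := fvol _ _ _ in fv *; set j := `|_| in j0 *.
have := mulr_ge0 fv j0; set Fj := F * j => Fj0.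
(* Each half has half the length s of the cell and deviates by |jump|/2, so together they cost s/2
   times F |jump|, whereas the field collects F |jump|: hence the factor [H / 2]. *)
have -> : j / 2 * ((p i0 b.+1 - p i0 b) / 2 * F) + j / 2 * ((p i0 b.+1 - p i0 b) / 2 * F) =
  (p i0 b.+1 - p i0 b) / 2 * Fj by rewrite /Fj; field.
by rewrite ler_wpM2r// ler_wpM2r.
Qed.

End bisection.

Section poincare.
Context {R : realType} {n : nat}.
Variables (a l : 'rV[R]_n.+1).
Hypothesis l_gt0 : forall i, 0 < l ord0 i.
Local Notation Om := (hyperrectangle a l).
Local Notation mu := (lebesgue_on a l).
Local Notation I f := (Rintegral mu setT f).
Local Notation gavg N p := (avg mu (@gcell R n.+1 N p)).
Variables (u : 'rV[R]_n.+1 -> R) (V : R).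
Hypothesis Lu : L2 mu u.
Hypothesis TVu : TV Om u = V%:E.
Let fin := lebesgue_on_fin a l_gt0.
Let iu := L2_integ fin Lu.

Let V0 : 0 <= V.
Proof. by rewrite -lee_fin -TVu; exact: TV_ge0. Qed.

Let avg_integ N p : is_padded a l N p -> integ mu (gavg N p u).
Proof. by move=> Hp; apply: L2_integ => //; apply: step_L2 => //; exact: gcell_part. Qed.

Let dist_triangle f g h : integ mu f -> integ mu g -> integ mu h ->
  I (fun x => `|f x - h x|) <= I (fun x => `|f x - g x|) + I (fun x => `|g x - h x|).
Proof.
move=> iF ig ih.
have i1 := integ_norm (integB iF ig); have i2 := integ_norm (integB ig ih).
rewrite -ID//; apply: I_le; [exact: integ_norm (integB iF ih)|exact: integD|].
by move=> x; exact: ler_distD.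
Qed.

(** Steps never grow, so every bisection of the list is charged with the initial bound [H]; those in
    the directions listed end up halved. *)
Lemma bisects_cost s N p H : is_padded a l N p -> (forall i m, p i m.+1 - p i m <= H) ->
  [/\ is_padded a l (iter (size s) double N) (foldr bisect p s),
      forall i m, foldr bisect p s i m.+1 - foldr bisect p s i m <= H,
      forall i m, i \in s -> foldr bisect p s i m.+1 - foldr bisect p s i m <= H / 2 &
      I (fun x => `|gavg (iter (size s) double N) (foldr bisect p s) u x - gavg N p u x|)
        <= (size s)%:R * (H / 2) * V].
Proof.
move=> Hp sH; have H0 : 0 <= H.
  by apply: le_trans (sH ord0 0%N); rewrite subr_ge0; exact: nodes_leS (Hp ord0) _.
elim: s => [|i s [IHp IHH IHh IHc]] /=.
  split=> //; rewrite !mul0r.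
  under eq_fun do rewrite subrr normr0.
  by rewrite (I_cst mu 0) mul0r.
set q := foldr bisect p s in IHp IHH IHh IHc *; set M := iter (size s) double N in IHp IHc *.
have Hq := bisect_padded IHp i.
have st j m : bisect i q j m.+1 - bisect i q j m <= (if j == i then H / 2 else H).
  case: eqP => [->|/eqP ji].
    by rewrite bisect_step ler_wpM2r.
  by rewrite /bisect (negbTE ji).
split=> //.
- by move=> j m; apply: le_trans (st j m) _; case: ifP => // _; rewrite ler_pdivrMr// mulrC ler_peMl// ler1n.
- move=> j m; rewrite inE; have := st j m; case: eqP => //= ji _ js.
  by move/eqP : ji => ji; rewrite /bisect (negbTE ji); exact: IHh.
- have cost := bisect_cost l_gt0 IHp Lu (IHH i).
  rewrite TVu -EFinM lee_fin in cost.
  apply: le_trans (dist_triangle (avg_integ Hq) (avg_integ IHp) (avg_integ Hp)) _.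
  apply: le_trans (lerD cost IHc) _.
  by rewrite -natr1 le_eqVlt; apply/orP; left; apply/eqP; ring.
Qed.

(* Each round bisects all the directions and costs half the previous mesh size,
   whence a geometric sum. *)
Lemma refine_cost k N p H : is_padded a l N p -> (forall i m, p i m.+1 - p i m <= H) ->
  exists Mq : nat * ('I_n.+1 -> nat -> R), [/\ is_padded a l Mq.1 Mq.2,
    forall i m, Mq.2 i m.+1 - Mq.2 i m <= H / 2 ^+ k &
    I (fun x => `|gavg Mq.1 Mq.2 u x - gavg N p u x|) <= n.+1%:R * H * V * (1 - (2 ^+ k)^-1)].
Proof.
move=> Hp sH; elim: k => [|k [[M q] /= [Hq sq cq]]].
  exists (N, p); split=> //=; first by move=> i m; rewrite expr0 divr1.
  under eq_fun do rewrite subrr normr0.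
  by rewrite (I_cst mu 0) mul0r expr0 invr1 subrr mulr0.
have [H1 _ H2 H3] := bisects_cost (index_enum 'I_n.+1) Hq sq.
exists (iter (size (index_enum 'I_n.+1)) double M, foldr bisect q (index_enum 'I_n.+1)).
split=> //=.
- move=> i m; apply: le_trans (H2 i m (mem_index_enum i)) _.
  by rewrite exprS invfM mulrCA [leLHS]mulrC.
- apply: le_trans (dist_triangle (avg_integ H1) (avg_integ Hq) (avg_integ Hp)) _.
  apply: le_trans (lerD H3 cq) _.
  have -> : size (index_enum 'I_n.+1) = n.+1 by rewrite -[RHS]card_ord cardT enumT.
  rewrite exprS; have : (2 ^+ k : R) != 0 by rewrite expf_neq0.
  by set z := 2 ^+ k => z0; rewrite le_eqVlt; apply/orP; left; apply/eqP; field.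
Qed.

(** Averages over the refined grids tend to [u] in L^2, hence in L^1, so the distance from [u] to
    its average is at most the total cost of all refinements. *)
Theorem poincare N p H : is_padded a l N p -> (forall i m, p i m.+1 - p i m <= H) ->
  I (fun x => `|u x - gavg N p u x|) <= n.+1%:R * H * V.
Proof.
move=> Hp sH; have H0 : 0 <= H.
  by apply: le_trans (sH ord0 0%N); rewrite subr_ge0; exact: nodes_leS (Hp ord0) _.
pose g k := projT1 (cid (refine_cost k Hp sH)).
have gP k : [/\ is_padded a l (g k).1 (g k).2,
    forall i m, (g k).2 i m.+1 - (g k).2 i m <= H / 2 ^+ k &
    I (fun x => `|gavg (g k).1 (g k).2 u x - gavg N p u x|) <= n.+1%:R * H * V * (1 - (2 ^+ k)^-1)].
  by rewrite /g; case: cid.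
have g1 k : is_padded a l (g k).1 (g k).2 by case: (gP k).
have g2 k i m : (g k).2 i m.+1 - (g k).2 i m <= H / 2 ^+ k by case: (gP k).
have h0 : H / 2 ^+ k @[k --> \oo] --> 0.
  rewrite -(mulr0 H); apply: cvgM; first exact: cvg_cst.
  have -> : (fun k => (2 ^+ k)^-1 : R) = (fun k => 2^-1 ^+ k) by apply/funext => k; rewrite exprVn.
  by apply: cvg_expr; rewrite ger0_norm ?invr_ge0// invf_lt1 ?ltr1n.
have K4 := grid_avg_cvg l_gt0 g1 g2 h0 Lu.
have c : Num.sqrt (ip mu (fun x => u x - gavg (g k).1 (g k).2 u x)
    (fun x => u x - gavg (g k).1 (g k).2 u x)) * Num.sqrt (fine (mu setT)) @[k --> \oo] --> 0.
  rewrite -(mul0r (Num.sqrt (fine (mu setT)))); apply: cvgM; last exact: cvg_cst.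
  rewrite -[X in _ --> X]sqrtr0.
  by apply: continuous_cvg K4; exact: sqrt_continuous.
apply/ler_addgt0Pr => e e0.
move/cvgrPdist_le : c => /(_ _ e0)[k _ /(_ k (leqnn k)) /=].
rewrite sub0r normrN ger0_norm ?mulr_ge0 ?sqrtr_ge0// => hk.
apply: le_trans (dist_triangle iu (avg_integ (g1 k)) (avg_integ Hp)) _.
rewrite addrC; apply: lerD.
  have [_ _ ] := gP k; move/le_trans; apply.
  by rewrite ler_piMr ?gerBl ?invr_ge0 ?exprn_ge0// !mulr_ge0.
apply: le_trans hk; apply: L1_le_L2 => //.
by apply: L2B => //; apply: step_L2 => //; exact: gcell_part.
Qed.

End poincare.

(** * Minimizers of the energy *)

(** Here x, y, z, d stand for the squared norms of u - f, Au - Af, Af - Av, f - Af, the primed terms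
    for the variations of the averages, and 0 for that of v - Av; the last two hypotheses are the
    minimality of v and of u. *)
Lemma energy_gap_arith (R : realFieldType) (x d y z aV aV' aW aW' : R) :
  y <= x -> aV' <= aV -> aW' <= aW -> (0 + z) / 2 + aW <= y / 2 + aV' ->
  x / 2 + aV <= (d + z) / 2 + aW' -> 0 <= x / 2 + aV - ((0 + z) / 2 + aW) <= d / 2.
Proof. by move=> h1 h2 h3 h4 h5; apply/andP; split; lra. Qed.

Section variational_inequality.
Context {R : realType} {n : nat}.
Variables (a l : 'rV[R]_n.+1).
Hypothesis l_gt0 : forall i, 0 < l ord0 i.
Local Notation Om := (hyperrectangle a l).
Local Notation mu := (lebesgue_on a l).
Local Notation I f := (Rintegral mu setT f).
Local Notation nsq f := (ip mu f f).
Let fin := lebesgue_on_fin a l_gt0.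
Implicit Types f u v w : 'rV[R]_n.+1 -> R.

(* The Euler-Lagrange inequality of a minimizer [u] with [J(u) = V]. *)
Definition is_rof (alpha : R) f u (V : R) := [/\ L2 mu u, TV Om u = V%:E &
  forall w W, L2 mu w -> TV Om w = W%:E ->
    0 <= ip mu (fun x => u x - f x) (fun x => w x - u x) + alpha * (W - V)].

Definition rof (alpha : R) f u (V : R) : R := nsq (fun x => u x - f x) / 2 + alpha * V.

(** Expanding the square about [u] leaves the Euler-Lagrange expression plus half the squared norm
    of [w - u]. *)
Lemma rof_le alpha f u V w W : L2 mu f -> is_rof alpha f u V -> L2 mu w -> TV Om w = W%:E ->
  rof alpha f u V <= rof alpha f w W.
Proof.
move=> Lf [Lu _ H] Lw TVw; have := H _ _ Lw TVw.
have L1 : L2 mu (fun x => u x - f x) by exact: L2B.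
have L2' : L2 mu (fun x => w x - u x) by exact: L2B.
have -> : rof alpha f w W = nsq (fun x => (u x - f x) + (w x - u x)) / 2 + alpha * W.
  by rewrite /rof; congr (ip _ _ _ / _ + _); apply/funext => x; ring.
rewrite ip_add// /rof => h; have := ip_ge0 mu (fun x => w x - u x) => h'.
by move: (ip _ _ _) (ip _ _ _) (ip _ _ _) h h' => X Y Z h h'; lra.
Qed.

Lemma TV_finE u : (TV Om u < +oo)%E -> exists2 V, TV Om u = V%:E & 0 <= V.
Proof.
move=> h; have := TV_ge0 a l u; case E : (TV Om u) h => [V| |]// _; rewrite lee_fin => V0.
by exists V.
Qed.

(** Competitors on the segment from [u] to [w], with convexity of [TV], give the inequality up to an
    error t Q / 2 with t as small as desired. *)
Lemma is_rof_of_le (alpha : R) f u (V : R) : L2 mu f -> L2 mu u -> TV Om u = V%:E -> 0 < alpha ->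
  (forall w W, L2 mu w -> TV Om w = W%:E -> rof alpha f u V <= rof alpha f w W) ->
  is_rof alpha f u V.
Proof.
move=> Lf Lu TVu al H; split=> // w W Lw TVw.
have Ld : L2 mu (fun x => w x - u x) by exact: L2B.
have Le : L2 mu (fun x => u x - f x) by exact: L2B.
set P := ip mu (fun x => u x - f x) (fun x => w x - u x).
set Q := nsq (fun x => w x - u x).
have Q0 : 0 <= Q by exact: ip_ge0.
have key (t : R) : 0 < t <= 1 -> 0 <= P + alpha * (W - V) + t * Q / 2.
  move=> /andP[t0 t1].
  have Lt : L2 mu (fun x => u x + t * (w x - u x)) by apply: L2D => //; exact: L2Z.
  have TVt : (TV Om (fun x => (u x + t * (w x - u x))%R) <= (V + t * (W - V))%:E)%E.
    by apply: TV_convex => //; rewrite ?TVu ?TVw// (ltW t0).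
  have [T ET T0] := TV_finE (le_lt_trans TVt (ltry _)).
  rewrite ET lee_fin in TVt.
  have := H _ _ Lt ET.
  have -> : rof alpha f (fun x => u x + t * (w x - u x)) T =
      nsq (fun x => (u x - f x) + t * (w x - u x)) / 2 + alpha * T.
    by rewrite /rof; congr (ip _ _ _ / _ + _); apply/funext => x; ring.
  rewrite ip_add//; last exact: L2Z.
  rewrite (ipZr _ Ld Le) (ipZl _ Ld)//; last exact: L2Z.
  rewrite (ipZr _ Ld Ld) -/P -/Q /rof => h.
  have h2 : alpha * T <= alpha * (V + t * (W - V)) by rewrite ler_wpM2l// ltW.
  rewrite -(pmulr_rge0 _ t0).
  have -> : t * (P + alpha * (W - V) + t * Q / 2) = t * P + alpha * (V + t * (W - V)) - alpha * V + t * (t * Q) / 2.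
    by field.
  move: h h2; move: (nsq _) (t * P) (t * (t * Q)) (alpha * T) (alpha * (V + _)) (alpha * V) => A B C D E F h h2; lra.
rewrite leNgt; apply/negP => neg.
have [Q00|Q1] := eqVneq Q 0.
  have := key 1; rewrite ltr01 lexx Q00 => /(_ isT); rewrite mulr0 mul0r addr0.
  by rewrite leNgt neg.
have Qp : 0 < Q by rewrite lt_neqAle eq_sym Q1.
set X := P + alpha * (W - V) in neg key.
(* If X < 0, this t makes t Q <= -X, so X + t Q / 2 <= X / 2 < 0. *)
pose t : R := Num.min 1 (- X / Q).
have t01 : 0 < t <= 1 by rewrite /t lt_min ltr01 ge_min lexx divr_gt0// oppr_gt0.
have := key t t01; have : t * Q <= - X.
  by rewrite -ler_pdivlMr// /t ge_min lexx orbT.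
by move: (t * Q) neg => tQ neg h1 h2; clear -neg h1 h2; lra.
Qed.

Variables (N : nat) (p : 'I_n.+1 -> nat -> R).
Hypothesis Hp : is_padded a l N p.
Local Notation A := (avg mu (@gcell _ _ N p)).
Let part := gcell_part Hp.

Let LA f : L2 mu (A f). Proof. exact: step_L2. Qed.

Lemma avg_pythagoras f (w : {ffun 'I_n.+1 -> 'I_N} -> R) : L2 mu f ->
  nsq (fun x => f x - step (@gcell _ _ N p) w x) =
  nsq (fun x => f x - A f x) + nsq (fun x => A f x - step (@gcell _ _ N p) w x).
Proof.
move=> Lf; have Ls : L2 mu (step (@gcell _ _ N p) w) by exact: step_L2.
rewrite (avg_orth fin part Lf) !ip_sub// (avg_ip fin part w Lf).
by ring.
Qed.

Lemma TV_avg_le u V : L2 mu u -> TV Om u = V%:E -> exists2 W, TV Om (A u) = W%:E & W <= V.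
Proof.
move=> Lu TVu; have h : (TV Om (A u) <= V%:E)%E by rewrite -TVu; exact: TV_step_le.
have [W EW _] := TV_finE (le_lt_trans h (ltry _)); exists W => //.
by rewrite EW lee_fin in h.
Qed.

Variables (alpha : R) (f u v : 'rV[R]_n.+1 -> R) (V W : R).
Hypothesis al0 : 0 < alpha.
Hypothesis Lf : L2 mu f.
Hypothesis uP : is_rof alpha f u V.
Hypothesis vP : is_rof alpha (A f) v W.

Let Lu : L2 mu u. Proof. by case: uP. Qed.
Let Lv : L2 mu v. Proof. by case: vP. Qed.
Let TVu : TV Om u = V%:E. Proof. by case: uP. Qed.
Let TVv : TV Om v = W%:E. Proof. by case: vP. Qed.

(** Replacing [v] by [A v] does not increase the variation and lowers the squared distance to the
    step function [A f] by exactly the norm in question, by Pythagoras; minimality makes that norm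
    0. *)
Lemma rof_avg_fixed : nsq (fun x => v x - A v x) = 0.
Proof.
have [W' EW' W'W] := TV_avg_le Lv TVv.
have := rof_le (LA f) vP (LA v) EW'.
rewrite /rof (avg_pythagoras (cm mu (@gcell _ _ N p) f) Lv) -/(A f) => h.
have := ip_ge0 mu (fun x => v x - A v x).
have h2 : alpha * W' <= alpha * W by rewrite ler_wpM2l// ltW.
move: h h2; move: (nsq _) (nsq _) (alpha * W') (alpha * W) => X Y B C h h2 h3.
by apply/eqP; rewrite eq_le h3 andbT; lra.
Qed.

Lemma rof_avg_ae : {ae mu, forall x, v x = A v x}.
Proof.
have Ld : L2 mu (fun x => v x - A v x) by exact: L2B.
have := I_eq0_ae (L2_mul Ld Ld) _ rof_avg_fixed.
move=> H; apply: filterS (H _) => [x|x].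
  by move/eqP; rewrite mulf_eq0 orbb subr_eq0 => /eqP.
by rewrite -expr2 sqr_ge0.
Qed.

Let ip_fixed g : L2 mu g -> ip mu g v = ip mu g (A v).
Proof.
move=> Lg; apply: I_ae.
- by apply: measurable_funM; [case: Lg|case: Lv].
- by apply: measurable_funM; [case: Lg|case: (LA v)].
- by apply: filterS rof_avg_ae => x ->.
Qed.

(** Testing each inequality with the other minimizer and adding cancels the variations and leaves |u
    - v|^2 <= <Af - f, v - u>. The part in [v] is 0 because v = Av and f - Af is orthogonal to step
    functions; symmetry of [A] moves the average onto [u]. *)
Lemma rof_dist_le : nsq (fun x => u x - v x) <= ip mu f (fun x => u x - A u x).
Proof.
have [_ _ Hu] := uP; have [_ _ Hv] := vP.
have h1 := Hu _ _ Lv TVv; have h2 := Hv _ _ Lu TVu.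
have E : ip mu (fun x => A f x - f x) v = 0.
  rewrite ip_fixed; last exact: L2B.
  by rewrite ipBl// -(avg_ip fin part (cm mu (@gcell _ _ N p) v) Lf) subrr.
have E2 : ip mu f (fun x => u x - A u x) = - ip mu (fun x => A f x - f x) u.
  by rewrite ipBr// ipBl// (avg_sym fin part Lf Lu); ring.
move: h1 h2 E; rewrite E2 ip_sub//.
do !rewrite (ipBl, ipBr)//; try exact: L2B.
rewrite (ipC mu v u) (ipC mu (A f) v) (ipC mu (A f) u) (ipC mu f u) (ipC mu f v).
move: (ip mu u v) (ip mu u u) (ip mu v v) => X1 X3 X4.
move: (ip mu u f) (ip mu v f) (ip mu v (A f)) (ip mu u (A f)) => Y1 Y2 Y3 Y4.
have : alpha * (W - V) = - (alpha * (V - W)) by ring.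
by move: (alpha * (W - V)) (alpha * (V - W)) => Z1 Z2 h; lra.
Qed.

Local Notation nrm g := (Num.sqrt (nsq g)).

Let nsq_le0 g h : nsq g <= nsq h -> nrm g <= nrm h.
Proof. by move=> gh; rewrite ler_sqrt// ip_ge0. Qed.

(** One sign follows from testing [u] with [v]. For the other, [v] is tested with [A u] instead of
    [u]: then Au - Af = A(u - f) and Au - v = A(u - v) are contracted by averaging, so the bound
    involves [u - f] and not [v - A f]. *)
Lemma rof_TV_gap : alpha * `|W - V| <= nrm (fun x => u x - f x) * nrm (fun x => u x - v x).
Proof.
have [_ _ Hu] := uP; have [_ _ Hv] := vP.
have iu := L2_integ fin Lu; have iF := L2_integ fin Lf; have iv := L2_integ fin Lv.
have Lvu : L2 mu (fun x => v x - u x) by exact: L2B.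
have Luv : L2 mu (fun x => u x - v x) by exact: L2B.
have Luf : L2 mu (fun x => u x - f x) by exact: L2B.
have sym g h : nsq (fun x => g x - h x) = nsq (fun x => h x - g x).
  by congr (Rintegral _ _ _); apply/funext => x; ring.
have h1 : alpha * (V - W) <= nrm (fun x => u x - f x) * nrm (fun x => u x - v x).
  have h := Hu _ _ Lv TVv.
  have cs := CauchySchwarz Luf Lvu; rewrite (sym v u) in cs.
  have := ler_norm (ip mu (fun x => u x - f x) (fun x => v x - u x)).
  have -> : alpha * (V - W) = - (alpha * (W - V)) by ring.
  move: h cs; move: (ip _ _ _) (alpha * _) (nrm _ * _) => X Y Z h cs h3; lra.
have h2 : alpha * (W - V) <= nrm (fun x => u x - f x) * nrm (fun x => u x - v x).
  have [V' EV' V'V] := TV_avg_le Lu TVu.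
  have h := Hv _ _ (LA u) EV'.
  have LAuf : L2 mu (fun x => A u x - A f x) by exact: L2B.
  have LAuv : L2 mu (fun x => A u x - v x) by exact: L2B.
  have E : ip mu (fun x => v x - A f x) (fun x => A u x - v x) =
      ip mu (fun x => A u x - A f x) (fun x => A u x - v x) - nsq (fun x => A u x - v x).
    rewrite -ipBl//; congr (ip _ _ _); apply/funext => x; ring.
  have cs := CauchySchwarz LAuf LAuv.
  have n1 : nrm (fun x => A u x - A f x) <= nrm (fun x => u x - f x).
    apply: nsq_le0; have -> : (fun x => A u x - A f x) = A (fun x => u x - f x).
      by apply/funext => x; rewrite (avgB part).
    exact: avg_le.
  have n2 : nrm (fun x => A u x - v x) <= nrm (fun x => u x - v x).
    apply: nsq_le0; rewrite sym (avg_pythagoras (cm mu (@gcell _ _ N p) u) Lv) rof_avg_fixed add0r.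
    rewrite (sym u v) -/(A u); have -> : (fun x => A v x - A u x) = A (fun x => v x - u x).
      by apply/funext => x; rewrite (avgB part).
    exact: avg_le.
  have n3 : nrm (fun x => A u x - A f x) * nrm (fun x => A u x - v x) <=
     nrm (fun x => u x - f x) * nrm (fun x => u x - v x).
    by apply: ler_pM; rewrite ?sqrtr_ge0.
  have := ler_norm (ip mu (fun x => A u x - A f x) (fun x => A u x - v x)).
  have := ip_ge0 mu (fun x => A u x - v x).
  rewrite E in h.
  have a1 : alpha * (W - V) <= alpha * (W - V') by rewrite ler_wpM2l ?(ltW al0)// lerB.
  have E2 : alpha * (V' - W) = - (alpha * (W - V')) by ring.
  rewrite E2 in h.
  move: h cs n3 a1; move: (ip _ _ _) (ip _ _ _) (alpha * _) (alpha * _) (nrm _ * _) (nrm _ * _).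
  by move=> X1 X2 X3 X4 X5 X6 h cs n3 a1 h3 h4; lra.
rewrite -[X in X * _](gtr0_norm al0) -normrM ler_norml h2 andbT lerNl -mulrN opprB.
exact: h1.
Qed.

(** Below: [A u] competes with [v] for the datum [A f] and both of its terms are at most those of
    [u]. Above: [A v] competes with [u], and its squared distance to [f] exceeds that to [A f] by |f
    - Af|^2. *)
Lemma rof_energy_gap : 0 <= rof alpha f u V - rof alpha (A f) v W <=
  ip mu f (fun x => f x - A f x) / 2.
Proof.
have iu := L2_integ fin Lu; have iF := L2_integ fin Lf.
have [V' EV' V'V] := TV_avg_le Lu TVu; have [W' EW' W'W] := TV_avg_le Lv TVv.
have e1 := rof_le (LA f) vP (LA u) EV'.
have e2 := rof_le Lf uP (LA v) EW'.
have a1 : alpha * V' <= alpha * V by rewrite ler_wpM2l ?(ltW al0).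
have a2 : alpha * W' <= alpha * W by rewrite ler_wpM2l ?(ltW al0).
have n1 : nsq (fun x => A u x - A f x) <= nsq (fun x => u x - f x).
  have -> : (fun x => A u x - A f x) = A (fun x => u x - f x).
    by apply/funext => x; rewrite (avgB part).
  by apply: avg_le => //; exact: L2B.
have sym g h : nsq (fun x => g x - h x) = nsq (fun x => h x - g x).
  by congr (Rintegral _ _ _); apply/funext => x; ring.
have n2 := avg_pythagoras (cm mu (@gcell _ _ N p) v) Lf; rewrite -/(A v) in n2.
have n3 := avg_pythagoras (cm mu (@gcell _ _ N p) f) Lv; rewrite -/(A f) rof_avg_fixed in n3.
have n4 : ip mu f (fun x => f x - A f x) = nsq (fun x => f x - A f x).
  rewrite (avg_orth fin part Lf) ipBr//; congr (_ - _).
  by rewrite -(avg_ip fin part (cm mu (@gcell _ _ N p) f) Lf).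
rewrite n4; move: e1 e2; rewrite /rof (sym (A v) f) n2 n3 (sym (A f) (A v)).
exact: energy_gap_arith.
Qed.

End variational_inequality.

(** * Integrability of the minimizer *)

Section limits_of_bounded_sequences.
Context {disp} {T : measurableType disp} {R : realType}.
Variable mu : {measure set T -> \bar R}.
Hypothesis mu_fin : (mu setT < +oo)%E.
Local Notation I f := (Rintegral mu setT f).
Variables (u : T -> R) (g : nat -> T -> R).
Hypothesis iu : integ mu u.
Hypothesis ig : forall k, integ mu (g k).
Hypothesis gu : I (fun x => `|u x - g k x|) @[k --> \oo] --> 0.

(** The excess of |u| over [B] is at most |u - g_k|, so its integral is 0. *)
Lemma limit_ae_bounded B : 0 <= B -> (forall k x, `|g k x| <= B) -> {ae mu, forall x, `|u x| <= B}.
Proof.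
move=> B0 gB; pose e x := Num.max (`|u x| - B) 0.
have me : measurable_fun setT e.
  apply: measurable_maxr => //; apply: measurable_funB => //.
  by apply: measurableT_comp => //; exact: integ_measurable iu.
have ie : integ mu e.
  apply: (integ_le me (integ_norm iu)) => x.
  rewrite ger0_norm ?le_max ?lexx ?orbT// ge_max normr_ge0 andbT.
  by rewrite gerBl.
have e0 x : 0 <= e x by rewrite /e le_max lexx orbT.
have Ie : I e = 0.
  apply/eqP; rewrite eq_le I_ge0// andbT; apply/ler_addgt0Pr => z z0; rewrite add0r.
  move/cvgrPdist_lt : gu => /(_ _ z0)[k _ /(_ k (leqnn k)) /=].
  rewrite sub0r normrN ger0_norm; last by apply: I_ge0.
  move/ltW; apply: le_trans; apply: I_le => //; first exact: integ_norm (integB iu (ig k)).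
  move=> x; rewrite ge_max normr_ge0 andbT lerBlDr.
  by rewrite -{1}(subrK (g k x) (u x)) (le_trans (ler_normD _ _))// lerD.
apply: filterS (I_eq0_ae ie e0 Ie) => x.
by rewrite /e; case: (leP (`|u x| - B) 0) => [h _|h E]; [lra|rewrite E ltxx in h].
Qed.

(** Truncate |u| at level j. Where the truncation exceeds 2|g_k| it is at most 2|u - g_k|, so its
    power costs only 2 j^(q-1) |u - g_k|, which vanishes as k grows. Convergence in L^1 thus
    suffices, and j tends to infinity by monotone convergence. *)
Lemma limit_integ_powR q K : 1 <= q -> (forall k, integ mu (fun x => `|g k x| `^ q)) ->
  (forall k, I (fun x => `|g k x| `^ q) <= K) -> integ mu (fun x => `|u x| `^ q).
Proof.
move=> q1 igq gK; have q0 : 0 <= q by lra.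
have mu_ : measurable_fun setT (fun x => `|u x|).
  by apply: measurableT_comp => //; exact: integ_measurable iu.
pose m (j : nat) x := Num.min `|u x| j%:R.
have m0 j x : 0 <= m j x by rewrite /m le_min normr_ge0/=.
have mm j : measurable_fun setT (fun x => m j x `^ q).
  by apply: (measurableT_comp (measurable_powR _)); apply: measurable_minr.
have im j : integ mu (fun x => m j x `^ q).
  apply: (integ_bounded mu_fin (M := j%:R `^ q)) => // x.
  rewrite ger0_norm ?powR_ge0//; apply: ge0_ler_powR => //; rewrite ?nnegrE//.
  by rewrite /m ge_min lexx orbT.
have mK j : I (fun x => m j x `^ q) <= 2 `^ q * K.
  apply/ler_addgt0Pr => z z0.
  pose c : R := 2 * j%:R `^ (q - 1).
  have c0 : 0 <= c by rewrite mulr_ge0// powR_ge0.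
  have cv : c * I (fun x => `|u x - g k x|) @[k --> \oo] --> 0.
    by rewrite -(mulr0 c); apply: cvgM; [exact: cvg_cst|exact: gu].
  move/cvgrPdist_lt : cv => /(_ _ z0)[k _ /(_ k (leqnn k)) /=].
  rewrite sub0r normrN ger0_norm; last by rewrite mulr_ge0//; apply: I_ge0.
  move/ltW => hz; have id := integ_norm (integB iu (ig k)).
  apply: (@le_trans _ _ (2 `^ q * I (fun x => `|g k x| `^ q) + c * I (fun x => `|u x - g k x|))); last first.
    by apply: lerD => //; rewrite ler_wpM2l// powR_ge0.
  rewrite -!IZ// -ID; [|exact: integZ|exact: integZ].
  apply: I_le => //; first by apply: integD; exact: integZ.
  move=> x; have [h|h] := leP (m j x) (2 * `|g k x|).
    apply: (@le_trans _ _ ((2 * `|g k x|) `^ q)).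
      by apply: ge0_ler_powR; rewrite ?nnegrE ?mulr_ge0.
    by rewrite powRM// lerDl mulr_ge0.
  apply: (@le_trans _ _ (c * `|u x - g k x|)); last by rewrite lerDr mulr_ge0// powR_ge0.
  have mp : 0 < m j x by apply: le_lt_trans h; rewrite mulr_ge0.
  rewrite powR_ge1E//.
  have h2 : m j x <= 2 * `|u x - g k x|.
    have := lerB_dist (u x) (g k x); have : m j x <= `|u x| by rewrite /m ge_min lexx.
    by move: h; move: (m j x) (`|_|) (`|_|) (`|_|) => X Y Z A h h1 h3; lra.
  rewrite /c mulrAC; apply: ler_pM => //; first exact: powR_ge0.
  apply: ge0_ler_powR; rewrite ?nnegrE//; first lra.
  by rewrite /m ge_min lexx orbT.
apply/integrableP; split.
  by apply/measurable_EFinP; apply: (measurableT_comp (measurable_powR _)).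
have : (\int[mu]_x (m j x `^ q)%:E)%E @[j --> \oo] --> (\int[mu]_x (`|u x| `^ q)%:E)%E.
  have -> : (\int[mu]_x (`|u x| `^ q)%:E = \int[mu]_x limn (fun j => (m j x `^ q)%:E))%E.
    apply: eq_integral => x _; apply/esym/cvg_lim => //; apply: cvg_near_cst; near=> j.
    by rewrite /m min_l//; near: j; exact: nbhs_infty_ger.
  apply: (@cvg_monotone_convergence _ _ _ mu setT measurableT (fun j x => (m j x `^ q)%:E)).
  - by move=> j; apply/measurable_EFinP.
  - by move=> j x _; rewrite lee_fin powR_ge0.
  - move=> x _ i j ij; rewrite lee_fin; apply: ge0_ler_powR; rewrite ?nnegrE//.
    by rewrite /m le_min ge_min lexx/= ge_min ler_nat ij orbT.
move=> cv; have -> : (\int[mu]_x `|(EFin \o (fun y => (`|u y| `^ q)%R)) x| = \int[mu]_x (`|u x| `^ q)%:E)%E.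
  by apply: eq_integral => x _ /=; rewrite ger0_norm ?powR_ge0.
apply: (@le_lt_trans _ _ (2 `^ q * K)%:E); last exact: ltry.
rewrite -(cvg_lim _ cv)//; apply: lime_le; first by apply: cvgP cv.
apply: nearW => j; have := mK j; rewrite -lee_fin; apply: le_trans.
rewrite /Rintegral fineK//; exact: integrable_fin_num (im j).
Unshelve. all: by end_near. Qed.

End limits_of_bounded_sequences.

Section signed_power.
Context {R : realType}.
Variable q : R.
Hypothesis q1 : 1 < q.

(** The derivative of |t|^q / q. *)
Definition spow (t : R) : R := Num.sg t * `|t| `^ (q - 1).

Let q10 : q - 1 != 0. Proof. by rewrite subr_eq0 gt_eqF. Qed.

Lemma spow0 : spow 0 = 0. Proof. by rewrite /spow sgr0 mul0r. Qed.

Lemma spowN t : spow (- t) = - spow t.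
Proof. by rewrite /spow sgrN normrN mulNr. Qed.

Lemma spow_ge0E t : 0 <= t -> spow t = t `^ (q - 1).
Proof.
rewrite le_eqVlt => /orP[/eqP <-|t0]; first by rewrite spow0 powR0.
by rewrite /spow gtr0_sg// mul1r gtr0_norm.
Qed.

Lemma norm_spow t : `|spow t| = `|t| `^ (q - 1).
Proof.
have [->|t0] := eqVneq t 0; first by rewrite spow0 normr0 powR0.
by rewrite /spow normrM normr_sg t0 mul1r ger0_norm// powR_ge0.
Qed.

Lemma mul_spow t : t * spow t = `|t| `^ q.
Proof.
have [->|t0] := eqVneq t 0; first by rewrite mul0r normr0 powR0// gt_eqF// (lt_trans ltr01).
by rewrite /spow mulrA (mulrC t) -normrEsg -powR_ge1E// normr_gt0.
Qed.

Lemma spow_le s t : s <= t -> spow s <= spow t.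
Proof.
have pos (x y : R) : 0 <= x -> x <= y -> spow x <= spow y.
  move=> x0 xy; rewrite !spow_ge0E//; last exact: le_trans xy.
  by apply: ge0_ler_powR; rewrite ?nnegrE ?subr_ge0 ?(ltW q1)// (le_trans x0).
move=> st; have [s0|s0] := leP 0 s; first exact: pos.
have [t0|t0] := leP 0 t.
  apply: (@le_trans _ _ 0); last by rewrite spow_ge0E// powR_ge0.
  by rewrite -[s]opprK spowN oppr_le0 spow_ge0E ?powR_ge0// oppr_ge0 ltW.
by rewrite -[s]opprK -[t]opprK !(spowN (- _)) lerN2; apply: pos; rewrite ?lerN2// oppr_ge0 ltW.
Qed.

Lemma contraction_arith (D P e : R) : 0 <= e -> e * `|P| <= `|D| -> 0 <= D -> 0 <= P -> `|D - e * P| <= `|D|.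
Proof.
move=> e0; rewrite ler_norml => h D0 P0; move: h; rewrite (ger0_norm D0) (ger0_norm P0).
have := mulr_ge0 e0 P0; move: (e * P) => Z z0 zd; apply/andP; split; lra.
Qed.

(** Over finitely many values the difference quotients of [spow] have a maximum L. With e = 1/(1 +
    L) the monotone correction has the sign of the difference and is no larger than it, so
    subtracting it cannot increase the absolute value. *)
Lemma spow_contraction (J : finType) (c : J -> R) : exists2 e : R, 0 < e &
  forall r s, `|(c r - e * spow (c r)) - (c s - e * spow (c s))| <= `|c r - c s|.
Proof.
pose L := \big[Order.max/0]_(rs : J * J) (`|spow (c rs.1) - spow (c rs.2)| / `|c rs.1 - c rs.2|).
have L0 : 0 <= L by apply: bigmax_ge_id.
have LP r s : `|spow (c r) - spow (c s)| <= L * `|c r - c s|.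
  have [E|ne] := eqVneq (c r) (c s); first by rewrite E !subrr normr0 mulr0.
  rewrite -ler_pdivrMr ?normr_gt0 ?subr_eq0//.
  exact: (le_bigmax 0 (fun rs : J * J => `|spow (c rs.1) - spow (c rs.2)| / `|c rs.1 - c rs.2|) (r, s)).
have e0 : 0 < (1 + L)^-1 by rewrite invr_gt0 ltr_wpDr.
exists (1 + L)^-1 => //.
have W r s : c s <= c r -> `|(c r - (1 + L)^-1 * spow (c r)) - (c s - (1 + L)^-1 * spow (c s))| <= `|c r - c s|.
  move=> sr; have -> : (c r - (1 + L)^-1 * spow (c r)) - (c s - (1 + L)^-1 * spow (c s)) =
    (c r - c s) - (1 + L)^-1 * (spow (c r) - spow (c s)) by ring.
  apply: contraction_arith; rewrite ?subr_ge0 ?spow_le//; first exact: ltW.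
  rewrite mulrC ler_pdivrMr ?ltr_wpDr// (le_trans (LP r s))// mulrC ler_wpM2l//.
  by rewrite lerDr.
move=> r s; have [|/ltW] := leP (c s) (c r); first exact: W.
by move/W; rewrite (distrC (c s)) (distrC (c s - _)).
Qed.

End signed_power.

(** Young's inequality with the coefficient 1/2 that allows absorption: if y <= 2x then y^(q-1) <=
    (2x)^(q-1), otherwise x < y/2. *)
Lemma young_half (R : realType) (q x y : R) : 1 < q -> 0 <= x -> 0 <= y ->
  x * y `^ (q - 1) <= y `^ q / 2 + 2 `^ (q - 1) * x `^ q.
Proof.
move=> q1 x0 y0; have q10 : 0 <= q - 1 by rewrite subr_ge0 ltW.
have [y00|yp] := eqVneq y 0.
  rewrite y00 [0 `^ (q - 1)]powR0 ?subr_eq0 ?gt_eqF// mulr0 addr_ge0 ?divr_ge0 ?mulr_ge0 ?powR_ge0//.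
have {}yp : 0 < y by rewrite lt_neqAle eq_sym yp.
have [xy|xy] := leP y (2 * x).
  have xp : 0 < x by move: xy yp; lra.
  rewrite ler_wpDl ?divr_ge0 ?powR_ge0// (powR_ge1E q xp) mulrCA ler_wpM2l// -powRM//.
  by apply: ge0_ler_powR; rewrite ?nnegrE ?mulr_ge0.
rewrite ler_wpDr ?mulr_ge0 ?powR_ge0// (powR_ge1E q yp) mulrAC ler_wpM2r ?powR_ge0//.
by lra.
Qed.

Lemma half_absorb (R : realFieldType) (x y z : R) : x <= x / 2 + z * y -> x <= 2 * z * y.
Proof. by rewrite -mulrA; move: (z * y) => w h; lra. Qed.

Section power_bound.
Context {R : realType} {n : nat}.
Variables (a l : 'rV[R]_n.+1).
Hypothesis l_gt0 : forall i, 0 < l ord0 i.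
Local Notation Om := (hyperrectangle a l).
Local Notation mu := (lebesgue_on a l).
Local Notation I f := (Rintegral mu setT f).
Variables (N : nat) (p : 'I_n.+1 -> nat -> R).
Hypothesis Hp : is_padded a l N p.
Local Notation C := (@gcell _ _ N p).
Local Notation A := (avg mu C).
Let fin := lebesgue_on_fin a l_gt0.
Let part := gcell_part Hp.

Lemma step_powR_integ q w : q != 0 -> integ mu (fun x => `|step C w x| `^ q).
Proof.
move=> q0; have -> : (fun x => `|step C w x| `^ q) = step C (fun r => `|w r| `^ q).
  apply/funext => x; rewrite -(step_map part (phi := fun t => `|t| `^ q))//.
  by rewrite normr0 powR0.
by apply: L2_integ => //; exact: step_L2.
Qed.

Variables (alpha q : R) (f v : 'rV[R]_n.+1 -> R) (W : R).
Hypothesis al0 : 0 < alpha.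
Hypothesis q1 : 1 < q.
Hypothesis Lf : L2 mu f.
Hypothesis vP : is_rof a l alpha (A f) v W.

(* Testing the variational inequality with [v - e * spow v], which does not
   increase the total variation. *)
Lemma rof_powR_le : integ mu (fun x => `|f x| `^ q) ->
  I (fun x => `|A v x| `^ q) <= 2 `^ q * 2 `^ q * I (fun x => `|f x| `^ q).
Proof.
move=> ifq; have q0 : q != 0 by rewrite gt_eqF// (lt_trans ltr01).
have [Lv TVv H] := vP; have iF := L2_integ fin Lf.
have vA := rof_avg_ae l_gt0 Hp al0 vP.
pose c := cm mu C v; pose cf := cm mu C f.
have [e e0 He] := spow_contraction q1 c.
pose w r := c r - e * spow q (c r).
have LS w' : L2 mu (step C w') by exact: step_L2.
have TVw : (TV Om (step C w) <= W%:E)%E by rewrite -TVv; exact: TV_step_le.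
have [W' EW' _] := TV_finE (le_lt_trans TVw (ltry _)).
rewrite EW' lee_fin in TVw.
have := H _ _ (LS w) EW'.
have -> : ip mu (fun x => v x - A f x) (fun x => step C w x - v x) =
    I (step C (fun r => (c r - cf r) * (- e * spow q (c r)))).
  apply: I_ae.
  - apply: measurable_funM; apply: measurable_funB; first by case: Lv.
    + by case: (LS cf).
    + by case: (LS w).
    + by case: Lv.
  - exact: (measurable_step part).
  - apply: filterS vA => x vx; rewrite vx (stepM part) (stepB part); congr (_ * _).
    by rewrite -(stepB part) /step; apply: eq_bigr => r _; rewrite /w /c; ring.
rewrite (I_stepE fin part).
have a1 : alpha * (W' - W) <= 0.
  by rewrite pmulr_rle0// subr_le0.
(* The variation term is nonpositive, so the scalar product alone is nonnegative: it compares |c|^q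
   with cf times [spow c]. *)
move=> h; have {h a1} : 0 <= \sum_r (c r - cf r) * (- e * spow q (c r)) * vol mu C r.
  by apply: le_trans h _; rewrite gerDl.
have -> : \sum_r (c r - cf r) * (- e * spow q (c r)) * vol mu C r =
   e * \sum_r (cf r * spow q (c r) - `|c r| `^ q) * vol mu C r.
  rewrite mulr_sumr; apply: eq_bigr => r _; rewrite -mul_spow//.
  by ring.
rewrite pmulr_rge0// => h.
have hA : I (fun x => `|A v x| `^ q) = \sum_r `|c r| `^ q * vol mu C r.
  rewrite -(I_stepE fin part); congr (Rintegral _ _ _); apply/funext => x.
  by rewrite (step_map part (phi := fun t => `|t| `^ q))// normr0 powR0.
have hf : I (fun x => `|A f x| `^ q) = \sum_r `|cf r| `^ q * vol mu C r.
  rewrite -(I_stepE fin part); congr (Rintegral _ _ _); apply/funext => x.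
  by rewrite (step_map part (phi := fun t => `|t| `^ q))// normr0 powR0.
have hf2 : \sum_r `|cf r| `^ q * vol mu C r <= 2 `^ q * I (fun x => `|f x| `^ q).
  by rewrite -hf; exact: avg_powR (ltW q1) iF ifq.
rewrite hA.
apply: (@le_trans _ _ (2 `^ q * \sum_r `|cf r| `^ q * vol mu C r)); last first.
  by rewrite -mulrA ler_wpM2l// powR_ge0.
(* Young's inequality on each cell; half of the left side is then absorbed. That contributes one
   factor 2^q, and [avg_powR] the other. *)
have h2 : \sum_r `|c r| `^ q * vol mu C r <=
    \sum_r (`|c r| `^ q / 2 + 2 `^ (q - 1) * `|cf r| `^ q) * vol mu C r.
  rewrite -subr_ge0 -sumrB; apply: le_trans h _; apply: ler_sum => r _.
  rewrite -mulrBl; apply: ler_wpM2r; first exact: vol_ge0.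
  rewrite lerD2r.
  apply: le_trans (ler_norm _) _; rewrite normrM norm_spow//.
  by apply: young_half.
have E : 2 `^ q = 2 * 2 `^ (q - 1) :> R by rewrite -powR_ge1E.
have E2 : \sum_r (`|c r| `^ q / 2 + 2 `^ (q - 1) * `|cf r| `^ q) * vol mu C r =
    (\sum_r `|c r| `^ q * vol mu C r) / 2 + 2 `^ (q - 1) * \sum_r `|cf r| `^ q * vol mu C r.
  rewrite mulr_suml mulr_sumr -big_split/=; by apply: eq_bigr => r _; rewrite mulrDl mulrAC -(mulrA (2 `^ _)).
by rewrite E2 in h2; rewrite E; exact: half_absorb h2.
Qed.

End power_bound.

(** * Oscillation in dimension one *)

Section dimension_one.
Context {R : realType}.
Variables (a l : 'rV[R]_1).
Hypothesis l_gt0 : forall i, 0 < l ord0 i.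
Local Notation Om := (hyperrectangle a l).
Local Notation mu := (lebesgue_on a l).
Local Notation I f := (Rintegral mu setT f).
Variables (N : nat) (p : 'I_1 -> nat -> R).
Hypothesis Hp : is_padded a l N p.
Local Notation C := (@gcell _ _ N p).
Let fin := lebesgue_on_fin a l_gt0.
Let part := gcell_part Hp.
Variables (u : 'rV[R]_1 -> R) (V : R).
Hypothesis Lu : L2 mu u.
Hypothesis TVu : TV Om u = V%:E.
Let iu := L2_integ fin Lu.

(** The field equals the sign of the difference on the nodes from the cell [r] to the cell [s] and 0
    elsewhere; its increments single out these two cells. That [s] is not null keeps its left node
    away from the right endpoint. *)
Let cm_lt (r s : {ffun 'I_1 -> 'I_N}) : (r ord0 < s ord0)%N -> vol mu C s != 0 ->
  `|cm mu C u r - cm mu C u s| <= V.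
Proof.
move=> rs vs; pose sg := Num.sg (cm mu C u r - cm mu C u s).
have ps : p ord0 (s ord0) < a ord0 ord0 + l ord0 ord0.
  rewrite lt_neqAle (nodes_le (Hp ord0)) andbT.
  apply: contra vs => /eqP E; rewrite gcell_vol// big_ord1.
  rewrite E (_ : p ord0 (s ord0).+1 = a ord0 ord0 + l ord0 ord0) ?subrr//.
  apply/eqP; rewrite eq_le (nodes_le (Hp ord0)) /= -E.
  exact: nodes_leS (Hp _) _.
pose c (i : 'I_1) (m : nat) (r' : {ffun 'I_0 -> 'I_N}) : R :=
  if (r ord0 < m <= s ord0)%N then sg else 0.
have c1 i m r' : `|c i m r'| <= 1.
  by rewrite /c; case: ifP => _; rewrite ?normr0// /sg normr_sg; case: (_ != 0).
have c2 i r' : c i 0%N r' = 0 by rewrite /c ltn0.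
have c3 i m r' : p i m = a ord0 i + l ord0 i -> c i m r' = 0.
  rewrite (ord1 i) /c => E; case: ifP => // /andP[_ ms].
  by have := nodes_homo (Hp ord0) ms; rewrite E leNgt ps.
have := TV_ge_step l_gt0 Hp c1 c2 c3 Lu.
rewrite TVu lee_fin big_ord1.
pose r0 : {ffun 'I_0 -> 'I_N} := [ffun k => s ord0].
have r0E (r' : {ffun 'I_0 -> 'I_N}) : r' = r0 by apply/ffunP => -[].
rewrite (bigD1 r0)//= [X in _ + X]big1 ?addr0; last by move=> r'; rewrite (r0E r') eqxx.
have idx (t : {ffun 'I_1 -> 'I_N}) : insidx ord0 (t ord0) r0 = t.
  by apply/ffunP => j; rewrite (ord1 j) insidx_same.
rewrite /fvol big_ord0; under eq_bigr do rewrite mul1r.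
have sr : s ord0 != r ord0 by rewrite -val_eqE/= gtn_eqF.
rewrite (bigD1 (r ord0))//= (bigD1 (s ord0))//= [X in _ + (_ + X)]big1 ?addr0; last first.
  move=> m /andP[mr ms]; rewrite -!val_eqE/= in mr ms; rewrite /c.
  have -> : (r ord0 < m.+1 <= s ord0)%N = (r ord0 < m <= s ord0)%N.
    by rewrite ltnS (leq_eqVlt (r ord0)) eq_sym (negbTE mr)/= (leq_eqVlt m) (negbTE ms).
  by rewrite subrr mul0r.
rewrite !idx /c ltnn ltnSn rs /= leqnn ltnn !andbF/= sub0r subr0.
by rewrite mulNr -mulrBr -normrEsg.
Qed.

Lemma cm_dist_dim1 r s : vol mu C r != 0 -> vol mu C s != 0 ->
  `|cm mu C u r - cm mu C u s| <= V.
Proof.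
move=> vr vs; have [rs|rs|E] := ltngtP (r ord0) (s ord0); first exact: cm_lt.
  by rewrite distrC; exact: cm_lt.
have -> : r = s by apply/ffunP => j; rewrite (ord1 j); exact: val_inj.
by rewrite subrr normr0 -lee_fin -TVu; exact: TV_ge0.
Qed.

(** The mean of [u] over the whole interval is a weighted mean of the cell means, so every one of
    them is within [V] of it. The bound does not depend on the grid. *)
Lemma avg_bound_dim1 x : `|avg mu C u x| <= V + `|I u| / fine (mu setT).
Proof.
have V0 : 0 <= V by rewrite -lee_fin -TVu; exact: TV_ge0.
have mu0 : 0 <= fine (mu setT) by rewrite fine_ge0.
have B0 : 0 <= `|I u| / fine (mu setT) by rewrite divr_ge0.
have [[r Cr E]|E] := stepP part x; rewrite /avg E ?normr0 ?addr_ge0//.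
have vr : vol mu C r != 0.
  move/gcellP : Cr => xr; rewrite gcell_vol//; apply/prodf_neq0 => i _.
  by have /andP[h1 h2] := xr i; rewrite subr_eq0 gt_eqF// (lt_trans h1).
have i1 : integ mu (cst 1) by apply: (integ_bounded fin (M := 1)) => // y; rewrite normr1.
have sv : \sum_s vol mu C s = fine (mu setT).
  rewrite -[RHS]mul1r -(I_cst mu 1) (I_cm fin part i1); apply: eq_bigr => s _.
  have [->|v0] := eqVneq (vol mu C s) 0; first by rewrite mul0r.
  by rewrite (cm_const fin part (c := 1))// mulr1.
have mup : 0 < fine (mu setT).
  rewrite lt_neqAle mu0 andbT eq_sym -sv psumr_neq0; last by move=> *; exact: vol_ge0.
  by apply/hasP; exists r; rewrite ?mem_index_enum//= lt_neqAle eq_sym vr vol_ge0.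
have h : `|cm mu C u r * fine (mu setT) - I u| <= V * fine (mu setT).
  rewrite (I_cm fin part iu) -sv !mulr_sumr -sumrB; apply: le_trans (ler_norm_sum _ _ _) _.
  apply: ler_sum => s _; rewrite mulrC -mulrBr normrM (ger0_norm (vol_ge0 _ _ _)) mulrC.
  have [->|vs] := eqVneq (vol mu C s) 0; first by rewrite !mulr0.
  by rewrite ler_wpM2r ?vol_ge0 ?cm_dist_dim1.
rewrite -(ler_pM2r mup) mulrDl divfK ?gt_eqF// -{1}(gtr0_norm mup) -normrM.
rewrite -[cm mu C u r * _](subrK (I u)).
by apply: le_trans (ler_normD _ _) _; rewrite lerD2r.
Qed.

End dimension_one.

(** * Convergence rates *)

Section truncation_estimates.
Context {disp} {T : measurableType disp} {R : realType}.
Variable mu : {measure set T -> \bar R}.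
Hypothesis mu_fin : (mu setT < +oo)%E.
Local Notation I f := (Rintegral mu setT f).

Lemma powR_le_neg (x M e : R) : 0 < M -> M <= x -> e <= 0 -> x `^ e <= M `^ e.
Proof.
move=> M0 Mx e0; rewrite -[e]opprK !(powRN _ (- e)) lef_pV2 ?posrE ?powR_gt0//; last exact: lt_le_trans Mx.
by apply: ge0_ler_powR; rewrite ?nnegrE ?oppr_ge0// ltW// (lt_le_trans M0).
Qed.

(** For x > M let m be the larger of x and y; then x y <= m^2 = m^(2-q) m^q with m >= M and 2 - q <=
    0. *)
Lemma truncation_le (q x y M : R) : 2 <= q -> 0 <= x -> 0 <= y -> 0 < M ->
  x * y <= M * y + M `^ (2 - q) * (x `^ q + y `^ q).
Proof.
move=> q2 x0 y0 M0; have [xM|Mx] := leP x M.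
  by rewrite (le_trans (ler_wpM2r y0 xM))// lerDl mulr_ge0 ?addr_ge0 ?powR_ge0.
apply: ler_wpDl; first by rewrite mulr_ge0// ltW.
pose m := Num.max x y; have Mm : M <= m by rewrite le_max (ltW Mx).
have m0 : 0 < m by exact: lt_le_trans Mm.
have mq : m `^ q <= x `^ q + y `^ q.
  by rewrite /m; case: (leP x y) => _; [rewrite lerDr|rewrite lerDl]; rewrite powR_ge0.
apply: (@le_trans _ _ (m `^ (2 - q) * m `^ q)).
  have -> : m `^ (2 - q) * m `^ q = m * m.
    by rewrite -powRD; [rewrite subrK powR_mulrn ?expr2// ltW|rewrite (gt_eqF m0) implybT].
  by apply: ler_pM => //; rewrite /m le_max lexx ?orbT.
by apply: ler_pM; rewrite ?powR_ge0// powR_le_neg// subr_le0.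
Qed.

(** For x > M, x y <= B x = B x^(1-q) x^q and x^(1-q) <= M^(1-q). *)
Lemma truncation_bounded_le (q x y M B : R) : 1 <= q -> 0 <= x -> 0 <= y <= B -> 0 < M ->
  x * y <= M * y + B * M `^ (1 - q) * x `^ q.
Proof.
move=> q1 x0 /andP[y0 yB] M0; have [xM|Mx] := leP x M.
  by rewrite (le_trans (ler_wpM2r y0 xM))// lerDl !mulr_ge0 ?powR_ge0// (le_trans y0).
apply: ler_wpDl; first by rewrite mulr_ge0// ltW.
have xp := lt_trans M0 Mx.
rewrite mulrC -mulrA; apply: ler_pM => //.
rewrite -{1}(powRr1 (ltW xp)) -{1}(subrK q 1) powRD; last by rewrite (gt_eqF xp) implybT.
by rewrite ler_wpM2r ?powR_ge0// powR_le_neg ?subr_le0// ltW.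
Qed.

Variables (f w : T -> R) (c h : R).
Hypothesis Lf : L2 mu f.
Hypothesis Lw : L2 mu w.
Hypothesis h0 : 0 < h.
Hypothesis wc : I (fun x => `|w x|) <= c * h.

Let iw := integ_norm (L2_integ mu_fin Lw).
Let ifw : integ mu (fun x => `|f x * w x|) := integ_norm (L2_mul Lf Lw).

Let ip_le_norm : `|ip mu f w| <= I (fun x => `|f x * w x|).
Proof. exact: I_abs (L2_mul Lf Lw). Qed.

Let powRh (s e : R) : (h `^ (- s)) `^ e = h `^ (- s * e).
Proof. by rewrite -powRrM. Qed.

Lemma pairing_bound q K : 2 <= q -> integ mu (fun x => `|f x| `^ q) -> integ mu (fun x => `|w x| `^ q) ->
  I (fun x => `|f x| `^ q) + I (fun x => `|w x| `^ q) <= K ->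
  `|ip mu f w| <= (c + K) * h `^ (1 - (q - 1)^-1).
Proof.
move=> q2 ifq iwq fwK; pose s := (q - 1)^-1; pose M := h `^ (- s).
have M0 : 0 < M by exact: powR_gt0.
have q1 : q - 1 != 0 by rewrite subr_eq0 gt_eqF// (lt_le_trans _ q2)// ltr1n.
have E1 : M * (c * h) = c * h `^ (1 - s).
  by rewrite mulrC -mulrA /M -{1}(powRr1 (ltW h0)) -powRD// (gt_eqF h0) implybT.
have E2 : M `^ (2 - q) = h `^ (1 - s).
  by rewrite /M powRh; congr (h `^ _); rewrite /s; field.
apply: (le_trans ip_le_norm).
apply: (@le_trans _ _ (I (fun x => M * `|w x| + M `^ (2 - q) * (`|f x| `^ q + `|w x| `^ q)))).
  apply: I_le => //; first by apply: integD; apply: integZ => //; exact: integD.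
  by move=> x; rewrite normrM; exact: truncation_le.
rewrite ID ?IZ ?ID//; [|exact: integD|exact: integZ|by apply: integZ; exact: integD].
rewrite mulrDl -/s -E1 -E2; apply: lerD; first by rewrite ler_wpM2l// ltW.
by rewrite [leRHS]mulrC ler_wpM2l// powR_ge0.
Qed.

Lemma pairing_bound_bounded q B : 1 <= q -> integ mu (fun x => `|f x| `^ q) ->
  {ae mu, forall x, `|w x| <= B} ->
  `|ip mu f w| <= (c + B * I (fun x => `|f x| `^ q)) * h `^ (1 - q^-1).
Proof.
move=> q1 ifq wB; pose s := q^-1; pose M := h `^ (- s).
have M0 : 0 < M by exact: powR_gt0.
have q0 : q != 0 by rewrite gt_eqF// (lt_le_trans ltr01).
have E1 : M * (c * h) = c * h `^ (1 - s).
  by rewrite mulrC -mulrA /M -{1}(powRr1 (ltW h0)) -powRD// (gt_eqF h0) implybT.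
have E2 : M `^ (1 - q) = h `^ (1 - s).
  by rewrite /M powRh; congr (h `^ _); rewrite /s; field.
apply: (le_trans ip_le_norm).
apply: (@le_trans _ _ (I (fun x => M * `|w x| + B * M `^ (1 - q) * `|f x| `^ q))).
  apply: I_le_ae => //; first by apply: integD; exact: integZ.
  by apply: filterS wB => x wB; rewrite normrM; apply: truncation_bounded_le; rewrite ?normr_ge0.
rewrite ID ?IZ//; [|exact: integZ|exact: integZ].
rewrite mulrDl -/s -E1 -E2; apply: lerD; first by rewrite ler_wpM2l// ltW.
by rewrite mulrAC.
Qed.

Lemma pairing_bound_ess M : 0 <= M -> {ae mu, forall x, `|f x| <= M} -> `|ip mu f w| <= M * c * h.
Proof.
move=> M0 fM; apply: (le_trans ip_le_norm).
apply: (@le_trans _ _ (I (fun x => M * `|w x|))).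
  apply: I_le_ae => //; first exact: integZ.
  by apply: filterS fM => x fM; rewrite normrM ler_wpM2r.
by rewrite IZ// -mulrA ler_wpM2l.
Qed.

End truncation_estimates.

Lemma powR_dist_le (R : realType) (q x y : R) : 0 <= q ->
  `|x - y| `^ q <= 2 `^ q * (`|x| `^ q + `|y| `^ q).
Proof.
move=> q0; have m0 : 0 <= Num.max `|x| `|y| by rewrite le_max normr_ge0.
apply: (@le_trans _ _ ((2 * Num.max `|x| `|y|) `^ q)).
  apply: ge0_ler_powR; rewrite ?nnegrE ?mulr_ge0//.
  rewrite mulr_natl mulr2n; apply: le_trans (ler_normB _ _) _.
  by apply: lerD; rewrite le_max lexx ?orbT.
rewrite powRM// ler_wpM2l ?powR_ge0//.
by case: (leP `|x| `|y|) => _; [rewrite lerDr|rewrite lerDl]; rewrite powR_ge0.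
Qed.

Lemma half_le (R : realFieldType) (x z : R) : `|x| <= z -> x / 2 <= z.
Proof. by have := ler_norm x; have := normr_ge0 x; move: (`|x|) => y *; lra. Qed.

Section rates.
Context {R : realType} {n : nat}.
Variables (a l : 'rV[R]_n.+1).
Hypothesis l_gt0 : forall i, 0 < l ord0 i.
Local Notation Om := (hyperrectangle a l).
Local Notation mu := (lebesgue_on a l).
Local Notation I f := (Rintegral mu setT f).
Local Notation nsq f := (ip mu f f).
Let fin := lebesgue_on_fin a l_gt0.
Variables (N : nat -> nat) (p : nat -> 'I_n.+1 -> nat -> R) (h : nat -> R).
Hypothesis Hp : forall k, is_padded a l (N k) (p k).
Hypothesis Hh : forall k i m, p k i m.+1 - p k i m <= h k.
Hypothesis h_gt0 : forall k, 0 < h k.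
Hypothesis h_cvg0 : h k @[k --> \oo] --> 0.
Local Notation A k := (avg mu (@gcell _ _ (N k) (p k))).
Let part k := gcell_part (Hp k).
Let LA k g : L2 mu (A k g). Proof. exact: step_L2. Qed.

Section pairing.
Variables (f g : 'rV[R]_n.+1 -> R) (V : R).
Hypothesis Lf : L2 mu f.
Hypothesis Lg : L2 mu g.
Hypothesis TVg : TV Om g = V%:E.
Let Lw k : L2 mu (fun x => g x - A k g x). Proof. exact: L2B. Qed.
Let wc k : I (fun x => `|g x - A k g x|) <= n.+1%:R * V * h k.
Proof. by rewrite mulrAC; exact: poincare. Qed.

(** The constant is independent of k because averaging is bounded in L^q uniformly over all grids,
    by [avg_powR]. *)
Lemma grid_pairing_bound q : 2 <= q -> integ mu (fun x => `|f x| `^ q) ->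
  integ mu (fun x => `|g x| `^ q) ->
  exists C, forall k, `|ip mu f (fun x => g x - A k g x)| <= C * h k `^ (1 - (q - 1)^-1).
Proof.
move=> q2 ifq igq; have q1 : 1 <= q by rewrite (le_trans _ q2)// ler1n.
have q0 : 0 <= q by rewrite (le_trans _ q2).
pose Kg := 2 `^ q * (I (fun x => `|g x| `^ q) + 2 `^ q * I (fun x => `|g x| `^ q)).
exists (n.+1%:R * V + (I (fun x => `|f x| `^ q) + Kg)) => k.
have ig := L2_integ fin Lg.
have iA : integ mu (fun x => `|A k g x| `^ q).
  by apply: step_powR_integ => //; rewrite gt_eqF// (lt_le_trans ltr01).
have iS : integ mu (fun x => 2 `^ q * (`|g x| `^ q + `|A k g x| `^ q)).
  by apply: integZ; exact: integD.
have le x : `| `|g x - A k g x| `^ q| <= 2 `^ q * (`|g x| `^ q + `|A k g x| `^ q).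
  by rewrite ger0_norm ?powR_ge0//; exact: powR_dist_le.
have iw : integ mu (fun x => `|g x - A k g x| `^ q).
  apply: (integ_le _ iS le).
  by apply: (measurableT_comp (measurable_powR _)); apply: measurableT_comp => //; case: (Lw k).
apply: (pairing_bound fin Lf (Lw k) (h_gt0 k) (wc k)) => //; rewrite lerD2l.
apply: (@le_trans _ _ (I (fun x => 2 `^ q * (`|g x| `^ q + `|A k g x| `^ q)))).
  by apply: I_le => // x; exact: le_trans (ler_norm _) (le x).
rewrite IZ ?ID//; last exact: integD.
by rewrite ler_wpM2l ?powR_ge0// lerD2l avg_powR.
Qed.

Lemma grid_pairing_bound_ess M : 0 <= M -> {ae mu, forall x, `|f x| <= M} ->
  exists C, forall k, `|ip mu f (fun x => g x - A k g x)| <= C * h k.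
Proof.
move=> M0 fM; exists (M * (n.+1%:R * V)) => k.
exact: (pairing_bound_ess fin Lf (Lw k) (wc k) M0 fM).
Qed.

Lemma grid_pairing_bound_bounded q B : 1 <= q -> integ mu (fun x => `|f x| `^ q) ->
  (forall k x, `|A k g x| <= B) -> {ae mu, forall x, `|g x| <= B} ->
  exists C, forall k, `|ip mu f (fun x => g x - A k g x)| <= C * h k `^ (1 - q^-1).
Proof.
move=> q1 ifq AB gB; exists (n.+1%:R * V + (B + B) * I (fun x => `|f x| `^ q)) => k.
apply: (pairing_bound_bounded fin Lf (Lw k) (h_gt0 k) (wc k) q1 ifq).
apply: filterS gB => x gB; apply: le_trans (ler_normB _ _) _; exact: lerD.
Qed.

Lemma grid_avg_L1_cvg : I (fun x => `|g x - A k g x|) @[k --> \oo] --> 0.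
Proof.
have c : n.+1%:R * V * h k @[k --> \oo] --> 0.
  by rewrite -(mulr0 (n.+1%:R * V)); apply: cvgM; [exact: cvg_cst|exact: h_cvg0].
apply: (squeeze_cvgr _ (cvg_cst 0) c); apply: nearW => k.
by rewrite wc andbT; exact: I_ge0.
Qed.

End pairing.

Variables (alpha : R) (f u : 'rV[R]_n.+1 -> R) (V : R) (v : nat -> 'rV[R]_n.+1 -> R) (W : nat -> R).
Hypothesis al0 : 0 < alpha.
Hypothesis Lf : L2 mu f.
Hypothesis uP : is_rof a l alpha f u V.
Hypothesis vP : forall k, is_rof a l alpha (A k f) (v k) (W k).
Let Lu : L2 mu u. Proof. by case: uP. Qed.
Let TVu : TV Om u = V%:E. Proof. by case: uP. Qed.
Let Lv k : L2 mu (v k). Proof. by case: (vP k). Qed.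
Local Notation dist k := (Num.sqrt (nsq (fun x => v k x - u x))).

Let distE k : nsq (fun x => v k x - u x) = nsq (fun x => u x - v k x).
Proof. by congr (Rintegral _ _ _); apply/funext => x; ring. Qed.

Let sqr_dist_le k : nsq (fun x => v k x - u x) <= ip mu f (fun x => u x - A k u x).
Proof. by rewrite distE; exact: (rof_dist_le l_gt0 (Hp k) al0 Lf uP (vP k)). Qed.

Let sqrt_cvg0 (s : nat -> R) : s k @[k --> \oo] --> 0 -> Num.sqrt (s k) @[k --> \oo] --> 0.
Proof.
move=> c; rewrite -[X in _ --> X]sqrtr0.
by apply: continuous_cvg c; exact: sqrt_continuous.
Qed.

Let ip_cvg0 g : L2 mu g -> ip mu f (fun x => g x - A k g x) @[k --> \oo] --> 0.
Proof.
move=> Lg; apply/norm_cvg0P.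
have c := sqrt_cvg0 (grid_avg_cvg l_gt0 Hp Hh h_cvg0 Lg).
have {}c : Num.sqrt (nsq f) * Num.sqrt (nsq (fun x => g x - A k g x)) @[k --> \oo] --> 0.
  by rewrite -(mulr0 (Num.sqrt (nsq f))); apply: cvgM; [exact: cvg_cst|exact: c].
apply: (squeeze_cvgr _ (cvg_cst 0) c); apply: nearW => k.
by rewrite normr_ge0/=; apply: CauchySchwarz => //; exact: L2B.
Qed.

Lemma rof_dist_cvg : dist k @[k --> \oo] --> 0.
Proof.
apply: sqrt_cvg0; apply: (squeeze_cvgr _ (cvg_cst 0) (ip_cvg0 Lu)); apply: nearW => k.
by rewrite ip_ge0/=.
Qed.

Let gap_le k : `|W k - V| <= alpha^-1 * Num.sqrt (nsq (fun x => u x - f x)) * dist k.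
Proof.
rewrite -mulrA mulrC ler_pdivlMr// mulrC distE.
exact: (rof_TV_gap l_gt0 (Hp k) al0 Lf uP (vP k)).
Qed.

Lemma rof_TV_cvg : W k @[k --> \oo] --> V.
Proof.
apply/subr_cvg0; apply/norm_cvg0P.
have c : alpha^-1 * Num.sqrt (nsq (fun x => u x - f x)) * dist k @[k --> \oo] --> 0.
  rewrite -(mulr0 (alpha^-1 * Num.sqrt (nsq (fun x => u x - f x)))).
  by apply: cvgM; [exact: cvg_cst|exact: rof_dist_cvg].
by apply: (squeeze_cvgr _ (cvg_cst 0) c); apply: nearW => k; rewrite normr_ge0/=.
Qed.

Local Notation egap k := (rof a l alpha (A k f) (v k) (W k) - rof a l alpha f u V).

Let energy_gap_le k : `|egap k| <= ip mu f (fun x => f x - A k f x) / 2.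
Proof.
have /andP[h1 h2] := rof_energy_gap l_gt0 (Hp k) al0 Lf uP (vP k).
by rewrite distrC ger0_norm.
Qed.

Lemma rof_energy_cvg : egap k @[k --> \oo] --> 0.
Proof.
apply/norm_cvg0P; have c : ip mu f (fun x => f x - A k f x) / 2 @[k --> \oo] --> 0.
  by rewrite -(mul0r 2^-1); apply: cvgM; [exact: ip_cvg0|exact: cvg_cst].
by apply: (squeeze_cvgr _ (cvg_cst 0) c); apply: nearW => k; rewrite normr_ge0/=.
Qed.

(** [rof_dist_le] controls the square of the distance, hence e / 2; the gap of the variations is
    linear in the distance. *)
Lemma rof_rate C e : (forall k, `|ip mu f (fun x => u x - A k u x)| <= C * h k `^ e) ->
  exists C', forall k, dist k <= C' * h k `^ (e / 2) /\ `|W k - V| <= C' * h k `^ (e / 2).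
Proof.
move=> H; pose c1 := Num.sqrt `|C|; pose c2 := alpha^-1 * Num.sqrt (nsq (fun x => u x - f x)) * c1.
have D k : dist k <= c1 * h k `^ (e / 2).
  have -> : h k `^ (e / 2) = Num.sqrt (h k `^ e) by rewrite powRrM powR12_sqrt// powR_ge0.
  rewrite -sqrtrM// ler_sqrt ?mulr_ge0 ?powR_ge0//.
  apply: le_trans (sqr_dist_le k) _; apply: le_trans (ler_norm _) _; apply: le_trans (H k) _.
  by rewrite ler_wpM2r ?powR_ge0 ?ler_norm.
have c20 : 0 <= c2 by rewrite !mulr_ge0 ?sqrtr_ge0// invr_ge0 ltW.
exists (c1 + c2) => k; split.
  by apply: le_trans (D k) _; rewrite ler_wpM2r ?powR_ge0// lerDl.
apply: le_trans (gap_le k) _.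
apply: (@le_trans _ _ (c2 * h k `^ (e / 2))).
  by rewrite /c2 -(mulrA _ c1) ler_wpM2l// mulr_ge0 ?sqrtr_ge0// invr_ge0 ltW.
by rewrite ler_wpM2r ?powR_ge0// lerDr sqrtr_ge0.
Qed.

Lemma rof_energy_rate C e : (forall k, `|ip mu f (fun x => f x - A k f x)| <= C * h k `^ e) ->
  forall k, `|egap k| <= C * h k `^ e.
Proof.
move=> H k; apply: le_trans (energy_gap_le k) _.
exact: half_le.
Qed.

(** The functions [A k (v k)] agree almost everywhere with [v k], converge to [u] in L^1 and have
    L^q norms bounded independently of k by [rof_powR_le]. *)
Lemma rof_powR_integ q : 1 < q -> integ mu (fun x => `|f x| `^ q) -> integ mu (fun x => `|u x| `^ q).
Proof.
move=> q1 ifq; have q0 : q != 0 by rewrite gt_eqF// (lt_trans ltr01).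
have iu := L2_integ fin Lu.
apply: (@limit_integ_powR _ _ _ mu fin u (fun k => A k (v k)) iu _ _ q
    (2 `^ q * 2 `^ q * I (fun x => `|f x| `^ q)) (ltW q1)).
- by move=> k; exact: L2_integ.
- have c : dist k * Num.sqrt (fine (mu setT)) @[k --> \oo] --> 0.
    rewrite -(mul0r (Num.sqrt (fine (mu setT)))); apply: cvgM; [exact: rof_dist_cvg|exact: cvg_cst].
  apply: (squeeze_cvgr _ (cvg_cst 0) c); apply: nearW => k.
  rewrite I_ge0//=; apply: (@le_trans _ _ (I (fun x => `|u x - v k x|))).
    apply: I_le_ae.
    + by apply/integ_norm/integB => //; exact: L2_integ.
    + by apply/integ_norm/integB => //; exact: L2_integ.
    + by apply: filterS (rof_avg_ae l_gt0 (Hp k) al0 (vP k)) => x <-.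
  by rewrite distE; apply: L1_le_L2 => //; exact: L2B.
- by move=> k; exact: step_powR_integ.
- by move=> k; exact: (rof_powR_le l_gt0 (Hp k) al0 q1 Lf (vP k)).
Qed.

End rates.

(** * Cells of a family of hyperplanes *)

Lemma itv_segment (R : realDomainType) (c e x y t : R) : 0 <= t <= 1 ->
  c < x < e -> c < y < e -> c < x + t * (y - x) < e.
Proof.
move=> /andP[t0 t1] /andP[x1 x2] /andP[y1 y2]; have t1' : 0 <= 1 - t by rewrite subr_ge0.
have [xy|/ltW xy] := leP x y; rewrite -subr_ge0 in xy;
  by have := mulr_ge0 t0 xy; have := mulr_ge0 t1' xy => h1 h2; apply/andP; split; lra.
Qed.

Section grid_nodes.
Context {R : realType} {n : nat}.
Variables (a l : 'rV[R]_n.+1).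
Hypothesis l_gt0 : forall i, 0 < l ord0 i.
Variable G : {fset 'I_n.+1 * R}.
Local Notation Om := (hyperrectangle a l).
Local Notation mu := (lebesgue_on a l).
Local Notation b i := (a ord0 i + l ord0 i).

(** Only hyperplanes that meet the open box are kept; the endpoints are put back in [grid_node]. *)
Definition cuts (i : 'I_n.+1) : seq R :=
  sort <=%R (undup [seq e.2 | e <- enum_fset G & (e.1 == i) && (a ord0 i < e.2 < b i)]).

(** The default value of [nth] produces the padding by the right endpoint. *)
Definition grid_node (i : 'I_n.+1) (m : nat) : R := nth (b i) (a ord0 i :: cuts i) m.
Definition grid_size : nat := \max_(i < n.+1) (size (cuts i)).+1.

Lemma mem_cuts i c : (c \in cuts i) = ((i, c) \in G) && (a ord0 i < c < b i).
Proof.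
rewrite mem_sort mem_undup; apply/mapP/andP.
  move=> [[j x]]; rewrite mem_filter /= => /andP[/andP[/eqP -> h] jG] ->; by split.
by move=> [icG h]; exists (i, c) => //; rewrite mem_filter /= eqxx h.
Qed.

Let sorted_cuts i : sorted <%R (a ord0 i :: cuts i).
Proof.
rewrite /= path_sortedE; last exact: lt_trans.
rewrite sort_lt_sorted undup_uniq andbT; apply/allP => c.
by rewrite mem_cuts => /andP[_ /andP[]].
Qed.

Let nth_lt i m : (m < size (a ord0 i :: cuts i))%N -> grid_node i m < b i.
Proof.
move=> ms; have := mem_nth (b i) ms; rewrite -/(grid_node i m) inE => /orP[/eqP ->|].
  by rewrite ltrDl.
by rewrite mem_cuts => /andP[_ /andP[]].
Qed.

Lemma grid_node_padded : is_padded a l grid_size grid_node.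
Proof.
move=> i; split=> //.
  by rewrite /grid_node nth_default//= /grid_size (leq_bigmax i).
move=> m; have [ms|ms] := ltnP m.+1 (size (a ord0 i :: cuts i)).
  left; split; last exact/ltW/nth_lt.
  by rewrite lt_sorted_ltn_nth ?inE ?(ltnW ms).
have E : grid_node i m.+1 = b i by rewrite /grid_node nth_default.
have [ms'|ms'] := ltnP m (size (a ord0 i :: cuts i)).
  by left; rewrite E; split=> //; exact: nth_lt.
by right; rewrite E /grid_node nth_default.
Qed.

Local Notation C := (@gcell _ _ grid_size grid_node).
Let free := Om `\` grid_support G.

Let node_or i m : [\/ grid_node i m = a ord0 i, grid_node i m = b i | (i, grid_node i m) \in G].
Proof.
have [ms|ms] := ltnP m (size (a ord0 i :: cuts i)); last first.
  by constructor 2; rewrite /grid_node nth_default.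
have := mem_nth (b i) ms; rewrite -/(grid_node i m) inE => /orP[/eqP ->|]; first by constructor 1.
by rewrite mem_cuts => /andP[h _]; constructor 3.
Qed.

Let free_off_nodes x i m : free x -> x ord0 i <> grid_node i m.
Proof.
move=> [Ox xG] E; have /andP[h1 h2] := Ox i; case: (node_or i m) => h.
- by move: h1; rewrite E h ltxx.
- by move: h2; rewrite E h ltxx.
- by apply: xG; exists (i, grid_node i m).
Qed.

Let free_gcell x : free x -> exists r, C r x.
Proof.
move=> fx; case: (fx) => Ox _.
by apply: (gcell_off_nodes grid_node_padded Ox) => i m; exact: free_off_nodes.
Qed.

Let node_index i c : (i, c) \in G -> a ord0 i < c < b i -> exists m, grid_node i m = c.
Proof.
move=> cG cb; have : c \in cuts i by rewrite mem_cuts cG.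
by move=> /(nthP (b i))[m ms E]; exists m.+1.
Qed.

Let gcell_free r : C r `<=` free.
Proof.
move=> x xr; have Ox := gcell_sub grid_node_padded xr.
split=> // -[[i c] /= cG xc]; rewrite /hyperplane/= in xc.
have [m E] := node_index cG (eq_ind _ (fun t => a ord0 i < t < b i) (Ox i) _ xc).
move/gcellP : xr => /(_ i); rewrite xc -E => /andP[h1 h2].
have mono := nodes_homo (grid_node_padded i).
have [mr|rm] := leqP m (r i); first by have := mono _ _ mr; rewrite leNgt h1.
by have := mono _ _ rm; rewrite leNgt h2.
Qed.

Let segment_gcell r x y : C r x -> C r y -> connected_component free x y.
Proof.
move=> /gcellP xr /gcellP yr; pose g (t : R) : 'rV[R]_n.+1 := x + t *: (y - x).
have cg : continuous g.
  by move=> t; apply: cvgD; [exact: cvg_cst|apply: cvgZ; [exact: cvg_id|exact: cvg_cst]].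
exists (g @` `[0, 1]); last by exists 1; rewrite /g ?scale1r ?subrKC//= in_itv/= ler01 lexx.
split.
- by exists 0; rewrite /g ?scale0r ?addr0//= in_itv/= ler01 lexx.
- move=> z [t t01 <-]; move: t01; rewrite /= in_itv/= => /andP[t0 t1]; apply: (@gcell_free r).
  apply/gcellP => i; rewrite /g !mxE.
  by apply: itv_segment; rewrite ?t0.
- apply: connected_continuous_connected; first exact: segment_connected.
  exact: continuous_subspaceT.
Qed.

(** A cell is convex, hence connected. Conversely each coordinate projection of a connected set free
    of the grid is an interval that contains no node, so it cannot leave the slab of x. *)
Let component_gcell r x : C r x -> connected_component free x = C r.
Proof.
move=> xr; apply/seteqP; split=> y; last exact: segment_gcell.
move=> [B [Bx Bfree Bc] By]; apply/gcellP => i.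
have Bi : is_interval ((fun z : 'rV[R]_n.+1 => z ord0 i) @` B).
  apply/connected_intervalP; apply: connected_continuous_connected => //.
  by apply: continuous_subspaceT => z; exact: coord_continuous.
have ix : ((fun z : 'rV[R]_n.+1 => z ord0 i) @` B) (x ord0 i) by exists x.
have iy : ((fun z : 'rV[R]_n.+1 => z ord0 i) @` B) (y ord0 i) by exists y.
have avoid m : ~ ((fun z : 'rV[R]_n.+1 => z ord0 i) @` B) (grid_node i m).
  by move=> [z Bz E]; exact: (free_off_nodes (Bfree _ Bz) E).
move/gcellP : xr => /(_ i) /andP[h1 h2]; apply/andP; split; rewrite ltNge; apply/negP => h.
  by apply: (avoid (r i)); apply: (Bi _ _ iy ix); rewrite h ltW.
by apply: (avoid (r i).+1); apply: (Bi _ _ ix iy); rewrite h ltW.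
Qed.

Lemma cells_gcell P : cells Om G P <-> exists2 r, P = C r & C r !=set0.
Proof.
split.
  move=> [x fx <-]; have [r xr] := free_gcell fx.
  by exists r; [exact: component_gcell|exists x].
move=> [r -> [x xr]]; exists x; first exact: gcell_free xr.
exact: component_gcell.
Qed.

Let part := gcell_part grid_node_padded.

Let mean_cm (f : 'rV[R]_n.+1 -> R) r : integ mu f -> mean f (C r) = cm mu C f r.
Proof.
move=> iF; have mC : measurable (C r) by case: part.
have Cs := @gcell_sub _ _ a l _ _ grid_node_padded r.
rewrite /mean /cm; congr (_^-1 * _).
  have -> : vol mu C r = fine (lebesgue_rV n.+1 (C r `&` Om)) by [].
  by rewrite (setIidl Cs).
have := integral_lebesgue_on (integ_indic part r iF) => E.
rewrite -[RHS]/(fine ((Rintegral mu setT (fun x => f x * \1_(C r) x))%:E)) -E /Rintegral; congr fine.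
rewrite integral_mkcond [RHS]integral_mkcond; apply: eq_integral => x _.
rewrite !patchE; case: ifPn => xC.
  rewrite (_ : x \in Om = true) ?indicE ?xC ?mulr1//.
  by apply/mem_set/Cs/set_mem.
by case: ifP => //; rewrite indicE (negbTE xC) mulr0.
Qed.

(** Several indices may give the same empty cell, so the sums over sets and over indices are
    compared at a point, where at most one term survives. *)
Lemma averaging_gcell f : integ mu f -> averaging Om G f = avg mu C f.
Proof.
move=> iF; apply/funext => x; rewrite /averaging.
have [[r xr]|nr] := pselect (exists r, C r x).
  rewrite /avg (step_in part _ xr) -(fsbig_widen [set C r]).
  - by rewrite fsbig_set1 indicE mem_set// mulr1 mean_cm.
  - by move=> _ ->; apply/cells_gcell; exists r => //; exists x.
  - move=> _ [/cells_gcell[s -> _] /= ns]; rewrite indicE memNset ?mulr0// => xs.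
    by apply: ns; case: part => _ dis _; rewrite (dis _ _ _ xr xs).
rewrite /avg step_out// fsbig1// => P /cells_gcell[s -> _].
by rewrite indicE memNset ?mulr0// => xs; apply: nr; exists s.
Qed.

Let side_gcell r i : C r !=set0 -> side_length (C r) i = grid_node i (r i).+1 - grid_node i (r i).
Proof.
move=> [x xr]; move/gcellP : (xr) => xr'; rewrite /side_length.
have -> : [set y ord0 i | y in C r] = [set` `]grid_node i (r i), grid_node i (r i).+1[].
  apply/seteqP; split=> t /=.
    by move=> [y /gcellP yr <-]; rewrite in_itv; exact: yr.
  rewrite in_itv/= => ti; exists (\row_j if j == i then t else x ord0 j); last by rewrite mxE eqxx.
  by apply/gcellP => j; rewrite mxE; case: eqP => [->|_].
have /andP[h1 h2] := xr' i; have h := lt_trans h1 h2.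
by rewrite sup_itv ?inf_itv.
Qed.

Let sides := [set side_length P.1 P.2 | P in cells Om G `*` [set: 'I_n.+1]].

(** For an unbounded set [sup] would be a default value that says nothing about the sides. *)
Let has_ubound_sides : has_ubound sides.
Proof.
exists (\sum_i l ord0 i) => _ [[P i] [/= /cells_gcell[r -> r0] _] <-].
rewrite side_gcell//; have h1 := nodes_le (grid_node_padded i) (r i).+1.
have h2 := nodes_ge (grid_node_padded i) (r i).
apply: (@le_trans _ _ (l ord0 i)); first by lra.
by rewrite (bigD1 i)//= lerDl sumr_ge0// => j _; rewrite ltW.
Qed.

Let side_le_mesh r i : C r !=set0 -> grid_node i (r i).+1 - grid_node i (r i) <= mesh_size Om G.
Proof.
move=> r0; rewrite -side_gcell//; apply: ub_le_sup => //.
by exists (C r, i) => //; split=> //; apply/cells_gcell; exists r.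
Qed.

Let grid_size_gt0 : (0 < grid_size)%N.
Proof. by apply: (@leq_trans (size (cuts ord0)).+1) => //; exact: (leq_bigmax ord0). Qed.

Let first_step i : grid_node i 0 < grid_node i 1.
Proof.
have [h1 _ h3] := grid_node_padded i; have [[]//|[h _]] := h3 0%N.
by move: h (l_gt0 i); rewrite h1 => h l0; exfalso; lra.
Qed.

(** In the other directions the first slab is taken, which has positive length. Thus every positive
    step of the nodes is a side of some cell and is seen by the mesh size. *)
Let gcell_nonempty (i : 'I_n.+1) (m : 'I_grid_size) : grid_node i m < grid_node i m.+1 ->
  exists2 r, C r !=set0 & r i = m.
Proof.
move=> h; pose r : {ffun 'I_n.+1 -> 'I_grid_size} :=
  [ffun j => if j == i then m else Ordinal grid_size_gt0].
exists r; last by rewrite ffunE eqxx.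
exists (\row_j ((grid_node j (r j) + grid_node j (r j).+1) / 2)).
apply/gcellP => j; rewrite mxE ffunE; case: eqP => [->|_] /=; rewrite ?midf_lt//;
  exact: first_step.
Qed.

Lemma mesh_size_gt0 : 0 < mesh_size Om G.
Proof.
have [r r0 E] := @gcell_nonempty ord0 (Ordinal grid_size_gt0) (first_step ord0).
by apply: lt_le_trans (side_le_mesh ord0 r0); rewrite E /= subr_gt0; exact: first_step.
Qed.

Lemma grid_node_step i m : grid_node i m.+1 - grid_node i m <= mesh_size Om G.
Proof.
have [_ _ h3] := grid_node_padded i; have [[h _]|[-> ->]] := h3 m; last first.
  by rewrite subrr ltW// mesh_size_gt0.
have [mN|Nm] := ltnP m grid_size.
  have [r r0 E] := @gcell_nonempty i (Ordinal mN) h.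
  by have := side_le_mesh i r0; rewrite E.
by move: h; rewrite !(nodes_pad (grid_node_padded i)) ?ltxx// (leq_trans Nm).
Qed.

End grid_nodes.

(** * Energies and Lebesgue spaces of the library *)

Section conversions.
Context {R : realType} {n : nat}.
Variables (a l : 'rV[R]_n.+1).
Hypothesis l_gt0 : forall i, 0 < l ord0 i.
Local Notation Om := (hyperrectangle a l).
Local Notation mu := (lebesgue_on a l).
Local Notation I f := (Rintegral mu setT f).
Local Notation nsq f := (ip mu f f).
Let fin := lebesgue_on_fin a l_gt0.
Implicit Types f u v : 'rV[R]_n.+1 -> R.

Lemma Lnorm_on_sqrt g : L2 mu g -> Lnorm_on a l 2%:E g = (Num.sqrt (nsq g))%:E.
Proof.
move=> Lg; rewrite /Lnorm_on unlock.
have -> : (\int[mu]_x (`|(EFin \o g) x| `^ 2) = (nsq g)%:E)%E.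
  rewrite /ip /Rintegral fineK; last exact: integrable_fin_num (L2_mul Lg Lg).
  apply: eq_integral => x _; have -> : (`|(EFin \o g) x| = (`|g x|%R)%:E)%E by [].
  rewrite poweR_EFin powR_mulrn//.
  by rewrite real_normK ?num_real// expr2.
by rewrite poweR_EFin powR12_sqrt// ip_ge0.
Qed.

Lemma Lfun2P f : f \in Lfun mu 2%:E <-> L2 mu f.
Proof.
split.
  move=> fL; split; last exact: Lfun2_integrable_sqr.
  by move: fL; rewrite inE => /andP[/[!inE]].
move=> Lf; rewrite inE; apply/andP; split; rewrite inE/=; first by case: Lf.
by rewrite /finite_norm -[X in (X < _)%E]/(Lnorm_on a l 2%:E f) Lnorm_on_sqrt// ltry.
Qed.

Lemma energy_rof alpha f u V : L2 mu f -> L2 mu u -> TV Om u = V%:E ->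
  energy a l alpha f u = (rof a l alpha f u V)%:E.
Proof.
move=> Lf Lu TVu; rewrite /energy /rof TVu.
have -> : u \- f = (fun x => u x - f x) by [].
rewrite Lnorm_on_sqrt; last exact: L2B.
by rewrite -EFin_expe sqr_sqrtr ?ip_ge0// -!EFinM -EFinD mulrC.
Qed.

(** Comparison with the zero function, whose energy is finite, shows that the variation of [u] is
    finite. *)
Lemma is_minimizer_rof alpha f u : 0 < alpha -> L2 mu f -> is_minimizer a l alpha f u ->
  exists V, is_rof a l alpha f u V.
Proof.
move=> al0 Lf [/Lfun2P Lu H].
have L0 : L2 mu (cst 0) by apply: (L2_bounded fin (M := 0)) => // x; rewrite normr0.
have TV0 : TV Om (cst 0 : 'rV[R]_n.+1 -> R) = 0%:E.
  by apply/eqP; rewrite eq_le TV_ge0 andbT; exact: TV_cst0.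
have := H _ ((Lfun2P _).2 L0); rewrite (energy_rof _ Lf L0 TV0) => h.
have [V TVu _] : exists2 V, TV Om u = V%:E & 0 <= V.
  apply: TV_finE; rewrite ltNge leye_eq; apply/negP => /eqP TVu.
  move: h; rewrite /energy TVu (_ : u \- f = (fun x => u x - f x))//.
  rewrite Lnorm_on_sqrt; last exact: L2B.
  by rewrite -EFin_expe -EFinM gt0_muley ?lte_fin// addey// leye_eq.
exists V; apply: is_rof_of_le => // w W Lw TVw.
by rewrite -lee_fin -!energy_rof//; apply: H; exact/Lfun2P.
Qed.

Lemma Lfun_powR_integ f q : 1 <= q -> f \in Lfun mu q%:E -> integ mu (fun x => `|f x| `^ q).
Proof. by move=> q1 fq; exact: Lfun_integrable. Qed.

Lemma Lfun_pinfty_bounded f : f \in Lfun mu +oo%E ->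
  exists2 M, 0 <= M & {ae mu, forall x, `|f x| <= M}.
Proof.
rewrite inE => /andP[/[!inE]/= mf]; rewrite /finite_norm unlock.
case: ifPn => [mu0|]; last first.
  (* For a null measure the norm is 0 by convention and any bound holds almost everywhere. *)
  rewrite -leNgt => mu0 _; exists 0 => //; exists setT; split=> //.
  by apply/eqP; rewrite eq_le mu0 measure_ge0.
move=> /ess_sup_inf.ess_supr_bounded[M fM]; exists (Num.max 0 M); first by rewrite le_max lexx.
by apply: filterS fM => x; rewrite le_max => ->; rewrite orbT.
Qed.

End conversions.

Lemma conj_ratioE (R : realType) (q : R) : 2 <= q -> conj_ratio q%:E = (q - 1)^-1.
Proof.
move=> q2; have q0 : q != 0 by rewrite gt_eqF// (lt_le_trans _ q2).
have q1 : q - 1 != 0 by rewrite subr_eq0 gt_eqF// (lt_le_trans _ q2)// ltr1n.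
rewrite /conj_ratio /hoelder_conjugate /= eqe (negbTE q0) -EFinD !inver (negbTE q0) (negbTE q1) -!EFinM /=.
by rewrite mulrAC divff// mul1r.
Qed.

Lemma conj_ratio_pinfty (R : realType) : conj_ratio (+oo%E : \bar R) = 0.
Proof. by rewrite /conj_ratio hoelder_conjugatey invey mule0. Qed.

Lemma ereal_bigO_le (R : realType) (e : nat -> \bar R) (x b : nat -> R) (C : R) :
  (forall k, e k = (x k)%:E) -> (forall k, 0 <= b k) -> (forall k, `|x k| <= C * b k) ->
  ereal_bigO e b.
Proof.
move=> ex b0 xb; split; first by apply: nearW => k; rewrite ex.
apply/eqOP; apply: filterS (nbhs_pinfty_ge (num_real C)) => M CM.
apply: nearW => k; rewrite ex /=.
by apply: le_trans (xb k) _; rewrite (ger0_norm (b0 k)) ler_wpM2r.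
Qed.

Lemma cvg_real_ereal (R : realType) (e : nat -> \bar R) (x : nat -> R) (y : R) :
  (forall k, e k = (x k)%:E) -> x k @[k --> \oo] --> y -> e k @[k --> \oo] --> y%:E.
Proof.
move=> ex xy; apply/fine_cvgP; split; first by apply: nearW => k; rewrite ex.
by rewrite (_ : fine \o e = x)//; apply/funext => k /=; rewrite ex.
Qed.

(** * Convergence and rates for the given grids *)

Theorem corollary5p6 (R : realType) (d : nat) (d_gt0 : (0 < d)%N)
    (a l : 'rV[R]_d) (l_gt0 : forall i, 0 < l ord0 i)
    (alpha : R) (alpha_gt0 : 0 < alpha)
    (G : nat -> {fset 'I_d * R})
    (G_grid : forall k, is_grid (hyperrectangle a l) (G k))
    (G_mesh : mesh_size (hyperrectangle a l) (G k) @[k --> \oo] --> 0)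
    (f : 'rV[R]_d -> R) (f_L2 : f \in Lfun (lebesgue_on a l) 2%:E)
    (u : 'rV[R]_d -> R) (u_min : is_minimizer a l alpha f u)
    (uk : nat -> 'rV[R]_d -> R)
    (uk_min : forall k,
      is_minimizer a l alpha (averaging (hyperrectangle a l) (G k) f) (uk k)) :
  let Omega := hyperrectangle a l in
  let h k := mesh_size Omega (G k) in
  let dist_k k := Lnorm_on a l 2%:E (uk k \- u) in
  let TV_gap k := `|TV Omega (uk k) - TV Omega u|%E in
  let energy_k k := energy a l alpha (averaging Omega (G k) f) (uk k) in
  let energy_gap k := `|energy_k k - energy a l alpha f u|%E in
  [/\ [/\ dist_k k @[k --> \oo] --> 0%E,
          TV Omega (uk k) @[k --> \oo] --> TV Omega u &
          energy_k k @[k --> \oo] --> energy a l alpha f u],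
      forall q : \bar R, (2%:E <= q)%E -> f \in Lfun (lebesgue_on a l) q ->
        [/\ ereal_bigO dist_k (fun k => h k `^ (1 / 2 - conj_ratio q / 2)),
            ereal_bigO TV_gap (fun k => h k `^ (1 / 2 - conj_ratio q / 2)) &
            d = 1%N ->
              ereal_bigO dist_k (fun k => h k `^ (1 / 2 - fine q^-1 / 2)) /\
              ereal_bigO TV_gap (fun k => h k `^ (1 / 2 - fine q^-1 / 2))] &
      forall q : \bar R, (2%:E <= q)%E -> f \in Lfun (lebesgue_on a l) q ->
        is_BV a l f ->
        ereal_bigO energy_gap (fun k => h k `^ (1 - conj_ratio q)) /\
        (d = 1%N ->
          ereal_bigO energy_gap (fun k => h k `^ (1 - fine q^-1)))].
Proof.
case: d d_gt0 a l l_gt0 G G_grid G_mesh f f_L2 u u_min uk uk_min => [//|n] _ a l l_gt0.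
move=> G _ h_cvg0 f /Lfun2P Lf u u_min uk uk_min Omega h dist_k TV_gap energy_k energy_gap.
have fin := lebesgue_on_fin a l_gt0; have iF := L2_integ fin Lf.
pose N k := grid_size a l (G k); pose p k := grid_node a l (G k).
pose A k g := avg (lebesgue_on a l) (@gcell _ _ (N k) (p k)) g.
have Hp k : is_padded a l (N k) (p k) by exact: grid_node_padded.
have Hh k i m : p k i m.+1 - p k i m <= h k by exact: grid_node_step.
have h0 k : 0 < h k by exact: mesh_size_gt0.
have avgE k : averaging Omega (G k) f = A k f by exact: averaging_gcell.
have LA k : L2 (lebesgue_on a l) (A k f) by apply: step_L2 => //; exact: gcell_part.
have [V uP] := is_minimizer_rof l_gt0 alpha_gt0 Lf u_min.
have vPex k : exists W, is_rof a l alpha (A k f) (uk k) W.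
  by have := uk_min k; rewrite avgE; exact: is_minimizer_rof.
pose W k := projT1 (cid (vPex k)).
have vP k : is_rof a l alpha (A k f) (uk k) (W k) by rewrite /W; case: cid.
have [Lu TVu _] := uP; have Lv k : L2 (lebesgue_on a l) (uk k) by case: (vP k).
have TVv k : TV Omega (uk k) = (W k)%:E by case: (vP k).
pose dist k := Num.sqrt (ip (lebesgue_on a l) (fun x => uk k x - u x) (fun x => uk k x - u x)).
have distE k : dist_k k = (dist k)%:E by apply: Lnorm_on_sqrt => //; exact: L2B.
have gapE k : TV_gap k = `|W k - V|%:E by rewrite /TV_gap TVu TVv.
have eE k : energy_k k = (rof a l alpha (A k f) (uk k) (W k))%:E.
  by rewrite /energy_k avgE; exact: energy_rof.
have euE : energy a l alpha f u = (rof a l alpha f u V)%:E by exact: energy_rof.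
have egapE k : energy_gap k = `|rof a l alpha (A k f) (uk k) (W k) - rof a l alpha f u V|%:E.
  by rewrite /energy_gap eE euE.
have rates C e : (forall k, `|ip (lebesgue_on a l) f (fun x => u x - A k u x)| <= C * h k `^ e) ->
    ereal_bigO dist_k (fun k => h k `^ (e / 2)) /\ ereal_bigO TV_gap (fun k => h k `^ (e / 2)).
  move=> /(rof_rate l_gt0 Hp alpha_gt0 Lf uP vP)[C' H]; split.
    apply: (ereal_bigO_le (C := C') distE) => k; first exact: powR_ge0.
    by rewrite (ger0_norm (sqrtr_ge0 _)); have [] := H k.
  apply: (ereal_bigO_le (C := C') gapE) => k; first exact: powR_ge0.
  by rewrite normr_id; have [] := H k.
have energy_rates C e : (forall k, `|ip (lebesgue_on a l) f (fun x => f x - A k f x)| <= C * h k `^ e) ->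
    ereal_bigO energy_gap (fun k => h k `^ e).
  move=> /(rof_energy_rate l_gt0 Hp alpha_gt0 Lf uP vP) H.
  apply: (ereal_bigO_le (C := C) egapE) => k; first exact: powR_ge0.
  by rewrite normr_id; exact: H.
have half_exp s : 1 / 2 - s / 2 = (1 - s) / 2 :> R by rewrite mulrBl.
have fBV : is_BV a l f -> exists Vf, TV Omega f = Vf%:E.
  by move=> [_ /TV_finE[Vf E _]]; exists Vf.
(* In dimension one all averages of [g] share one bound, and [g] inherits it almost everywhere as
   their L^1 limit. *)
have bounded_rate g Vg : n = 0%N -> L2 (lebesgue_on a l) g -> TV Omega g = Vg%:E -> forall q, 1 <= q ->
    integ (lebesgue_on a l) (fun x => `|f x| `^ q) ->
    exists C, forall k, `|ip (lebesgue_on a l) f (fun x => g x - A k g x)| <= C * h k `^ (1 - q^-1).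
  move=> n0; subst n => Lg TVg q q1 ifq.
  have AB k x : `|A k g x| <= Vg + `|Rintegral (lebesgue_on a l) setT g| / fine (lebesgue_on a l setT).
    exact: avg_bound_dim1.
  have ig := L2_integ fin Lg.
  have B0 : 0 <= Vg + `|Rintegral (lebesgue_on a l) setT g| / fine (lebesgue_on a l setT).
    by apply: le_trans (AB 0%N 0); exact: normr_ge0.
  have LAg k : L2 (lebesgue_on a l) (A k g) by apply: step_L2 => //; exact: gcell_part.
  have gB := limit_ae_bounded ig (fun k => L2_integ fin (LAg k))
    (grid_avg_L1_cvg l_gt0 Hp Hh h_cvg0 Lg TVg) B0 AB.
  exact: (grid_pairing_bound_bounded l_gt0 Hp Hh h0 Lf Lg TVg q1 ifq AB gB).
split.
- split.
  + by apply: (cvg_real_ereal distE); exact: (rof_dist_cvg l_gt0 Hp Hh h_cvg0 alpha_gt0 Lf uP vP).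
  + rewrite TVu; apply: (cvg_real_ereal TVv); exact: (rof_TV_cvg l_gt0 Hp Hh h_cvg0 alpha_gt0 Lf uP vP).
  + rewrite euE; apply: (cvg_real_ereal eE); apply/subr_cvg0.
    exact: (rof_energy_cvg l_gt0 Hp Hh h_cvg0 alpha_gt0 Lf uP vP).
- move=> [q| |]// q2 fq; rewrite !half_exp; last first.
    have [M M0 fM] := Lfun_pinfty_bounded fq.
    have [C H] := grid_pairing_bound_ess l_gt0 Hp Hh Lf Lu TVu M0 fM.
    (* For bounded [f] no truncation occurs; the exponent 1 is written 1 - 0 to match both
       conventions at q = +oo. *)
    have H1 k : `|ip (lebesgue_on a l) f (fun x => u x - A k u x)| <= C * h k `^ (1 - 0).
      by rewrite subr0 (powRr1 (ltW (h0 k))); exact: H.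
    have [r1 r2] := rates _ _ H1.
    by rewrite conj_ratio_pinfty invey.
  rewrite lee_fin in q2; have q1 : 1 < q by rewrite (lt_le_trans _ q2)// ltr1n.
  have ifq := Lfun_powR_integ (ltW q1) fq.
  have iuq := rof_powR_integ l_gt0 Hp Hh h_cvg0 alpha_gt0 Lf uP vP q1 ifq.
  rewrite conj_ratioE//.
  have [C H] := grid_pairing_bound l_gt0 Hp Hh h0 Lf Lu TVu q2 ifq iuq.
  have [r1 r2] := rates _ _ H; split=> // -[n0].
  have [C1 H1] := bounded_rate _ _ n0 Lu TVu _ (ltW q1) ifq.
  by rewrite inver gt_eqF ?(lt_trans ltr01)//=; exact: rates H1.
- move=> [q| |]// q2 fq /fBV[Vf TVf]; last first.
    have [M M0 fM] := Lfun_pinfty_bounded fq.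
    have [C H] := grid_pairing_bound_ess l_gt0 Hp Hh Lf Lf TVf M0 fM.
    have H1 k : `|ip (lebesgue_on a l) f (fun x => f x - A k f x)| <= C * h k `^ (1 - 0).
      by rewrite subr0 (powRr1 (ltW (h0 k))); exact: H.
    have r1 := energy_rates _ _ H1.
    by rewrite conj_ratio_pinfty invey.
  rewrite lee_fin in q2; have q1 : 1 < q by rewrite (lt_le_trans _ q2)// ltr1n.
  have ifq := Lfun_powR_integ (ltW q1) fq.
  rewrite conj_ratioE//.
  have [C H] := grid_pairing_bound l_gt0 Hp Hh h0 Lf Lf TVf q2 ifq ifq.
  split; first exact: energy_rates H.
  move=> [n0]; have [C1 H1] := bounded_rate _ _ n0 Lf TVf _ (ltW q1) ifq.
  by rewrite inver gt_eqF ?(lt_trans ltr01)//=; exact: energy_rates H1.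
Qed.
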